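(* Let $H$ be a Gaussian Hilbert space and suppose that $X$ is a random variable such that (i) $X-\mathbb E X\in H^{:2:}$; (ii) $X\ge0$ a.s. and $\Pr(X<\varepsilon)>0$ for every $\varepsilon>0$; (iii) the bilinear form $\mathcal B(\xi,\eta):=\frac12\mathbb E\bigl((X-\mathbb E X)\xi\eta\bigr)$, $\xi,\eta\in H$, is positive, i.e. $\mathcal B(\xi,\xi)\ge0$ for all $\xi\in H$. Let $(\lambda_j)_{j=1}^N$, $0\le N\le\infty$, be the non-zero eigenvalues (with multiplicity) of the compact symmetric operator on $H$ associated with $\mathcal B$. Then every $\lambda_j>0$, \[ X\overset{d}{=}\sum_{j=1}^N\lambda_j\xi_j^2 \] with $\xi_j$ i.i.d. $N(0,1)$, $\mathbb E X=\sum_{j=1}^N\lambda_j<\infty$, and for all real $t<(2\max_j\lambda_j)^{-1}$, \[ \mathbb E e^{tX}=\prod_j(1-2\lambda_jt)^{-1/2}. \]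
   Context: A Gaussian Hilbert space is a closed subspace $H$ of $L^2_{\mathbb R}(\Omega,\mathcal F,\Pr)$ every element of which is a centered Gaussian random variable. For $\xi,\eta\in H$ the Wick product is $:\!\xi\eta\!:\,=\xi\eta-\mathbb E(\xi\eta)$, and $H^{:2:}$ is the closed linear span in $L^2$ of all Wick products $:\!\xi\eta\!:$ with $\xi,\eta\in H$. For $Y\in H^{:2:}$ the form $(\xi,\eta)\mapsto\frac12\mathbb E(Y\xi\eta)$ on $H$ is a bounded symmetric bilinear form given by a compact symmetric operator on $H$. *)

(* Defs.v *)
From HB Require Import structures.
From mathcomp Require Import all_boot all_order all_algebra.
From mathcomp Require Import all_classical all_reals all_analysis.

Set Implicit Arguments.
Unset Strict Implicit.
Unset Printing Implicit Defensive.

Import Order.TTheory GRing.Theory Num.Theory.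
Import numFieldNormedType.Exports.

Local Open Scope classical_set_scope.
Local Open Scope ring_scope.

Section gaussian_defs.
Context {d : measure_display} {T : measurableType d} {R : realType}
  (P : probability T R).

Definition centered_gaussian (xi : T -> R) : Prop :=
  measurable_fun setT xi /\
  ((P [set w | xi w = 0] = 1%E) \/
   exists s : R, 0 < s /\
     forall A : set R, measurable A -> P (xi @^-1` A) = normal_prob 0 s A).

Definition L2dist2 (f g : T -> R) : \bar R :=
  ('E_P[fun w => ((f w - g w) ^+ 2)%R])%E.

(* A Gaussian Hilbert space, represented by the set of all representatives
   of its elements: a closed linear subspace of L^2(P) (closed under
   a.e.-modification, linear combinations and L^2 limits), every element of
   which is a centered Gaussian variable. *)
Definition gaussian_hilbert_space (H : set (T -> R)) : Prop :=
  [/\ H (fun _ => 0),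
      (forall xi eta (a b : R), H xi -> H eta ->
         H (fun w => a * xi w + b * eta w)),
      (forall xi eta, H xi -> measurable_fun setT eta ->
         {ae P, forall w, eta w = xi w} -> H eta),
      (forall (u : nat -> T -> R) xi, (forall n, H (u n)) ->
         measurable_fun setT xi ->
         L2dist2 (u n) xi @[n --> \oo] --> 0%E -> H xi) &
      (forall xi, H xi -> centered_gaussian xi)].

Definition wick (xi eta : T -> R) : T -> R :=
  fun w => xi w * eta w - fine ('E_P[fun v => (xi v * eta v)%R])%E.

Definition wick_chaos2 (H : set (T -> R)) : set (T -> R) :=
  [set Y | measurable_fun setT Y /\
    forall eps : R, 0 < eps ->
      exists (n : nat) (c : nat -> R) (xs ys : nat -> T -> R),
        (forall i, (i < n)%N -> H (xs i) /\ H (ys i)) /\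
        (L2dist2 Y (fun w => (\sum_(i < n) c i * wick (xs i) (ys i) w)%R)
           < eps%:E)%E].

Definition Bform (Y xi eta : T -> R) : \bar R :=
  ((2^-1)%:E * 'E_P[fun w => (Y w * xi w * eta w)%R])%E.

(* eigenspace of the operator associated with B for the value mu:
   the xi in H with B(xi, eta) = mu <xi, eta> for all eta in H *)
Definition eigenspace (H : set (T -> R)) (Y : T -> R) (mu : R)
  : set (T -> R) :=
  [set xi | H xi /\ forall eta, H eta ->
     Bform Y xi eta = (mu%:E * 'E_P[fun w => (xi w * eta w)%R])%E].

Definition has_orthonormal (S : set (T -> R)) (m : nat) : Prop :=
  exists f : nat -> T -> R,
    (forall i, (i < m)%N -> S (f i)) /\
    forall i k, (i < m)%N -> (k < m)%N ->
      ('E_P[fun w => (f i w * f k w)%R] = ((i == k)%:R)%:E)%E.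

End gaussian_defs.

(* index set {0, ..., N-1} (N = Some n) or all of nat (N = None, i.e. N = oo) *)
Definition index_set (N : option nat) (j : nat) : bool :=
  if N is Some n then (j < n)%N else true.

(* lam_j, j in index_set N, lists the non-zero eigenvalues with multiplicity:
   every lam_j is non-zero and for every mu <> 0 and every m, mu occurs at
   least m times iff the eigenspace of mu has dimension at least m. *)
Definition enumerates_nonzero_eigenvalues {d : measure_display}
  {T : measurableType d} {R : realType} (P : probability T R)
  (H : set (T -> R)) (Y : T -> R) (N : option nat) (lam : nat -> R) : Prop :=
  (forall j, index_set N j -> lam j != 0) /\
  forall mu : R, mu != 0 -> forall m : nat,
    (exists s : seq nat, [/\ uniq s, size s = m &
        forall j, j \in s -> index_set N j /\ lam j = mu])
    <-> has_orthonormal P (eigenspace P H Y mu) m.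

Definition iid_std_normal {d' : measure_display} {T' : measurableType d'}
  {R : realType} (P' : probability T' R) (xi : nat -> T' -> R) : Prop :=
  [/\ (forall j, measurable_fun setT (xi j)),
      (forall j (A : set R), measurable A ->
         P' (xi j @^-1` A) = normal_prob 0 1 A) &
      (forall (s : seq nat) (A : nat -> set R), uniq s ->
         (forall j, measurable (A j)) ->
         P' (\bigcap_(j in [set j | j \in s]) (xi j @^-1` A j)) =
         (\prod_(j <- s) P' (xi j @^-1` A j))%E)].

(* Main.v *)
(** The form B is represented by a bounded operator A on H, and A has enough
    eigenvectors: power iteration from any xi with B(xi, xi) > 0 converges to a
    non-zero eigenvector, since otherwise infinitely many normalised iterates would
    be almost orthogonal, contradicting a Bessel inequality for Y = X - E X.  For an
    orthonormal family (e_j) of eigenvectors this gives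
    Y = sum_j lam_j (e_j^2 - 1) in L^2.

    Put T_n = sum_(j < n) lam_j e_j^2 and Lam_n = E T_n.  Testing X >= 0 against
    exp(- s T_n) and letting s -> oo gives Lam_n <= E X.  So T_n increases a.s. to
    an integrable Z, and X = Z + (E X - lim Lam_n) a.s.; because X takes values
    arbitrarily close to 0, the constant vanishes and X = sum_j lam_j e_j^2 a.s.

    The Laplace transform and moment generating function of T_n come from writing
    exp(- b y^2 / 2) (resp. exp(b y^2 / 2)) as a Gaussian average of cos(sqrt b g y)
    (resp. exp(sqrt b g y)), which reduces them to those of single elements of H; a
    law on the half-line is determined by its Laplace transform. *)

Require Import Defs.
From HB Require Import structures.
From mathcomp Require Import all_boot all_order all_algebra.
From mathcomp Require Import all_classical all_reals all_analysis.
From mathcomp Require Import measurable_realfun ring lra.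

Set Implicit Arguments.
Unset Strict Implicit.
Unset Printing Implicit Defensive.

Import Order.TTheory GRing.Theory Num.Theory.
Import numFieldNormedType.Exports.

Local Open Scope classical_set_scope.
Local Open Scope ring_scope.

(** * The space L^2 of a probability measure *)

(** Hypothesis (i) bounds only sum lam_j^2; nothing bounds sum lam_j at the start, so E X = sum
    lam_j cannot be read off the expansion. This is why the weights exp(- s T_n) appear: under them
    T_n has mean O(1/s), while T_m - T_n keeps its mean Lam_m - Lam_n for m > n. The weighted mean
    of X therefore tends to E X - Lam_n as s grows, and X >= 0 makes it nonnegative.

    The role of compactness is played by one inequality: k nearly orthogonal unit vectors with
    B(e_i, e_i) >= beta satisfy k beta^2 <= E Y^2. Besides keeping the limit of power iteration away
    from 0, it makes multiplicities finite, so that the given list of eigenvalues can be matched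
    with an orthonormal family.

    Elements of H are only known to be Gaussian one at a time. Joint information comes from
    linearity of H: mixed fourth moments by polarisation, exponentials of several squares by
    averaging over linear combinations. *)

Section discriminant.
Context {R : realType}.

(** The case [c = 0] is included because the lemma serves both the L^2 product and the merely
    semidefinite form [quad_form]. *)
Lemma psd_quadratic_discr (a b c : R) :
  (forall t, 0 <= a + (b * t) *+ 2 + c * t ^+ 2) -> b ^+ 2 <= a * c.
Proof.
move=> h.
have c0 : 0 <= c.
  rewrite leNgt; apply/negP => c0.
  have := h ((b - 1) / c); have := h ((b + 1) / c); have := h (- (b - 1) / c).
  have := h (- (b + 1) / c).
  have a0 : 0 <= a by have := h 0; rewrite mulr0 expr0n/= mulr0 mul0rn !addr0.
  move=> _ _ _ _.
  (* For [c < 0], this [t >= 1], taken with the sign opposite to [b], gives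
     [- c * t = 2|b| + a + 1 - c]; the quadratic is then at most [a - (a + 1) t < 0]. *)
  pose t := (`|b| *+ 2 + a + 1) / - c + 1.
  have := h (if 0 <= b then - t else t).
  have t1 : 1 <= t.
    by rewrite lerDr divr_ge0 ?oppr_ge0 ?(ltW c0)// !addr_ge0// mulrn_wge0.
  have ct : - c * t = `|b| *+ 2 + a + 1 - c.
    by rewrite /t mulrDr mulr1 mulrCA divff ?mulr1// oppr_eq0 lt_eqF.
  have -> : (b * (if 0 <= b then - t else t)) *+ 2 = - (`|b| * t) *+ 2.
    have [b0|b0] := leP 0 b; first by rewrite ger0_norm// mulrN.
    by rewrite ltr0_norm// mulNr opprK.
  have -> : (if 0 <= b then - t else t) ^+ 2 = t ^+ 2 by case: ifP; rewrite ?sqrrN.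
  have b0 := normr_ge0 b.
  rewrite leNgt => /negP; apply.
  have -> : c * t ^+ 2 = - ((`|b| *+ 2 + a + 1 - c) * t) by rewrite -ct; ring.
  nra.
have [c0'|c0'] := eqVneq c 0; last first.
  have cp : 0 < c by rewrite lt_neqAle eq_sym c0' c0.
  have := h (- b / c).
  have -> : a + (b * (- b / c)) *+ 2 + c * (- b / c) ^+ 2 = (a * c - b ^+ 2) / c.
    by field.
  by rewrite pmulr_lge0 ?invr_gt0// subr_ge0.
rewrite c0' mulr0 -(mulr0 b) expr2.
have [->|b0] := eqVneq b 0; first by rewrite mulr0.
(* With [c = 0] the expression is affine in [t], and at this point it equals -1. *)
have := h (- (a + 1) / (b *+ 2)).
have -> : a + (b * (- (a + 1) / (b *+ 2))) *+ 2 + c * (- (a + 1) / (b *+ 2)) ^+ 2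
   = -1 by rewrite c0'; field.
by rewrite lerNr oppr0 ler10.
Qed.

End discriminant.

Section L2.
Context {d : measure_display} {T : measurableType d} {R : realType}
  (P : probability T R).
Implicit Types (f g h : T -> R).

Local Notation Int f := (P.-integrable [set: T] (EFin \o f)).

(** Functions are kept as representatives, as in [gaussian_hilbert_space]; [L2dot] is a real
    [Rintegral], so its bilinearity is stated under membership in [L2]. *)
Definition L2 f := measurable_fun setT f /\ Int (fun x => f x ^+ 2).

Definition L2dot f g : R := \int[P]_x (f x * g x).

Lemma Int_ext f g : f =1 g -> Int f -> Int g.
Proof. by move=> /funext ->. Qed.

Lemma IntD f g : Int f -> Int g -> Int (fun x => f x + g x).
Proof. by move=> fi gi; exact: (integrableD measurableT fi gi). Qed.

Lemma IntZ (a : R) f : Int f -> Int (fun x => a * f x).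
Proof. by move=> fi; exact: (integrableZl measurableT a fi). Qed.

Lemma Int_cst (a : R) : Int (fun=> a).
Proof. exact: finite_measure_integrable_cst. Qed.

Lemma Int_sum (I : Type) (s : seq I) (Q : pred I) (F : I -> T -> R) :
  (forall i, Q i -> Int (F i)) -> Int (fun x => \sum_(i <- s | Q i) F i x).
Proof.
move=> h; have := @integrable_sum _ _ _ P _ measurableT _ s Q (fun i => EFin \o F i) h.
by apply: eq_integrable => // x _; rewrite /= sumEFin.
Qed.

Lemma Int_le f g : measurable_fun setT f -> (forall x, `|f x| <= g x) ->
  Int g -> Int f.
Proof.
move=> mf fg; apply: le_integrable => //; first exact/measurable_EFinP.
by move=> x _ /=; rewrite lee_fin (le_trans (fg x))// ler_norm.
Qed.

Lemma Int_measurable f : Int f -> measurable_fun setT f.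
Proof. by move=> /measurable_int/measurable_EFinP. Qed.

Lemma Int_bounded f (M : R) : measurable_fun setT f -> (forall x, `|f x| <= M) ->
  Int f.
Proof. by move=> mf fM; apply: (Int_le mf fM); exact: Int_cst. Qed.

Lemma RintD f g : Int f -> Int g ->
  \int[P]_x (f x + g x) = \int[P]_x f x + \int[P]_x g x.
Proof. by move=> fi gi; rewrite RintegralD. Qed.

Lemma RintZ (a : R) f : Int f -> \int[P]_x (a * f x) = a * \int[P]_x f x.
Proof. by move=> fi; rewrite RintegralZl. Qed.

Lemma Rint_cst (a : R) : \int[P]_x a = a.
Proof. by rewrite Rintegral_cst//= probability_setT mulr1. Qed.

Lemma Rint_sum (I : Type) (s : seq I) (Q : pred I) (F : I -> T -> R) :
  (forall i, Q i -> Int (F i)) ->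
  \int[P]_x (\sum_(i <- s | Q i) F i x) = \sum_(i <- s | Q i) \int[P]_x F i x.
Proof.
move=> h; elim: s => [|a s ih].
  by rewrite big_nil; under eq_Rintegral do rewrite big_nil; rewrite Rint_cst.
under eq_Rintegral do rewrite big_cons; rewrite big_cons.
by case: ifPn => // Qa; rewrite RintD ?ih//; [exact: h|exact: Int_sum].
Qed.

Lemma Rint_le f g : Int f -> Int g -> (forall x, f x <= g x) ->
  \int[P]_x f x <= \int[P]_x g x.
Proof. by move=> fi gi fg; apply: le_Rintegral. Qed.

Lemma EFin_Rint f : Int f -> (\int[P]_x f x)%:E = (\int[P]_x (f x)%:E)%E.
Proof. by move=> fi; rewrite /Rintegral fineK//; exact: integrable_fin_num. Qed.

Lemma EFin_expectation f : Int f -> 'E_P[f]%E = (\int[P]_x f x)%:E.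
Proof. by move=> fi; rewrite unlock EFin_Rint. Qed.

Lemma ge0_Int f : measurable_fun setT f -> (forall x, 0 <= f x) ->
  (\int[P]_x (f x)%:E < +oo)%E -> Int f.
Proof.
move=> mf f0 foo; apply/integrableP; split; first exact/measurable_EFinP.
by under eq_integral do rewrite gee0_abs ?lee_fin//.
Qed.

Lemma L2_measurable f : L2 f -> measurable_fun setT f.
Proof. by case. Qed.

Lemma L2_sqr f : L2 f -> Int (fun x => f x ^+ 2).
Proof. by case. Qed.

Lemma L2M f g : L2 f -> L2 g -> Int (fun x => f x * g x).
Proof.
move=> [mf fi] [mg gi]; apply: (@Int_le _ (fun x => f x ^+ 2 + g x ^+ 2)).
- exact: measurable_funM.
- move=> x; rewrite normrM -(real_normK (num_real (f x))).
  rewrite -(real_normK (num_real (g x))).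
  have := sqr_ge0 (`|f x| - `|g x|); have := normr_ge0 (f x).
  have := normr_ge0 (g x); nra.
- exact: IntD.
Qed.

Lemma L2_Int f : L2 f -> Int f.
Proof.
move=> [mf fi]; apply: (@Int_le _ (fun x => f x ^+ 2 + 1)) => //.
- move=> x; rewrite -(real_normK (num_real (f x))).
  have := sqr_ge0 (`|f x| - 1); have := normr_ge0 (f x); nra.
- by apply: IntD => //; exact: Int_cst.
Qed.

Lemma L2_cst (a : R) : L2 (fun=> a).
Proof. by split => //; exact: Int_cst. Qed.

Lemma L2_lin (a b : R) f g : L2 f -> L2 g -> L2 (fun x => a * f x + b * g x).
Proof.
move=> L2f L2g; split.
  by apply: measurable_funD; apply: measurable_funM => //; apply: L2_measurable.
apply: (@Int_ext (fun x => a ^+ 2 * f x ^+ 2 +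
   ((a * b) *+ 2 * (f x * g x) + b ^+ 2 * g x ^+ 2))).
  by move=> x; ring.
by do ?apply: IntD; apply: IntZ; [case: L2f| exact: L2M| case: L2g].
Qed.

Lemma L2Z (a : R) f : L2 f -> L2 (fun x => a * f x).
Proof.
move=> L2f; have := L2_lin a 0 L2f L2f.
by under eq_fun do rewrite mul0r addr0.
Qed.

Lemma L2D f g : L2 f -> L2 g -> L2 (fun x => f x + g x).
Proof.
move=> L2f L2g; have := L2_lin 1 1 L2f L2g.
by under eq_fun do rewrite !mul1r.
Qed.

Lemma L2B f g : L2 f -> L2 g -> L2 (fun x => f x - g x).
Proof.
move=> L2f L2g; have := L2_lin 1 (-1) L2f L2g.
by under eq_fun do rewrite mul1r mulN1r.
Qed.

Lemma L2_sum (I : Type) (s : seq I) (Q : pred I) (F : I -> T -> R) :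
  (forall i, Q i -> L2 (F i)) -> L2 (fun x => \sum_(i <- s | Q i) F i x).
Proof.
move=> h; elim: s => [|a s ih].
  rewrite (_ : (fun x => _) = fun=> 0); first exact: L2_cst.
  by apply/funext => x; rewrite big_nil.
have [Qa|Qa] := boolP (Q a).
  rewrite (_ : (fun x => _) = fun x => F a x + \sum_(i <- s | Q i) F i x).
    by apply: L2D => //; exact: h.
  by apply/funext => x; rewrite big_cons Qa.
rewrite (_ : (fun x => _) = fun x => \sum_(i <- s | Q i) F i x)//.
by apply/funext => x; rewrite big_cons (negbTE Qa).
Qed.

Lemma L2_bounded f (M : R) : measurable_fun setT f -> (forall x, `|f x| <= M) ->
  L2 f.
Proof.
move=> mf fM; split => //; apply: (@Int_bounded _ (M ^+ 2)).
  exact: measurable_funX.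
by move=> x; rewrite normrX lerXn2r ?nnegrE// (le_trans _ (fM x)).
Qed.

Lemma dotC f g : L2dot f g = L2dot g f.
Proof. by apply: eq_Rintegral => x _; rewrite mulrC. Qed.

Lemma dot_linl (a b : R) f g h : L2 f -> L2 g -> L2 h ->
  L2dot (fun x => a * f x + b * g x) h = a * L2dot f h + b * L2dot g h.
Proof.
move=> L2f L2g L2h; rewrite /L2dot -!RintZ ?L2M// -RintD; last 2 first.
- by apply: IntZ; exact: L2M.
- by apply: IntZ; exact: L2M.
by apply: eq_Rintegral => x _; ring.
Qed.

Lemma dotZl (a : R) f h : L2 f -> L2 h ->
  L2dot (fun x => a * f x) h = a * L2dot f h.
Proof.
move=> L2f L2h; rewrite /L2dot -RintZ ?L2M//.
by apply: eq_Rintegral => x _; ring.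
Qed.

Lemma dotDl f g h : L2 f -> L2 g -> L2 h ->
  L2dot (fun x => f x + g x) h = L2dot f h + L2dot g h.
Proof.
move=> L2f L2g L2h; rewrite /L2dot -RintD ?L2M//.
by apply: eq_Rintegral => x _; ring.
Qed.

Lemma dotBl f g h : L2 f -> L2 g -> L2 h ->
  L2dot (fun x => f x - g x) h = L2dot f h - L2dot g h.
Proof.
move=> L2f L2g L2h; rewrite /L2dot -RintegralB ?L2M//.
by apply: eq_Rintegral => x _; ring.
Qed.

Lemma dot_linr (a b : R) f g h : L2 f -> L2 g -> L2 h ->
  L2dot h (fun x => a * f x + b * g x) = a * L2dot h f + b * L2dot h g.
Proof. by move=> *; rewrite dotC dot_linl// (dotC f) (dotC g). Qed.

Lemma dotZr (a : R) f h : L2 f -> L2 h ->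
  L2dot h (fun x => a * f x) = a * L2dot h f.
Proof. by move=> *; rewrite dotC dotZl// (dotC f). Qed.

Lemma dotDr f g h : L2 f -> L2 g -> L2 h ->
  L2dot h (fun x => f x + g x) = L2dot h f + L2dot h g.
Proof. by move=> *; rewrite dotC dotDl// (dotC f) (dotC g). Qed.

Lemma dotBr f g h : L2 f -> L2 g -> L2 h ->
  L2dot h (fun x => f x - g x) = L2dot h f - L2dot h g.
Proof. by move=> *; rewrite dotC dotBl// (dotC f) (dotC g). Qed.

Lemma dot_suml (I : Type) (s : seq I) (Q : pred I) (F : I -> T -> R) h :
  (forall i, Q i -> L2 (F i)) -> L2 h ->
  L2dot (fun x => \sum_(i <- s | Q i) F i x) h = \sum_(i <- s | Q i) L2dot (F i) h.
Proof.
move=> LF Lh; rewrite /L2dot -Rint_sum//; last by move=> i Qi; apply: L2M => //; exact: LF.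
by apply: eq_Rintegral => x _; rewrite big_distrl.
Qed.

Lemma dot_sumr (I : Type) (s : seq I) (Q : pred I) (F : I -> T -> R) h :
  (forall i, Q i -> L2 (F i)) -> L2 h ->
  L2dot h (fun x => \sum_(i <- s | Q i) F i x) = \sum_(i <- s | Q i) L2dot h (F i).
Proof.
by move=> *; rewrite dotC dot_suml//; apply: eq_bigr => i _; rewrite dotC.
Qed.

Lemma dot_ge0 f : 0 <= L2dot f f.
Proof. by apply: Rintegral_ge0 => x _; rewrite -expr2 sqr_ge0. Qed.

Lemma cauchy_schwarz f g : L2 f -> L2 g -> (L2dot f g) ^+ 2 <= L2dot f f * L2dot g g.
Proof.
move=> Lf Lg; apply: psd_quadratic_discr => t.
have := dot_ge0 (fun x => 1 * f x + t * g x).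
have Lfg := L2_lin 1 t Lf Lg.
rewrite dot_linl// !dot_linr// (dotC g f).
by congr (0 <= _); ring.
Qed.

Lemma dot_norm_le f g (a b : R) : L2 f -> L2 g -> 0 <= a -> 0 <= b ->
  L2dot f f <= a ^+ 2 -> L2dot g g <= b ^+ 2 -> `|L2dot f g| <= a * b.
Proof.
move=> Lf Lg a0 b0 fa gb.
rewrite -(@ler_pXn2r _ 2)// ?nnegrE ?mulr_ge0//.
rewrite real_normK ?num_real// (le_trans (cauchy_schwarz Lf Lg))//.
by rewrite exprMn ler_pM// dot_ge0.
Qed.

Lemma L2dist2E f g : L2 f -> L2 g ->
  L2dist2 P f g = (L2dot (fun x => f x - g x) (fun x => f x - g x))%:E.
Proof.
move=> Lf Lg; have := L2B Lf Lg => -[_ i].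
rewrite /L2dist2 EFin_expectation//; congr EFin.
Qed.

Lemma dotB_sqr f g : L2 f -> L2 g ->
  L2dot (fun x => f x - g x) (fun x => f x - g x) =
  L2dot f f - L2dot f g *+ 2 + L2dot g g.
Proof.
move=> Lf Lg; have Lfg := L2B Lf Lg.
by rewrite dotBl// !dotBr// (dotC g f); ring.
Qed.

Lemma dotD_sqr f g : L2 f -> L2 g ->
  L2dot (fun x => f x + g x) (fun x => f x + g x) =
  L2dot f f + L2dot f g *+ 2 + L2dot g g.
Proof.
move=> Lf Lg; have Lfg := L2D Lf Lg.
by rewrite dotDl// !dotDr// (dotC g f); ring.
Qed.

End L2.

(** * Completeness of L^2 *)

Section riesz_fischer.
Context {d : measure_display} {T : measurableType d} {R : realType}
  (P : probability T R).

Local Notation Int f := (P.-integrable [set: T] (EFin \o f)).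
Local Notation dist2 f g := (L2dot P (fun x => f x - g x) (fun x => f x - g x)).

(** On a probability space the L^1 norm is at most the L^2 norm, so the sum of the increments
    [|v k.+1 - v k|] has mean at most 2. It is finite a.e., and the telescoping series converges
    absolutely there. *)
Lemma ae_cvg_of_summable_dist (v : nat -> T -> R) : (forall k, L2 P (v k)) ->
  (forall k, dist2 (v k.+1) (v k) <= ((2^-1) ^+ k) ^+ 2) ->
  {ae P, forall x, cvgn (v ^~ x)}.
Proof.
move=> Lv dv.
have mv k : measurable_fun setT (v k) by exact: L2_measurable (Lv k).
have Ldv k : L2 P (fun x => v k.+1 x - v k x) by exact: L2B.
pose F (k : nat) x : \bar R := (`|v k.+1 x - v k x|)%:E.
have mF k : measurable_fun setT (F k).
  by apply/measurable_EFinP/measurableT_comp => //; exact: measurable_funB.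
have F0 k x : setT x -> (0 <= F k x)%E by move=> _; rewrite lee_fin.
have iF k : (\int[P]_x F k x <= ((2^-1) ^+ k)%:E)%E.
  have i : Int (fun x => `|v k.+1 x - v k x|).
    by have /(integrable_norm) := L2_Int (Ldv k).
  rewrite /F -EFin_Rint// lee_fin.
  have -> : \int[P]_x `|v k.+1 x - v k x| = L2dot P (fun x => `|v k.+1 x - v k x|) (fun=> 1).
    by apply: eq_Rintegral => x _; rewrite mulr1.
  have L2a : L2 P (fun x => `|v k.+1 x - v k x|).
    split; first by apply: measurableT_comp => //; exact: measurable_funB.
    by apply: Int_ext (L2_sqr (Ldv k)) => x; rewrite real_normK// num_real.
  have := @dot_norm_le _ _ _ P _ (fun=> 1) ((2^-1) ^+ k) 1 L2a (L2_cst P 1).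
  rewrite mulr1 => h; apply: le_trans (ler_norm _) (h _ _ _ _) => //.
    rewrite (le_trans _ (dv k))// le_eqVlt; apply/orP; left; apply/eqP.
    by apply: eq_Rintegral => x _; rewrite -!expr2 real_normK// num_real.
  by rewrite /L2dot Rint_cst expr2.
have fin : (\int[P]_x (\sum_(0 <= k <oo) F k x) < +oo)%E.
  rewrite integral_nneseries//.
  apply: (@le_lt_trans _ _ (\sum_(0 <= k <oo) ((2^-1) ^+ k)%:E)%E).
    apply: lee_nneseries => [k _ _|k _]; last exact: iF.
    by apply: integral_ge0 => x; exact: F0.
  rewrite [ltLHS](_ : _ = 2%:E) ?ltry//.
  apply/cvg_lim => //; under eq_fun do rewrite sumEFin.
  apply/cvg_EFin; first by near=> n.
  have := @cvg_geometric_series R 1 (2^-1).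
  rewrite ger0_norm// invf_lt1// ltr1n => /(_ isT).
  have -> : 1 / (1 - 2^-1) = 2 :> R by field.
  apply: cvg_trans; apply: near_eq_cvg; near=> n.
  by rewrite /series/=; apply: eq_bigr => i _; rewrite /geometric/= mul1r.
have sum0 x : (0 <= \sum_(0 <= k <oo) F k x)%E.
  by apply: nneseries_ge0 => k _ _; exact: F0.
have : P.-integrable setT (fun x => \sum_(0 <= k <oo) F k x)%E.
  apply/integrableP; split.
    by apply: ge0_emeasurable_sum => // k x _ _; exact: F0.
  by rewrite [ltLHS](_ : _ = \int[P]_x (\sum_(0 <= k <oo) F k x))%E//;
    apply: eq_integral => x _; rewrite gee0_abs// sum0.
move/(integrable_ae measurableT); apply: filterS => x /(_ I).
rewrite ge0_fin_numE// => h.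
have : cvgn (series (fun k => `|v k.+1 x - v k x|)).
  by apply: nnseries_is_cvg => //.
move/(@normed_cvg _ R (fun k => v k.+1 x - v k x)).
rewrite -[fun k => v k.+1 x - v k x]/(telescope (v ^~ x)) telescopeK => c.
have -> : v ^~ x = (fun n => (v n x - v 0%N x) + v 0%N x).
  by apply/funext => n; rewrite subrK.
by apply: is_cvgD => //; exact: is_cvg_cst.
Unshelve. all: by end_near. Qed.

(** A subsequence with geometric increments converges a.e.; Fatou's lemma turns this pointwise limit
    into the L^2 limit of the whole sequence. *)
Lemma riesz_fischer (u : nat -> T -> R) : (forall n, L2 P (u n)) ->
  (forall e : R, 0 < e -> exists N, forall m n, (N <= m)%N -> (N <= n)%N ->
     dist2 (u m) (u n) <= e) ->
  exists f, L2 P f /\ forall e : R, 0 < e ->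
    exists N, forall n, (N <= n)%N -> dist2 (u n) f <= e.
Proof.
move=> Lu cu.
have mu n : measurable_fun setT (u n) by exact: L2_measurable (Lu n).
have /choice[N hN] : forall k, exists N, forall m n, (N <= m)%N -> (N <= n)%N ->
    dist2 (u m) (u n) <= ((2^-1) ^+ k) ^+ 2.
  by move=> k; apply: cu; rewrite !exprn_gt0.
(* The maximum puts [nk k] beyond all of [N 0], ..., [N k], so [v k] and [v k.+1] both lie past
   [N k]; the summand [k] sends the subsequence to infinity. *)
pose nk k := (k + \max_(i < k.+1) N i)%N.
have Nnk i k : (i <= k)%N -> (N i <= nk k)%N.
  move=> ik; rewrite /nk (leq_trans _ (leq_addl _ _))//.
  by apply: (@leq_bigmax _ (fun i : 'I_k.+1 => N i) (Ordinal (ik : (i < k.+1)%N))).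
pose v k := u (nk k).
have cv : {ae P, forall x, cvgn (v ^~ x)}.
  apply: ae_cvg_of_summable_dist => k; first exact: Lu.
  by apply: hN; apply: Nnk.
(* The upper limit is measurable everywhere, whereas the limit itself exists only a.e. *)
pose f x := fine (limn_esup (fun k => (v k x)%:E)).
have mf : measurable_fun setT f.
  apply: (measurableT_comp (fine_measurable measurableT)).
  apply: measurable_fun_limn_esup => k; apply/measurable_EFinP; exact: mu.
have vf : {ae P, forall x, v ^~ x @ \oo --> f x}.
  apply: filterS cv => x cx.
  have ve : EFin \o v ^~ x @ \oo --> (limn (v ^~ x))%:E by apply/cvg_EFin => //; near=> n.
  by rewrite /f (cvg_limn_einf_sup ve).2.
have fatou_bound n e : 0 < e -> (exists K, forall k, (K <= k)%N -> dist2 (u n) (v k) <= e) ->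
    (\int[P]_x ((u n x - f x) ^+ 2)%:E <= e%:E)%E.
  move=> e0 [K hK].
  have -> : (\int[P]_x ((u n x - f x) ^+ 2)%:E =
     \int[P]_x limn_einf (fun k => ((u n x - v (k + K)%N x) ^+ 2)%:E))%E.
    apply: ge0_ae_eq_integral => //.
    - by apply/measurable_EFinP; apply: measurable_funX; exact: measurable_funB.
    - have -> : (fun x => limn_einf (fun k => ((u n x - v (k + K)%N x) ^+ 2)%:E)) =
         (fun x => - limn_esup (fun k => - ((u n x - v (k + K)%N x) ^+ 2)%:E))%E.
        apply/funext => x.
        rewrite -[X in limn_esup X]/(-%E \o (fun k => ((u n x - v (k + K)%N x) ^+ 2)%:E)).
        by rewrite limn_esupN oppeK.
      apply: measurableT_comp => //; apply: measurable_fun_limn_esup => k.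
      apply: measurableT_comp => //; apply/measurable_EFinP.
      by apply: measurable_funX; apply: measurable_funB => //; exact: mu.
    - by move=> x _; rewrite lee_fin sqr_ge0.
    - move=> x _; rewrite limn_einf_lim; apply: lime_ge; first exact: is_cvg_einfs.
      near=> k; apply: le_ereal_inf_tmp => _ [j _ <-]; by rewrite lee_fin sqr_ge0.
    apply: filterS vf => x vx _.
    apply/esym; apply: (cvg_limn_einf_sup _).1; apply/cvg_EFin; first by near=> k.
    apply: cvgM; (apply: (@cvgB _ R^o); [exact: cvg_cst|]);
      by rewrite -(@cvg_shiftn K) in vx.
  apply: (le_trans (fatou _ measurableT _ _)).
  - move=> k; apply/measurable_EFinP.
    by apply: measurable_funX; apply: measurable_funB => //; exact: mu.
  - by move=> k x _; rewrite lee_fin sqr_ge0.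
  rewrite limn_einf_lim; apply: lime_le; first exact: is_cvg_einfs.
  near=> k; apply: ge_ereal_inf.
  exists (\int[P]_x ((u n x - v (k + K)%N x) ^+ 2)%:E)%E; first by exists k => /=.
  have L := L2B (Lu n) (Lu (nk (k + K)%N)).
  by rewrite -EFin_Rint ?lee_fin; [apply: hK; rewrite leq_addl | exact: L2_sqr].
have bound e : 0 < e -> exists M, forall n, (M <= n)%N -> (\int[P]_x ((u n x - f x) ^+ 2)%:E <= e%:E)%E.
  move=> e0; have [M hM] := cu _ e0; exists M => n Mn.
  apply: fatou_bound => //; exists M => k Mk; apply: hM => //.
  by rewrite /v /nk (leq_trans Mk)// leq_addr.
have Lf : L2 P f.
  have [M hM] := bound 1 ltr01.
  have L : L2 P (fun x => u M x - f x).
    split; first exact: measurable_funB.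
    apply: ge0_Int; [by apply: measurable_funX; exact: measurable_funB|by move=> x; rewrite sqr_ge0|].
    by apply: le_lt_trans (hM _ (leqnn _)) _; rewrite ltry.
  have := L2B (Lu M) L; congr L2; apply/funext => x; ring.
exists f; split => // e e0.
have [M hM] := bound e e0; exists M => n Mn.
have := hM n Mn; rewrite -EFin_Rint ?lee_fin//.
by have [] := L2B (Lu n) Lf.
Unshelve. all: by end_near. Qed.

End riesz_fischer.

(** * Gaussian integrals and moments *)

Section weighted_image.
Context {d d' : measure_display} {T : measurableType d} {Y : measurableType d'}
  {R : realType} (mu : {measure set T -> \bar R}) (nu : {measure set Y -> \bar R})
  (phi : T -> Y) (W : T -> R).
Hypotheses (mphi : measurable_fun setT phi) (mW : measurable_fun setT W)
  (W0 : forall x, 0 <= W x)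
  (munu : forall A, measurable A ->
     (\int[mu]_(x in phi @^-1` A) (W x)%:E = nu A)%E).
Local Open Scope ereal_scope.
Import HBNNSimple.

(** Change of variables for the measure [W mu] pushed forward by [phi], known on sets only. It is
    applied with [phi] the identity and [W] a density, with [W = 1] for the law of a variable, and
    with [W] the product of the other factors in the independence argument. *)
Lemma ge0_integral_weighted_image (f : Y -> \bar R) : measurable_fun setT f ->
  (forall y, 0 <= f y) ->
  \int[mu]_x ((W x)%:E * f (phi x)) = \int[nu]_y f y.
Proof.
move=> mf f0; pose h := nnsfun_approx measurableT mf.
have mWE : measurable_fun setT (fun x => (W x)%:E) by exact/measurable_EFinP.
have mA (r : R) n : measurable (h n @^-1` [set r]) by exact: measurable_sfunP.
have mh n : measurable_fun setT (fun y => (h n y)%:E).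
  by apply/measurable_EFinP; exact: measurable_funP.
have fE y : f y = limn (fun n => (h n y)%:E).
  by apply/esym/cvg_lim => //; exact: cvg_nnsfun_approx.
have -> : \int[nu]_y f y = limn (fun n => \int[nu]_y (h n y)%:E).
  under eq_integral => y _ do rewrite fE.
  apply: monotone_convergence => //.
  - by move=> n y _; rewrite lee_fin.
  - by move=> y _ a b ab; rewrite lee_fin; exact/lefP/nd_nnsfun_approx.
have -> : \int[mu]_x ((W x)%:E * f (phi x)) =
    limn (fun n => \int[mu]_x ((W x)%:E * (h n (phi x))%:E)).
  have WfE x : (W x)%:E * f (phi x) = limn (fun n => (W x)%:E * (h n (phi x))%:E).
    by apply/esym/cvg_lim => //; apply: cvgeZl => //; exact: cvg_nnsfun_approx.
  under eq_integral => y _ do rewrite WfE.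
  apply: monotone_convergence => //.
  - by move=> n; apply: emeasurable_funM => //; exact: measurableT_comp (mh n) mphi.
  - by move=> n y _; rewrite mule_ge0// lee_fin.
  - move=> y _ a b ab; rewrite lee_wpmul2l ?lee_fin//.
    exact/lefP/nd_nnsfun_approx.
congr (limn _); apply/funext => n.
transitivity (\int[mu]_x (\sum_(y \in range (h n))
    ((W x)%:E * (y * \1_(h n @^-1` [set y]) (phi x))%:E))).
  apply: eq_integral => x _.
  rewrite -ge0_mule_fsumr => [|y]; last exact: nnfun_muleindic_ge0.
  by rewrite fsumEFin// -(fimfunE _ (phi x)).
transitivity (\int[nu]_x
   (\sum_(y \in range (h n)) (y * \1_(h n @^-1` [set y]) x)%:E)); last first.
  by apply: eq_integral => t tE; rewrite /= fsumEFin// -fimfunE.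
have mWr r : measurable_fun setT
    (fun x => (W x)%:E * (r * \1_(h n @^-1` [set r]) (phi x))%:E).
  apply: emeasurable_funM => //; apply/measurable_EFinP/measurable_funM => //.
  exact: (measurableT_comp (measurable_indic (mA r n)) mphi).
have mr r : measurable_fun setT (fun x => (r * \1_(h n @^-1` [set r]) x)%:E).
  by apply/measurable_EFinP/measurable_funM.
rewrite ge0_integral_fsum//; last first.
  by move=> r x _; rewrite mule_ge0 ?lee_fin// -lee_fin nnfun_muleindic_ge0.
rewrite ge0_integral_fsum//; last by move=> r x _; exact: nnfun_muleindic_ge0.
apply: eq_fsbigr => r; rewrite inE => -[y0 _ yr].
have r0 : (0 <= r)%R by rewrite -yr.
under eq_integral do rewrite EFinM muleCA.
rewrite ge0_integralZl//; first last.
- by move=> x _; rewrite mule_ge0 ?lee_fin.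
- apply: emeasurable_funM => //; apply/measurable_EFinP.
  exact: (measurableT_comp (measurable_indic (mA r n)) mphi).
rewrite integralZl_indic_nnsfun//; congr (_ * _).
rewrite integral_indic// setIT -munu// [RHS]integral_mkcond/=.
apply: eq_integral => x _; rewrite patchE indicE.
have -> : (phi x \in h n @^-1` [set r]) = (x \in phi @^-1` (h n @^-1` [set r])).
  by apply/idP/idP; rewrite !inE.
by case: ifP; rewrite ?mule1 ?mule0.
Qed.

End weighted_image.

Section normal_integrals.
Context {R : realType}.
Local Notation mu := (@lebesgue_measure R).

Lemma ge0_integral_normal_prob (m s : R) (f : R -> \bar R) :
  measurable_fun setT f -> (forall y, 0 <= f y)%E ->
  (\int[normal_prob m s]_y f y = \int[mu]_y ((normal_pdf m s y)%:E * f y))%E.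
Proof.
move=> mf f0; apply/esym.
apply: (@ge0_integral_weighted_image _ _ (measurableTypeR R) (measurableTypeR R) R
  mu (normal_prob m s) id (normal_pdf m s)) => //.
- exact: measurable_normal_pdf.
- by move=> x; exact: normal_pdf_ge0.
Qed.

Lemma normal_pdf_expR (s a y : R) : s != 0 -> normal_pdf 0 s y * expR (a * y) =
  expR (a ^+ 2 * s ^+ 2 / 2) * normal_pdf (a * s ^+ 2) s y.
Proof.
move=> s0; rewrite !normal_pdfE// /normal_fun.
rewrite -[LHS]mulrA -expRD [RHS]mulrCA -expRD; congr (_ * expR _).
by field.
Qed.

(** A Gaussian factor only rescales the density: the new variance is [1 / (1 + b)]. Negative
    [b > -1] is kept for the moment generating function of a square. *)
Lemma normal_pdf_expR_sqr (b y : R) : 0 < 1 + b ->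
  normal_pdf 0 1 y * expR (- (b * y ^+ 2 / 2)) =
  (1 + b) `^ (- 2^-1) * normal_pdf 0 ((1 + b) `^ (- 2^-1)) y.
Proof.
move=> b0; set s := _ `^ _.
have s0 : 0 < s by rewrite powR_gt0.
have s2 : s ^+ 2 = (1 + b)^-1.
  by rewrite -powR_mulrn ?powR_ge0// /s -powRrM mulNr mulVf// powR_inv1// ltW.
have sN0 : s != 0 by rewrite gt_eqF.
rewrite !normal_pdfE// ?oner_neq0// /normal_fun.
rewrite -[LHS]mulrA -expRD [RHS]mulrA; congr (_ * expR _).
  rewrite /normal_peak s2 expr1n mul1r -mulrnAr sqrtrM ?invr_ge0 ?ltW//.
  by rewrite -s2 sqrtr_sqr ger0_norm ?ltW// invfM mulrA divff// mul1r.
by rewrite s2 !subr0; field; rewrite gt_eqF.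
Qed.

Lemma normal_mgf (s a : R) : s != 0 ->
  (\int[normal_prob 0 s]_y (expR (a * y))%:E = (expR (a ^+ 2 * s ^+ 2 / 2))%:E)%E.
Proof.
move=> s0; rewrite ge0_integral_normal_prob//; last first.
  by apply/measurable_EFinP/measurableT_comp => //; exact: measurable_funM.
transitivity (\int[mu]_y ((expR (a ^+ 2 * s ^+ 2 / 2))%:E *
    (normal_pdf (a * s ^+ 2) s y)%:E))%E.
  by apply: eq_integral => y _; rewrite -!EFinM normal_pdf_expR.
rewrite ge0_integralZl//; first by rewrite integral_normal_pdf mule1.
- by apply/measurable_EFinP; exact: measurable_normal_pdf.
- by move=> y _; rewrite lee_fin normal_pdf_ge0.
Qed.

Lemma normal_sqr_mgf (b : R) : -1 < b ->
  (\int[normal_prob 0 1]_y (expR (- (b * y ^+ 2 / 2)))%:E =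
   ((1 + b) `^ (- 2^-1))%:E)%E.
Proof.
move=> b1; have b0 : 0 < 1 + b by lra.
rewrite ge0_integral_normal_prob//; last first.
  apply/measurable_EFinP/measurableT_comp => //; apply: measurableT_comp => //.
  by apply: measurable_funM => //; apply: measurable_funM => //; exact: measurable_funX.
pose s := (1 + b) `^ (- 2^-1).
transitivity (\int[mu]_y (s%:E * (normal_pdf 0 s y)%:E))%E.
  by apply: eq_integral => y _; rewrite -!EFinM normal_pdf_expR_sqr.
rewrite ge0_integralZl//; first by rewrite integral_normal_pdf mule1.
- by apply/measurable_EFinP; exact: measurable_normal_pdf.
- by move=> y _; rewrite lee_fin normal_pdf_ge0.
- by rewrite lee_fin powR_ge0.
Qed.

End normal_integrals.

Section mgf.
Context {d : measure_display} {T : measurableType d} {R : realType}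
  (P : probability T R).
Local Notation Int f := (P.-integrable [set: T] (EFin \o f)).

(** A centered normal law recorded by its moment generating function, which treats the degenerate
    case [v = 0] together with the others; the moments of elements of [H] are derived from it. *)
Definition gauss_mgf (xi : T -> R) (v : R) := [/\ measurable_fun setT xi, 0 <= v &
  forall a, (\int[P]_x (expR (a * xi x))%:E = (expR (a ^+ 2 * v / 2))%:E)%E].

Lemma ge0_integral_normal_law (xi : T -> R) (s : R) (f : R -> \bar R) :
  measurable_fun setT xi ->
  (forall A : set R, measurable A -> P (xi @^-1` A) = normal_prob 0 s A) ->
  measurable_fun setT f -> (forall y, 0 <= f y)%E ->
  (\int[P]_x f (xi x) = \int[normal_prob 0 s]_y f y)%E.
Proof.
move=> mxi law mf f0.
have := @ge0_integral_weighted_image _ _ T (measurableTypeR R) R P (normal_prob 0 s)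
  xi (fun=> 1) mxi (measurable_cst _) (fun=> ler01).
have h (A : set (measurableTypeR R)) : measurable A ->
    (\int[P]_(x in xi @^-1` A) 1%:E = normal_prob 0 s A)%E.
  move=> mA; rewrite integral_cst ?mul1e; first exact: law.
  by rewrite -[X in measurable X]setTI; exact: mxi.
move=> /(_ h f mf f0) <-; by under [RHS]eq_integral do rewrite mul1e.
Qed.

Lemma centered_gaussian_mgf (xi : T -> R) : centered_gaussian P xi ->
  exists v, gauss_mgf xi v.
Proof.
move=> [mxi [xi0|[s [s0 law]]]]; last first.
  exists (s ^+ 2); split => // [|a]; first exact: sqr_ge0.
  rewrite -normal_mgf ?gt_eqF//.
  rewrite (@ge0_integral_normal_law xi s (fun y => (expR (a * y))%:E))//.
    by apply/measurable_EFinP/measurableT_comp => //; exact: measurable_funM.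
exists 0; split => // a.
have m0 : measurable [set w | xi w = 0].
  have := mxi measurableT [set 0] (measurable_set1 _); rewrite setTI.
  by congr measurable; apply/seteqP; split.
rewrite (@ae_eq_integral _ _ _ P setT (cst 1%:E))//.
- by rewrite mulr0 mul0r expR0 integral_cst//= probability_setT mule1.
- by apply/measurable_EFinP/measurableT_comp => //; exact: measurable_funM.
- exists (~` [set w | xi w = 0]); split; first exact: measurableC.
    by apply: eq_trans (probability_setC P m0) _; rewrite xi0 subee.
  apply: subsetC => x /= -> _; by rewrite mulr0 expR0.
Qed.

End mgf.

(** * Uniqueness of power series with nonnegative coefficients *)

Section power_series_uniqueness.
Context {R : realType}.

(** For [0 <= x <= 1] the terms of the [e]-series beyond degree [m] add up to at most
    [x ^+ m.+1 * F 1]. Cancelling the common terms below [m] leaves [c m <= e m + x * F 1], and [x]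
    is made small. *)
Lemma nneg_pseries_coef_le (c e : nat -> R) (F : R -> R) :
  (forall k, 0 <= c k) -> (forall k, 0 <= e k) ->
  (forall x, 0 <= x -> (fun n => \sum_(k < n) c k * x ^+ k) @ \oo --> F x) ->
  (forall x, 0 <= x -> (fun n => \sum_(k < n) e k * x ^+ k) @ \oo --> F x) ->
  forall m, (forall k, (k < m)%N -> c k = e k) -> c m <= e m.
Proof.
move=> c0 e0 cF eF m IH.
have le_F (a : nat -> R) x n : (forall k, 0 <= a k) -> 0 <= x ->
    (fun n => \sum_(k < n) a k * x ^+ k) @ \oo --> F x ->
    \sum_(k < n) a k * x ^+ k <= F x.
  move=> a0 x0 ca; rewrite -(cvg_lim _ ca)//.
  apply: (@nondecreasing_cvgn_le _ (fun n => \sum_(k < n) a k * x ^+ k)).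
    by apply/nondecreasing_seqP => k; rewrite big_ord_recr/= lerDl mulr_ge0// exprn_ge0.
  by apply/cvg_ex; exists (F x).
have ub x : 0 <= x <= 1 -> F x <= \sum_(k < m.+1) e k * x ^+ k + x ^+ m.+1 * F 1.
  move=> /andP[x0 x1]; rewrite -(cvg_lim _ (eF x x0))//.
  apply: limr_le; first by apply/cvg_ex; exists (F x); exact: eF.
  near=> n.
  have nm : (m.+1 <= n)%N by near: n; exists m.+1.
  rewrite -(big_mkord xpredT (fun k => e k * x ^+ k)) (big_cat_nat (n := m.+1))//=.
  rewrite big_mkord lerD2l.
  apply: (@le_trans _ _ (x ^+ m.+1 * \sum_(m.+1 <= k < n) e k * 1 ^+ k)).
    rewrite mulr_sumr big_nat [leRHS]big_nat; apply: ler_sum => k /andP[mk _].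
    rewrite expr1n mulr1 mulrC ler_wpM2r// -(subnKC mk) exprD ler_piMr ?exprn_ge0//.
    by rewrite exprn_ile1.
  rewrite ler_wpM2l ?exprn_ge0// (le_trans _ (le_F e 1 n _ _ _))//; last exact: eF.
  rewrite -(big_mkord xpredT (fun k => e k * 1 ^+ k)).
  rewrite [leRHS](big_cat_nat (n := m.+1))//=.
  by rewrite lerDr sumr_ge0// => i _; rewrite expr1n mulr1.
apply/ler_addgt0Pr => eps eps0.
have F1 : 0 <= F 1.
  by have := le_F e 1 0%N e0 ler01 (eF 1 ler01); rewrite big_ord0.
(* Small enough that [x * F 1 <= eps]; the added 1 covers [F 1 = 0]. *)
pose x := Num.min 1 (eps / (F 1 + 1)).
have Fp : 0 < F 1 + 1 by lra.
have x0 : 0 < x by rewrite lt_min ltr01 divr_gt0.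
have x1 : x <= 1 by rewrite ge_min lexx.
have xF : x * F 1 <= eps.
  have : x * (F 1 + 1) <= eps by rewrite -ler_pdivlMr// ge_min lexx orbT.
  by rewrite mulrDr mulr1; lra.
have := le_trans (le_F c x m.+1 c0 (ltW x0) (cF x (ltW x0))) (ub x _).
rewrite (ltW x0) x1 => /(_ isT); rewrite !big_ord_recr/=.
rewrite (eq_bigr (fun k : 'I_m => e k * x ^+ k)); last by move=> k _; rewrite IH.
rewrite exprS => h; have xm : 0 < x ^+ m by rewrite exprn_gt0.
rewrite -(ler_pM2r xm).
have : x * x ^+ m * F 1 <= eps * x ^+ m by rewrite mulrAC ler_wpM2r// ltW.
lra.
Unshelve. all: by end_near. Qed.

Lemma nneg_pseries_unique (c e : nat -> R) (F : R -> R) :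
  (forall k, 0 <= c k) -> (forall k, 0 <= e k) ->
  (forall x, 0 <= x -> (fun n => \sum_(k < n) c k * x ^+ k) @ \oo --> F x) ->
  (forall x, 0 <= x -> (fun n => \sum_(k < n) e k * x ^+ k) @ \oo --> F x) ->
  forall m, c m = e m.
Proof.
move=> c0 e0 cF eF; elim/ltn_ind => m IH.
apply/eqP; rewrite eq_le; apply/andP; split.
  exact: (nneg_pseries_coef_le c0 e0 cF eF).
by apply: (nneg_pseries_coef_le e0 c0 eF cF) => k km; rewrite IH.
Qed.

(** The odd terms of the two exponential series cancel. What remains has nonnegative coefficients in
    [x ^+ 2], as [nneg_pseries_unique] requires. *)
Lemma cosh_series (x : R) :
  (fun n => \sum_(k < n) x ^+ k.*2 / (k.*2)`!%:R) @ \oo -->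
  (expR x + expR (- x)) / 2.
Proof.
have cvg_exp (y : R) : (fun n => \sum_(k < n.*2) y ^+ k / k`!%:R) @ \oo --> expR y.
  have h : series (exp_coeff y) @ \oo --> expR y.
    exact: is_cvg_series_exp_coeff.
  have h2 : (fun n => n.*2) @ \oo --> \oo.
    move=> /= A [N _ NA]; exists N => // n /= Nn; apply: NA => /=.
    by rewrite -addnn (leq_trans Nn)// leq_addr.
  have := cvg_comp _ _ h2 h; apply: cvg_trans; apply: near_eq_cvg; near=> n.
  by rewrite /= /series/= big_mkord.
have : (fun n => (\sum_(k < n.*2) x ^+ k / k`!%:R + \sum_(k < n.*2) (- x) ^+ k / k`!%:R) / 2)
    @ \oo --> (expR x + expR (- x)) / 2.
  by apply: cvgM; [apply: cvgD; exact: cvg_exp|exact: cvg_cst].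
apply: cvg_trans; apply: near_eq_cvg; apply: nearW => n /=.
elim: n => [|n IH].
  by rewrite double0 !big_ord0 addr0 mul0r.
have e2 : (- x) ^+ n.*2 = x ^+ n.*2 by rewrite -mul2n !exprM sqrrN.
have e3 : (- x) ^+ n.*2.+1 = - x ^+ n.*2.+1 by rewrite exprS e2 mulNr -exprS.
rewrite [RHS]big_ord_recr -IH /= doubleS.
rewrite big_ord_recr /= big_ord_recr /= [X in _ + X]big_ord_recr /=.
rewrite [X in _ + (X + _)]big_ord_recr /= e2 e3.
set p := x ^+ n.*2.+1 / _; set q := x ^+ n.*2 / _.
have -> : - x ^+ n.*2.+1 / (n.*2.+1)`!%:R = - p by rewrite mulNr.
lra.
Unshelve. all: by end_near. Qed.

End power_series_uniqueness.

Section dominated.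
Context {d : measure_display} {T : measurableType d} {R : realType}
  (P : probability T R).
Local Notation Int f := (P.-integrable [set: T] (EFin \o f)).

Lemma Rint_dominated_cvg (f_ : nat -> T -> R) (f g : T -> R) :
  (forall n, measurable_fun setT (f_ n)) -> measurable_fun setT f ->
  {ae P, forall x, f_ ^~ x @ \oo --> f x} -> Int g ->
  {ae P, forall x n, `|f_ n x| <= g x} ->
  Int f /\ (fun n => \int[P]_x f_ n x) @ \oo --> \int[P]_x f x.
Proof.
move=> mf_ mf ff ig fg.
have [|||||intf _ cf] := @dominated_convergence _ _ _ P setT measurableT
  (fun n => EFin \o f_ n) (EFin \o f) (EFin \o g).
- by move=> n; exact/measurable_EFinP.
- exact/measurable_EFinP.
- by apply: filterS ff => x cx _; apply/cvg_EFin => //; near=> n.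
- exact: ig.
- by apply: filterS fg => x h n _; rewrite lee_fin.
split => //; apply/fine_cvg.
by rewrite -EFin_Rint in cf.
Unshelve. all: by end_near. Qed.

End dominated.

Section moments.
Context {d : measure_display} {T : measurableType d} {R : realType}
  (P : probability T R) (xi : T -> R) (v : R).
Hypothesis Gxi : gauss_mgf P xi v.
Local Notation Int f := (P.-integrable [set: T] (EFin \o f)).

Let mxi : measurable_fun setT xi. Proof. by case: Gxi. Qed.
Let v0 : 0 <= v. Proof. by case: Gxi. Qed.

Lemma mgf_Int_expR (a : R) : Int (fun x => expR (a * xi x)).
Proof.
apply: ge0_Int.
- by apply: measurableT_comp => //; exact: measurable_funM.
- by move=> x; exact: expR_ge0.
- by case: Gxi => _ _ ->; rewrite ltry.
Qed.

Lemma mgf_Rint_expR (a : R) : \int[P]_x expR (a * xi x) = expR (a ^+ 2 * v / 2).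
Proof. by case: Gxi => _ _ h; rewrite /Rintegral h. Qed.

Let cosh x : R := (expR x + expR (- x)) / 2.

Let Int_cosh (a : R) : Int (fun x => cosh (a * xi x)).
Proof.
apply: (@Int_ext _ _ _ _ (fun x => 2^-1 * (expR (a * xi x) + expR (- a * xi x)))).
  by move=> x; rewrite /cosh mulrC mulNr.
by apply/IntZ/IntD; exact: mgf_Int_expR.
Qed.

Let Rint_cosh (a : R) : \int[P]_x cosh (a * xi x) = expR (a ^+ 2 * v / 2).
Proof.
transitivity (\int[P]_x (2^-1 * (expR (a * xi x) + expR (- a * xi x)))).
  by apply: eq_Rintegral => x _; rewrite /cosh mulrC mulNr.
rewrite RintZ ?RintD; try exact: mgf_Int_expR; last first.
  by apply: IntD; exact: mgf_Int_expR.
by rewrite !mgf_Rint_expR sqrrN; field.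
Qed.

Let partial_cosh_le (x : R) n : \sum_(k < n) x ^+ k.*2 / (k.*2)`!%:R <= cosh x.
Proof.
have cc := @cosh_series R x; rewrite /cosh -(cvg_lim _ cc)//.
apply: (@nondecreasing_cvgn_le _ (fun n => \sum_(k < n) x ^+ k.*2 / (k.*2)`!%:R)).
  apply/nondecreasing_seqP => k; rewrite big_ord_recr/= lerDl divr_ge0//.
  by rewrite exprn_even_ge0// odd_double.
by apply/cvg_ex; eexists; exact: cc.
Qed.

Let Int_even k : Int (fun x => xi x ^+ k.*2).
Proof.
apply: (@Int_ext _ _ _ _ (fun x => (k.*2)`!%:R * (xi x ^+ k.*2 / (k.*2)`!%:R))).
  by move=> x; rewrite mulrC divfK// pnatr_eq0 -lt0n fact_gt0.
apply: IntZ; apply: (@Int_le _ _ _ _ _ (fun x => cosh (1 * xi x))).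
- by apply: measurable_funM => //; exact: measurable_funX.
- move=> x; rewrite mul1r (le_trans _ (partial_cosh_le (xi x) k.+1))//.
  rewrite ger0_norm ?divr_ge0 ?exprn_even_ge0 ?odd_double//.
  rewrite big_ord_recr/= lerDr sumr_ge0// => i _.
  by rewrite divr_ge0 ?exprn_even_ge0 ?odd_double.
- exact: Int_cosh.
Qed.

Let c k : R := (\int[P]_x (xi x ^+ k.*2)) / (k.*2)`!%:R.

(** The flag [s] switches the alternating sign on, so that one dominated convergence covers cosh
    ([s = false]) and cos ([s = true]); in both cases [cosh (a * xi)] dominates the partial sums. *)
Let series_cvg (s : bool) (a : R) (F : R -> R) : measurable_fun setT F ->
  (forall y, (fun n => \sum_(k < n) (-1) ^+ (s * k) * (y ^+ k.*2 / (k.*2)`!%:R)) @ \oo --> F y) ->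
  (fun n => \sum_(k < n) (-1) ^+ (s * k) * (c k * (a ^+ 2) ^+ k)) @ \oo -->
    \int[P]_x F (a * xi x).
Proof.
move=> mF cF.
pose f_ n x := \sum_(k < n) (-1) ^+ (s * k) * ((a * xi x) ^+ k.*2 / (k.*2)`!%:R).
have ma : measurable_fun setT (fun x => a * xi x) by exact: measurable_funM.
have mf_ n : measurable_fun setT (f_ n).
  apply: measurable_sum => k; apply: measurable_funM => //.
  by apply: measurable_funM => //; exact: measurable_funX.
have h : {ae P, forall x n, `|f_ n x| <= cosh (a * xi x)}.
  apply: aeW => x n; apply: le_trans (partial_cosh_le _ n).
  apply: le_trans (ler_norm_sum _ _ _) _; apply: ler_sum => k _.
  rewrite normrM normrX normrN1 expr1n mul1r ger0_norm//.
  by rewrite divr_ge0// exprn_even_ge0// odd_double.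
have cf : {ae P, forall x, f_ ^~ x @ \oo --> F (a * xi x)} by apply: aeW => x; exact: cF.
have [_] := Rint_dominated_cvg mf_ (measurableT_comp mF ma) cf (Int_cosh a) h.
apply: cvg_trans; apply: near_eq_cvg; near=> n.
rewrite /f_ Rint_sum; last first.
  move=> k _; apply: IntZ.
  apply: (@Int_ext _ _ _ _ (fun x => a ^+ k.*2 / (k.*2)`!%:R * (xi x ^+ k.*2))).
    by move=> x; rewrite exprMn; ring.
  exact/IntZ/Int_even.
apply: eq_bigr => k _.
transitivity (\int[P]_x (((-1) ^+ (s * k) * (a ^+ k.*2 / (k.*2)`!%:R)) * (xi x ^+ k.*2))).
  by apply: eq_Rintegral => x _; rewrite exprMn; ring.
by rewrite RintZ ?Int_even// /c -exprM mul2n; ring.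
Unshelve. all: by end_near. Qed.

(** At [a = Num.sqrt x] the mean of cosh is a power series in [x] with coefficients [c k], and it
    also equals [expR (x * v / 2)]. *)
Let cE k : c k = (v / 2) ^+ k / k`!%:R.
Proof.
apply: (@nneg_pseries_unique R c (fun k => (v / 2) ^+ k / k`!%:R)
  (fun x => expR (x * v / 2))).
- move=> i; rewrite divr_ge0// Rintegral_ge0// => x _.
  by rewrite exprn_even_ge0// odd_double.
- by move=> i; rewrite divr_ge0// exprn_ge0// divr_ge0.
- move=> x x0; have := @series_cvg false (Num.sqrt x) cosh.
  rewrite Rint_cosh sqr_sqrtr// => h.
  have := h _ _; under eq_fun do under eq_bigr do rewrite mul0n expr0 mul1r.
  apply.
    by apply: measurable_funM => //; apply: measurable_funD => //; exact: measurableT_comp.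
  by move=> y; under eq_fun do under eq_bigr do rewrite mul0n expr0 mul1r; exact: cosh_series.
- move=> x x0; have : series (exp_coeff (x * v / 2)) @ \oo --> expR (x * v / 2).
    exact: is_cvg_series_exp_coeff.
  apply: cvg_trans; apply: near_eq_cvg; near=> n.
  rewrite /series/= big_mkord; apply: eq_bigr => i _.
  by rewrite /exp_coeff/= -mulrA exprMn; ring.
Unshelve. all: by end_near. Qed.

Lemma mgf_L2 : L2 P xi.
Proof. by split => //; exact: (Int_even 1). Qed.

Lemma mgf_var : L2dot P xi xi = v.
Proof.
have := cE 1; rewrite /c expr1 (_ : 1`!%:R = 1)// divr1 => h.
have -> : L2dot P xi xi = \int[P]_x (xi x ^+ 1.*2) by apply: eq_Rintegral.
by rewrite -[LHS](@divfK _ 2)// h; field.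
Qed.

Lemma mgf_L4 : L2 P (fun x => xi x ^+ 2).
Proof.
split; first exact: measurable_funX.
by apply: Int_ext (Int_even 2) => x; rewrite -exprM.
Qed.

Lemma mgf_kurtosis : L2dot P (fun x => xi x ^+ 2) (fun x => xi x ^+ 2) = 3 * v ^+ 2.
Proof.
have := cE 2; rewrite /c => h.
have -> : L2dot P (fun x => xi x ^+ 2) (fun x => xi x ^+ 2) = \int[P]_x (xi x ^+ 2.*2).
  by apply: eq_Rintegral => x _; rewrite -exprD.
rewrite -[LHS](@divfK _ (2.*2)`!%:R)// ?h ?pnatr_eq0//.
have -> : (2.*2)`!%:R = 24 :> R by [].
have -> : 2`!%:R = 2 :> R by [].
by field.
Qed.

(** The moments found from cosh are inserted into the alternating series, which leads from the
    moment generating function to the characteristic function. *)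
Lemma mgf_cos : \int[P]_x cos (xi x) = expR (- (v / 2)).
Proof.
have := @series_cvg true 1 cos.
have -> : \int[P]_x cos (1 * xi x) = \int[P]_x cos (xi x).
  by apply: eq_Rintegral => x _; rewrite mul1r.
move=> h; apply: (@cvg_unique _ (@Rhausdorff R) _ _ _ _ (h _ _)).
- apply: continuous_measurable_fun; exact: continuous_cos.
- move=> y; have := @cvg_cos_coeff' R y.
  apply: cvg_trans; apply: near_eq_cvg; near=> n.
  rewrite /series/= big_mkord; apply: eq_bigr => i _.
  by rewrite /cos_coeff' mul1n mulrA.
have : series (exp_coeff (- (v / 2))) @ \oo --> expR (- (v / 2)).
  exact: is_cvg_series_exp_coeff.
apply: cvg_trans; apply: near_eq_cvg; near=> n.
rewrite /series/= big_mkord; apply: eq_bigr => i _.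
by rewrite /exp_coeff/= cE mul1n expr1n expr1n mulr1 (exprNn (v / 2)); ring.
Unshelve. all: by end_near. Qed.

End moments.

(** * Uniqueness of laws from Laplace transforms *)

Section step_polynomials.
Context {R : realType}.

Lemma bernoulli_ineq (y : R) n : -1 <= y -> 1 + n%:R * y <= (1 + y) ^+ n.
Proof.
move=> y1; elim: n => [|n IH]; first by rewrite mul0r addr0 expr0.
rewrite exprS; apply: le_trans (ler_wpM2l _ IH); last by lra.
rewrite -natr1; have := ler0n R n; have := sqr_ge0 y; nra.
Qed.

Lemma cvg_geometric0 (q : R) : 0 <= q < 1 -> (fun n => q ^+ n) @ \oo --> 0.
Proof.
move=> /andP[q0 q1]; have := @cvg_geometric R 1 q.
rewrite ger0_norm// => /(_ q1).
by apply: cvg_trans; apply: near_eq_cvg; apply: nearW => n /=; rewrite mul1r.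
Qed.

(** Split [r = q ^+ 2]: Bernoulli's inequality for [1 / q] bounds [n q^n], and the other factor
    [q^n] tends to 0. *)
Lemma cvg_natM_geometric0 (r : R) : 0 <= r < 1 -> (fun n => n%:R * r ^+ n) @ \oo --> 0.
Proof.
move=> /andP[r0 r1]; set q := Num.sqrt r.
have q0 : 0 <= q by exact: sqrtr_ge0.
have q2 : q ^+ 2 = r by rewrite sqr_sqrtr.
have q1 : q < 1 by rewrite -(@ltr_pXn2r _ 2)// ?nnegrE// q2 expr1n.
have [->|qN0] := eqVneq r 0.
  apply: (@cvg_trans _ ((fun=> 0 : R) @ \oo)); last exact: cvg_cst.
  by apply: near_eq_cvg; apply: nearW => -[|n]; rewrite ?mul0r// expr0n mulr0.
have qp : 0 < q by rewrite sqrtr_gt0 lt_neqAle eq_sym qN0.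
have C n : n%:R * q ^+ n <= (q^-1 - 1)^-1.
  have q1' : 0 < q^-1 - 1 by rewrite subr_gt0 invf_gt1.
  have q1'' : -1 <= q^-1 - 1 by lra.
  have := bernoulli_ineq n q1''.
  have -> : 1 + (q^-1 - 1) = q^-1 by ring.
  rewrite exprVn => h.
  rewrite -[leRHS]mul1r ler_pdivlMr// -(@ler_pM2r _ (q ^+ n)^-1) ?invr_gt0 ?exprn_gt0//.
  rewrite mul1r mulrAC mulfK ?gt_eqF ?exprn_gt0//; lra.
apply: (@squeeze_cvgr _ _ _ _ (fun=> 0) (fun n => (q^-1 - 1)^-1 * q ^+ n)).
- apply: nearW => n; rewrite mulr_ge0 ?exprn_ge0//=.
  by rewrite -q2 -exprM mulnC exprM expr2 mulrA ler_wpM2r ?exprn_ge0.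
- exact: cvg_cst.
- rewrite -[X in _ --> X](mulr0 (q^-1 - 1)^-1).
  by apply: cvgM; [exact: cvg_cst|apply: cvg_geometric0; rewrite q0].
Qed.

(* The exponent [n * 2 ^ n] puts the limit at the threshold [u = 1/2] on the side
   of [1], so that no atom has to be treated separately. *)
Lemma cvg_step_poly (u : R) : 0 <= u <= 1 ->
  (fun n => 1 - (1 - u ^+ n) ^+ (n * 2 ^ n)) @ \oo --> (((2^-1 : R) <= u)%R%:R : R).
Proof.
move=> /andP[u0 u1].
have un0 n : 0 <= u ^+ n by exact: exprn_ge0.
have un1 n : u ^+ n <= 1 by exact: exprn_ile1.
have My n : (n * 2 ^ n)%:R * u ^+ n = n%:R * (2 * u) ^+ n.
  by rewrite natrM natrX exprMn mulrA.
have [u2|u2] := leP; last first.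
  apply: (@squeeze_cvgr _ _ _ _ (fun=> 0) (fun n => n%:R * (2 * u) ^+ n)).
  - apply: nearW => n; rewrite subr_ge0 exprn_ile1 ?subr_ge0 ?lerBlDr ?lerDl//=.
    have := @bernoulli_ineq (- u ^+ n) (n * 2 ^ n).
    rewrite lerN2 => /(_ (un1 n)); rewrite mulrN My; lra.
  - exact: cvg_cst.
  - by apply: cvg_natM_geometric0; apply/andP; split; lra.
apply: (@squeeze_cvgr _ _ _ _ (fun n => 1 - n.+1%:R^-1) (fun=> 1)).
- apply: nearW => n; apply/andP; split; last first.
    by rewrite lerBlDr lerDl exprn_ge0// subr_ge0.
  rewrite lerD2l lerN2.
  set M := (n * 2 ^ n)%N.
  (* The power of [1 - u^n] is small as soon as that of [1 + u^n] is large, and Bernoulli gives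
     [(1 + u^n)^M >= 1 + M u^n >= n + 1]. *)
  have h : (1 - u ^+ n) ^+ M * (1 + u ^+ n) ^+ M <= 1.
    by rewrite -exprMn -subr_sqr expr1n exprn_ile1 ?lerBlDr ?lerDl ?sqr_ge0// subr_ge0 exprn_ile1.
  have h2 : n.+1%:R <= (1 + u ^+ n) ^+ M.
    apply: le_trans (bernoulli_ineq _ _); last by rewrite (le_trans _ (un0 n)).
    rewrite /M My -natr1 addrC lerD2l ler_peMr// exprn_ege1//; lra.
  rewrite -[leRHS]mul1r ler_pdivlMr ?ltr0n//; apply: le_trans h.
  by rewrite ler_wpM2l// exprn_ge0// subr_ge0.
- rewrite -[X in _ --> X]subr0; apply: (@cvgB _ R^o); first exact: cvg_cst.
  exact: cvg_harmonic.
- exact: cvg_cst.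
Qed.

End step_polynomials.

Lemma measurable_le_cst {R : realType} {d : measure_display} {T : measurableType d}
  (X : T -> R) (a : R) : measurable_fun setT X -> measurable [set w | X w <= a].
Proof.
move=> mX; have := mX measurableT `]-oo, a]%classic (measurable_itv _).
rewrite setTI; congr measurable; apply/seteqP; split => w /=; by rewrite in_itv.
Qed.

Section law_of_laplace.
Context {R : realType} {d1 d2 : measure_display} {T1 : measurableType d1}
  {T2 : measurableType d2} (P1 : probability T1 R) (P2 : probability T2 R).

Lemma law_of_cdf (X1 : T1 -> R) (X2 : T2 -> R) :
  measurable_fun setT X1 -> measurable_fun setT X2 ->
  (forall a : R, P1 [set w | X1 w <= a] = P2 [set w | X2 w <= a]) ->
  forall A : set R, measurable A -> P1 (X1 @^-1` A) = P2 (X2 @^-1` A).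
Proof.
move=> m1 m2 h A mA.
pose m1' := isMeasurableFun.Build _ _ _ _ _ m1.
pose m2' := isMeasurableFun.Build _ _ _ _ _ m2.
pose f1 : {mfun T1 >-> R} := HB.pack X1 m1'.
pose f2 : {mfun T2 >-> R} := HB.pack X2 m2'.
apply: (@measure_unique _ R R (@RGenOInfty.G R)
  (fun n : nat => `]- n%:R, +oo[%classic) _ _ _ _
  (pushforward P1 f1) (pushforward P2 f2)).
- exact: RGenOInfty.measurableE.
- move=> _ _ [x ->] [y ->]; exists (Num.max x y).
  by apply/seteqP; split => z /=; rewrite !in_itv/= !andbT gt_max => /andP.
- by move=> i; exists (- i%:R).
- rewrite -subTset => x _; exists (Num.truncn `|x|).+1 => //=.
  rewrite in_itv/= andbT ltrNl (le_lt_trans (ler_norm _))// normrN.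
  by rewrite truncnS_gt.
- move=> _ [a ->].
  change (P1 (X1 @^-1` `]a, +oo[) = P2 (X2 @^-1` `]a, +oo[)).
  have E1 : X1 @^-1` `]a, +oo[ = ~` [set w | X1 w <= a].
    by apply/seteqP; split => w /=; rewrite in_itv/= andbT ltNge; move/negP.
  have E2 : X2 @^-1` `]a, +oo[ = ~` [set w | X2 w <= a].
    by apply/seteqP; split => w /=; rewrite in_itv/= andbT ltNge; move/negP.
  have M1 : measurable [set w | X1 w <= a] by exact: measurable_le_cst.
  have M2 : measurable [set w | X2 w <= a] by exact: measurable_le_cst.
  rewrite E1 E2; apply: eq_trans (probability_setC P1 M1) _.
  apply/esym; apply: eq_trans (probability_setC P2 M2) _; by rewrite h.
- move=> k; apply: (@le_lt_trans _ _ 1%E); last exact: ltry.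
  apply: (@probability_le1 _ _ _ P1).
  by rewrite -[X in measurable X]setTI; exact: (m1 measurableT _ (measurable_itv _)).
- exact: mA.
Qed.

(** Polynomials in [expR (- (s * X))] are the right test functions because their means depend only
    on the Laplace transform of [X] at multiples of [s]. *)
Lemma laplace_horner {d : measure_display} {T : measurableType d}
  (P : probability T R) (X : T -> R) (s : R) (p : {poly R}) :
  measurable_fun setT X -> {ae P, forall w, 0 <= X w} -> 0 <= s ->
  \int[P]_w p.[expR (- (s * X w))] =
  \sum_(i < size p) p`_i * \int[P]_w expR (- (i%:R * s * X w)).
Proof.
move=> mX X0 s0.
have iE (i : nat) : P.-integrable [set: T] (EFin \o (fun w => expR (- (i%:R * s * X w)))).
  have mE : measurable_fun setT (fun w => expR (- (i%:R * s * X w))).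
    by apply: measurableT_comp => //; apply: measurableT_comp => //; exact: measurable_funM.
  apply: ge0_Int => //.
  apply: (@le_lt_trans _ _ (\int[P]_w 1%:E)%E); last first.
    by rewrite integral_cst//= probability_setT mule1 ltry.
  apply: ae_ge0_le_integral => //.
    exact/measurable_EFinP.
  apply: filterS X0 => w Xw _; rewrite lee_fin -[leRHS]expR0 ler_expR oppr_le0.
  by rewrite !mulr_ge0.
transitivity (\int[P]_w (\sum_(i < size p) p`_i * expR (- (i%:R * s * X w)))).
  apply: eq_Rintegral => w _; rewrite horner_coef; apply: eq_bigr => i _.
  by rewrite -expRM_natl mulrN mulrA.
rewrite Rint_sum; last by move=> i _; exact: IntZ.
by apply: eq_bigr => i _; rewrite RintZ.
Qed.

(** The scale [ln 2 / a] sends the threshold [X = a] to [1/2], where the limit of the polynomials of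
    [cvg_step_poly] jumps; these stay in [0, 1], so dominated convergence applies. *)
Lemma cdf_laplace {d : measure_display} {T : measurableType d}
  (P : probability T R) (X : T -> R) (a : R) :
  measurable_fun setT X -> {ae P, forall w, 0 <= X w} -> 0 < a ->
  (fun n : nat => \int[P]_w (1 - (1 - 'X^n) ^+ (n * 2 ^ n)).[expR (- (ln 2 / a * X w))])
    @ \oo --> fine (P [set w | X w <= a]).
Proof.
move=> mX X0 a0.
have M : measurable [set w | X w <= a] by exact: measurable_le_cst.
have -> : fine (P [set w | X w <= a]) = \int[P]_w \1_[set w | X w <= a] w.
  by rewrite /Rintegral integral_indic// setIT.
have ln2 : 0 < ln 2 :> R by rewrite ln_gt0// ltr1n.
have hE n w : (1 - (1 - 'X^n) ^+ (n * 2 ^ n)).[expR (- (ln 2 / a * X w))] =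
    1 - (1 - expR (- (ln 2 / a * X w)) ^+ n) ^+ (n * 2 ^ n).
  by rewrite !hornerE.
have u01 w : 0 <= X w -> 0 <= expR (- (ln 2 / a * X w)) <= 1.
  move=> Xw; rewrite expR_ge0 -[leRHS]expR0 ler_expR oppr_le0 mulr_ge0//.
  by rewrite divr_ge0// ltW.
have [|||||//] := @Rint_dominated_cvg _ _ _ P
  (fun n w => (1 - (1 - 'X^n) ^+ (n * 2 ^ n)).[expR (- (ln 2 / a * X w))])
  (\1_[set w | X w <= a]) (fun=> 1).
- move=> n; rewrite (_ : (fun w => _) = (fun w => 1 - (1 - expR (- (ln 2 / a * X w)) ^+ n) ^+ (n * 2 ^ n))).
    apply: measurable_funB => //; apply: measurable_funX; apply: measurable_funB => //.
    apply: measurable_funX; apply: measurableT_comp => //; apply: measurableT_comp => //.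
    exact: measurable_funM.
  by apply/funext => w; rewrite hE.
- exact: measurable_indic.
- apply: filterS X0 => w Xw.
  have -> : \1_[set w | X w <= a] w = ((2^-1 : R) <= expR (- (ln 2 / a * X w)))%R%:R :> R.
    rewrite indicE; congr (_%:R); congr nat_of_bool; apply/idP/idP.
      move/set_mem => /= h.
      rewrite -[X in X <= _](@lnK R)// ?posrE ?invr_gt0// ler_expR lnV ?posrE//.
      by rewrite lerN2 mulrAC ler_pdivrMr// ler_pM2l.
    move=> h; apply/mem_set => /=.
    move: h; rewrite -[X in X <= _](@lnK R)// ?posrE ?invr_gt0// ler_expR lnV ?posrE//.
    by rewrite lerN2 mulrAC ler_pdivrMr// ler_pM2l.
  have := cvg_step_poly (u01 _ Xw).
  by apply: cvg_trans; apply: near_eq_cvg; apply: nearW => n; rewrite hE.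
- exact: Int_cst.
- apply: filterS X0 => w Xw n; rewrite hE.
  have /andP[v0 v1] := u01 _ Xw.
  set v := expR _; have y0 : 0 <= 1 - v ^+ n <= 1.
    by rewrite subr_ge0 exprn_ile1//= lerBlDr lerDl exprn_ge0.
  have /andP[y1 y2] := y0.
  rewrite ger0_norm ?subr_ge0 ?exprn_ile1// lerBlDr lerDl exprn_ge0//.
Qed.

(** The atom at 0, for which the scale [ln 2 / a] makes no sense, is reached by letting the Laplace
    parameter tend to infinity. *)
Lemma cdf0_laplace {d : measure_display} {T : measurableType d}
  (P : probability T R) (X : T -> R) :
  measurable_fun setT X -> {ae P, forall w, 0 <= X w} ->
  (fun n : nat => \int[P]_w expR (- (n%:R * X w))) @ \oo --> fine (P [set w | X w <= 0]).
Proof.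
move=> mX X0.
have M : measurable [set w | X w <= 0] by exact: measurable_le_cst.
have -> : fine (P [set w | X w <= 0]) = \int[P]_w \1_[set w | X w <= 0] w.
  by rewrite /Rintegral integral_indic// setIT.
have [|||||//] := @Rint_dominated_cvg _ _ _ P
  (fun n w => expR (- (n%:R * X w))) (\1_[set w | X w <= 0]) (fun=> 1).
- move=> n; apply: measurableT_comp => //; apply: measurableT_comp => //.
  exact: measurable_funM.
- exact: measurable_indic.
- apply: filterS X0 => w; rewrite le_eqVlt => /predU1P[Xw|Xw].
    rewrite indicE mem_set/=; last by rewrite -Xw.
    apply: (@cvg_trans _ ((fun=> 1 : R) @ \oo)); last exact: cvg_cst.
    by apply: near_eq_cvg; apply: nearW => n; rewrite -Xw mulr0 oppr0 expR0.
  rewrite indicE memNset/=; last by apply/negP; rewrite -ltNge.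
  have := @cvg_geometric0 R (expR (- X w)).
  rewrite expR_ge0 -[ltRHS]expR0 ltr_expR oppr_lt0 => /(_ Xw).
  by apply: cvg_trans; apply: near_eq_cvg; apply: nearW => n; rewrite -mulrN expRM_natl.
- exact: Int_cst.
- apply: filterS X0 => w Xw n; rewrite ger0_norm ?expR_ge0// -[leRHS]expR0 ler_expR.
  by rewrite oppr_le0 mulr_ge0.
Qed.

Lemma law_of_laplace (X1 : T1 -> R) (X2 : T2 -> R) :
  measurable_fun setT X1 -> measurable_fun setT X2 ->
  {ae P1, forall w, 0 <= X1 w} -> {ae P2, forall w, 0 <= X2 w} ->
  (forall s, 0 <= s ->
     \int[P1]_w expR (- (s * X1 w)) = \int[P2]_w expR (- (s * X2 w))) ->
  forall A : set R, measurable A -> P1 (X1 @^-1` A) = P2 (X2 @^-1` A).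
Proof.
move=> m1 m2 X10 X20 L; apply: law_of_cdf => // a.
have M1 : measurable [set w | X1 w <= a] by exact: measurable_le_cst.
have M2 : measurable [set w | X2 w <= a] by exact: measurable_le_cst.
have [a0|a0|a0] := ltgtP a 0; last first.
- rewrite a0 in M1 M2 *.
  apply: eq_trans (esym (fineK (fin_num_measure P1 _ M1))) _.
  apply/esym; apply: eq_trans (esym (fineK (fin_num_measure P2 _ M2))) _.
  congr EFin; apply/esym.
  have h1 := cdf0_laplace m1 X10; have h2 := cdf0_laplace m2 X20.
  apply: (@cvg_unique _ (@Rhausdorff R) _ _ _ _ h1).
  move: h2; apply: cvg_trans; apply: near_eq_cvg; apply: nearW => n.
  by rewrite L.
- apply: eq_trans (esym (fineK (fin_num_measure P1 _ M1))) _.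
  apply/esym; apply: eq_trans (esym (fineK (fin_num_measure P2 _ M2))) _.
  congr EFin; apply/esym.
  have h1 := cdf_laplace m1 X10 a0; have h2 := cdf_laplace m2 X20 a0.
  apply: (@cvg_unique _ (@Rhausdorff R) _ _ _ _ h1).
  have s0 : 0 <= ln 2 / a by rewrite divr_ge0 ?(ltW a0)// ln_ge0// ler1n.
  move: h2; apply: cvg_trans; apply: near_eq_cvg; apply: nearW => n.
  rewrite !laplace_horner//; apply: eq_bigr => i _; rewrite L//.
  by rewrite mulr_ge0.
- have neg d (T : measurableType d) (P : probability T R) (X : T -> R) :
    {ae P, forall w, 0 <= X w} -> measurable [set w | X w <= a] -> P [set w | X w <= a] = 0%E.
    move=> X0 M; have [N [mN N0 sub]] := X0.
    apply: subset_measure0 N0 => //.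
    by move=> w /= Xa; apply: sub => /= /le_trans/(_ Xa); rewrite leNgt a0.
  by rewrite (neg _ _ _ _ X10)// (neg _ _ _ _ X20).
Qed.

End law_of_laplace.

(** * Independence *)

Section independence.
Context {d : measure_display} {T : measurableType d} {R : realType}
  (P : probability T R) (xi : nat -> T -> R).
Hypothesis iid : iid_std_normal P xi.

Let unit_fun (h : R -> R) := measurable_fun setT h /\ forall y, 0 <= h y <= 1.

Let mxi j : measurable_fun setT (xi j). Proof. by case: iid. Qed.

Let Int_unit (h : R -> R) j : unit_fun h ->
  P.-integrable [set: T] (EFin \o (fun x => h (xi j x))).
Proof.
move=> [mh h01]; apply: (@Int_bounded _ _ _ _ _ 1); first exact: measurableT_comp.
by move=> x; have /andP[h0 h1] := h01 (xi j x); rewrite ger0_norm.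
Qed.

Let indicators n (A : nat -> set R) : (forall j, measurable (A j)) ->
  \int[P]_x (\prod_(j < n) \1_(A j) (xi j x)) =
  \prod_(j < n) \int[P]_x \1_(A j) (xi j x).
Proof.
move=> mA.
have mxA j : measurable (xi j @^-1` A j).
  by rewrite -[X in measurable X]setTI; exact: mxi.
have [_ _ ind] := iid.
have := ind (iota 0 n) A (iota_uniq 0 n) mA.
set B := \bigcap_(j in _) _.
have mB : measurable B.
  by rewrite /B; apply: fin_bigcap_measurable => // j _; exact: mxA.
move=> PB.
have -> : \int[P]_x (\prod_(j < n) \1_(A j) (xi j x)) = fine (P B).
  rewrite -[B]setIT -integral_indic//; apply: eq_Rintegral => x _.
  rewrite [RHS]indicE; have [xB|xB] := boolP (x \in B).
    rewrite big1// => j _; rewrite indicE mem_set//.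
    by apply: (set_mem xB) => /=; rewrite mem_iota/=.
  have [j jn xj] : exists2 j : nat, (j < n)%N & ~ A j (xi j x).
    move/negP: xB => xB; apply: contrapT => h; apply: xB; apply/mem_set => j /=.
    rewrite mem_iota/= add0n => jn; apply: contrapT => hj; apply: h; by exists j.
  by rewrite (bigD1 (Ordinal jn))//= indicE memNset// mul0r.
have Pj j : P (xi j @^-1` A j) = (\int[P]_x \1_(A j) (xi j x))%:E.
  rewrite EFin_Rint; last first.
    by apply: (Int_unit (h := \1_(A j))); split => // y; rewrite indicE; case: (_ \in _); rewrite /= ?lexx ?ler01.
  by rewrite -[X in P X]setIT -integral_indic.
rewrite PB; under eq_bigr do rewrite Pj.
suff -> : (\prod_(j <- iota 0 n) (\int[P]_x \1_(A j) (xi j x))%:E)%E =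
    (\prod_(j <- iota 0 n) \int[P]_x \1_(A j) (xi j x))%:E.
  by rewrite /= -(big_mkord xpredT (fun j => \int[P]_x \1_(A j) (xi j x))) /index_iota subn0.
by elim/big_rec2: _ => // i y1 y2 _ ->.
Qed.

(** [iid_std_normal] factorises probabilities, that is, products of indicators; general factors are
    substituted for them one index at a time. *)
Lemma iid_Rint_prod n (h : nat -> R -> R) :
  (forall j, measurable_fun setT (h j)) -> (forall j y, 0 <= h j y <= 1) ->
  \int[P]_x (\prod_(j < n) h j (xi j x)) = \prod_(j < n) \int[P]_x h j (xi j x).
Proof.
move=> mh h01.
(* Induction on [k]: the factors of index at least [k] are still indicators, the earlier ones are
   arbitrary. *)
suff key k : forall h : nat -> R -> R, (forall j, unit_fun (h j)) ->
    (forall j, (k <= j)%N -> exists2 A, measurable A & h j = \1_A) ->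
    \int[P]_x (\prod_(j < n) h j (xi j x)) = \prod_(j < n) \int[P]_x h j (xi j x).
  (* Indices from [n] on do not enter the product; the indicator of the whole line fills them in, as
     [key] constrains all [j >= k]. *)
  pose h' j := if (j < n)%N then h j else \1_setT.
  have := key n h'.
  rewrite (eq_Rintegral _ (g := fun x => \prod_(j < n) h j (xi j x))); last first.
    by move=> x _; apply: eq_bigr => j _; rewrite /h' ltn_ord.
  rewrite [RHS](eq_bigr (fun j : 'I_n => \int[P]_x h j (xi j x))); last first.
    by move=> j _; rewrite /h' ltn_ord.
  apply.
  - move=> j; rewrite /h'; case: ifP => _; split => //.
    by move=> y; rewrite indicT lexx ler01.
  - by move=> j nj; exists setT => //; rewrite /h' ltnNge nj.
elim: k => [|k IH] {mh h01}{}h uh ih.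
  have /choice[A hA] : forall j, exists A, measurable A /\ h j = \1_A.
    by move=> j; have [A mA ->] := ih j (leq0n _); exists A.
  rewrite (eq_Rintegral _ (g := fun x => \prod_(j < n) \1_(A j) (xi j x))).
    rewrite indicators; last by move=> j; have [] := hA j.
    by apply: eq_bigr => j _; have [_ ->] := hA j.
  by move=> x _; apply: eq_bigr => j _; have [_ ->] := hA j.
have [kn|nk] := ltnP k n; last first.
  pose h' j := if j == k then \1_setT else h j.
  have := IH h'.
  rewrite (eq_Rintegral _ (g := fun x => \prod_(j < n) h j (xi j x))); last first.
    by move=> x _; apply: eq_bigr => j _; rewrite /h' ltn_eqF// (leq_trans _ nk).
  rewrite [RHS](eq_bigr (fun j : 'I_n => \int[P]_x h j (xi j x))); last first.
    by move=> j _; rewrite /h' ltn_eqF// (leq_trans _ nk).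
  apply.
  - move=> j; rewrite /h'; case: ifP => _; split => //; try by case: (uh j).
    by move=> y; rewrite indicT lexx ler01.
  - move=> j kj; rewrite /h'; case: ifPn => jk; first by exists setT.
    by apply: ih; rewrite ltn_neqAle eq_sym jk.
pose ok := Ordinal kn.
pose W x := \prod_(j < n | j != ok) h j (xi j x).
pose C := \prod_(j < n | j != ok) \int[P]_x h j (xi j x).
have mW : measurable_fun setT W.
  have -> : W = fun x => \prod_(j < n) (if j != ok then h j (xi j x) else 1).
    by apply/funext => x; rewrite /W big_mkcond.
  apply: measurable_prod => j _; case: (j != ok) => //.
  by apply: measurableT_comp => //; case: (uh j).
have W0 x : 0 <= W x by apply: prodr_ge0 => j _; case: (uh j) => _ /(_ (xi j x)) /andP[].
have C0 : 0 <= C.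
  by apply: prodr_ge0 => j _; apply: Rintegral_ge0 => x _; case: (uh j) => _ /(_ (xi j x)) /andP[].
have W1 x : W x <= 1.
  apply: prodr_ile1 => j _; case: (uh j) => _ /(_ (xi j x)); done.
have iWh (g : R -> R) : unit_fun g -> P.-integrable setT (EFin \o (fun x => W x * g (xi k x))).
  move=> [mg g01]; apply: (@Int_bounded _ _ _ _ _ 1).
    by apply: measurable_funM => //; exact: measurableT_comp.
  move=> x; have /andP[g0 g1] := g01 (xi k x).
  by rewrite ger0_norm ?mulr_ge0// mulr_ile1.
have unit_ind (A : set R) : measurable A -> unit_fun \1_A.
  by move=> mA; split => // y; rewrite indicE; case: (_ \in _); rewrite /= ?lexx ?ler01.
have hA (A : set R) : measurable A ->
    \int[P]_x (W x * \1_A (xi k x)) = C * \int[P]_x \1_A (xi k x).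
  move=> mA; pose h' j := if j == k then \1_A else h j.
  have h'W j : j != ok -> h' j = h j.
    by move=> jk; rewrite /h' ifN.
  have h'k : h' k = \1_A by rewrite /h' eqxx.
  have e : \int[P]_x (\prod_(j < n) h' j (xi j x)) = \prod_(j < n) \int[P]_x h' j (xi j x).
    apply: IH.
    - by move=> j; rewrite /h'; case: ifP => _; [exact: unit_ind|].
    - move=> j kj; rewrite /h'; case: ifPn => jk; first by exists A.
      by apply: ih; rewrite ltn_neqAle eq_sym jk.
  rewrite [RHS]mulrC; transitivity (\int[P]_x (\prod_(j < n) h' j (xi j x))).
    apply: eq_Rintegral => x _; rewrite [RHS](bigD1 ok)//= h'k mulrC; congr (_ * _).
    by apply: eq_bigr => j jk; rewrite h'W.
  rewrite e (bigD1 ok)//= h'k; congr (_ * _).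
  by apply: eq_bigr => j jk; rewrite h'W.
have [_ law _] := iid.
(* By the induction hypothesis, weighting by [W] leaves the law of [xi k] normal up to the total
   mass [C]; the change of variables then passes from indicators to [h k]. *)
have key := @ge0_integral_weighted_image _ _ T (measurableTypeR R) R P
  (mscale (NngNum C0) (normal_prob 0 1)) (xi k) W (mxi k) mW W0.
have fin : forall A : set (measurableTypeR R), measurable A ->
    (\int[P]_(x in xi k @^-1` A) (W x)%:E = mscale (NngNum C0) (normal_prob 0 1) A)%E.
  move=> A mA; rewrite /mscale/= -(law k)// integral_mkcond.
  transitivity (\int[P]_x (W x * \1_A (xi k x))%:E)%E.
    apply: eq_integral => x _; rewrite patchE indicE.
    have -> : (x \in xi k @^-1` A) = (xi k x \in A) by apply/idP/idP; rewrite !inE.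
    by case: ifP; rewrite ?mulr1 ?mulr0.
  rewrite -EFin_Rint; last exact/iWh/unit_ind.
  rewrite hA// EFinM; congr (_ * _)%E; rewrite EFin_Rint; last exact/Int_unit/unit_ind.
  rewrite -[X in P X]setIT -integral_indic//.
  by rewrite -[X in measurable X]setTI; exact: mxi.
have [mk k01] := uh k.
have := key fin (fun y => (h k y)%:E).
have mkE : measurable_fun setT (fun y => (h k y)%:E) by exact/measurable_EFinP.
have hk0 y : (0 <= (h k y)%:E)%E by have /andP[] := k01 y; rewrite lee_fin.
move=> /(_ mkE hk0); rewrite ge0_integral_mscale//= -(@ge0_integral_normal_law _ _ _ P (xi k) 1 (fun y => (h k y)%:E))//; last exact: law.
under eq_integral do rewrite -EFinM.
rewrite -EFin_Rint; last exact: Int_unit.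
rewrite -EFin_Rint; last exact: iWh.
rewrite -EFinM => -[e].
rewrite (eq_Rintegral _ (g := fun x => W x * h k (xi k x))); last first.
  by move=> x _; rewrite (bigD1 ok)//= mulrC.
by rewrite e [RHS](bigD1 ok)//= mulrC.
Qed.

End independence.

(** * Continuity of the L^2 product *)

Section L2_convergence.
Context {d : measure_display} {T : measurableType d} {R : realType}
  (P : probability T R).
Local Notation dist2 f g := (L2dot P (fun x => f x - g x) (fun x => f x - g x)).

Lemma dot_cvgl (u : nat -> T -> R) (f g : T -> R) : (forall n, L2 P (u n)) ->
  L2 P f -> L2 P g -> (fun n => dist2 (u n) f) @ \oo --> 0 ->
  (fun n => L2dot P (u n) g) @ \oo --> L2dot P f g.
Proof.
move=> Lu Lf Lg cu; apply/cvgrPdist_le => e e0.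
have G0 : 0 < L2dot P g g + 1 by rewrite ltr_wpDl// dot_ge0.
have ep : 0 < e ^+ 2 / (L2dot P g g + 1) by rewrite divr_gt0// exprn_gt0.
move/cvgrPdist_le : cu => /(_ _ ep); apply: filterS => n.
rewrite sub0r normrN ger0_norm ?dot_ge0// => h.
rewrite distrC -dotBl// -(@ler_pXn2r _ 2)// ?nnegrE ?(ltW e0)//.
rewrite real_normK ?num_real//.
apply: le_trans (cauchy_schwarz (L2B (Lu n) Lf) Lg) _.
apply: (@le_trans _ _ (dist2 (u n) f * (L2dot P g g + 1))).
  by rewrite ler_wpM2l ?dot_ge0// lerDl.
by rewrite -ler_pdivlMr.
Qed.

Lemma L2_triangle2 (f g h : T -> R) : L2 P f -> L2 P g -> L2 P h ->
  dist2 f g <= (dist2 f h + dist2 h g) *+ 2.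
Proof.
move=> Lf Lg Lh.
have L1 := L2B Lf Lh; have L2' := L2B Lh Lg; have L3 := L2B L1 L2'.
have L4 := L2D L1 L2'.
have := dot_ge0 P (fun x => (f x - h x) - (h x - g x)).
rewrite dotB_sqr// => h1.
have -> : dist2 f g = L2dot P (fun x => (f x - h x) + (h x - g x)) (fun x => (f x - h x) + (h x - g x)).
  by apply: eq_Rintegral => x _; ring.
rewrite (dotD_sqr L1 L2'); lra.
Qed.

Lemma dist2C (f g : T -> R) : dist2 f g = dist2 g f.
Proof. by apply: eq_Rintegral => x _; ring. Qed.

End L2_convergence.

(** * Gaussian Hilbert spaces and the second chaos *)

Section gaussian_hilbert.
Context {d : measure_display} {T : measurableType d} {R : realType}
  (P : probability T R) (H : set (T -> R)).
Hypothesis HH : gaussian_hilbert_space P H.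
Local Notation dot := (L2dot P).
Local Notation L2 := (L2 P).
Local Notation dist2 f g := (dot (fun x => f x - g x) (fun x => f x - g x)).

(** The variance in [gauss_mgf] is forced by [mgf_var], so the law of an element of [H] is
    determined by its norm. *)
Lemma H_mgf xi : H xi -> gauss_mgf P xi (dot xi xi).
Proof.
case: HH => _ _ _ _ hg /hg/centered_gaussian_mgf[v Gv].
by rewrite (mgf_var Gv).
Qed.

Lemma H_L2 xi : H xi -> L2 xi.
Proof. by move=> /H_mgf/mgf_L2. Qed.

Lemma H_zero : H (fun=> 0). Proof. by case: HH. Qed.

Lemma H_lin (a b : R) xi eta : H xi -> H eta -> H (fun w => a * xi w + b * eta w).
Proof. by case: HH => _ h _ _ _; exact: h. Qed.

Lemma H_scale (a : R) xi : H xi -> H (fun w => a * xi w).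
Proof.
move=> Hx; have := H_lin a 0 Hx H_zero.
by under eq_fun do rewrite mulr0 addr0.
Qed.

Lemma H_add xi eta : H xi -> H eta -> H (fun w => xi w + eta w).
Proof.
by move=> Hx He; have := H_lin 1 1 Hx He; under eq_fun do rewrite !mul1r.
Qed.

Lemma H_sub xi eta : H xi -> H eta -> H (fun w => xi w - eta w).
Proof.
move=> Hx He; have := H_lin 1 (-1) Hx He.
by under eq_fun do rewrite mul1r mulN1r.
Qed.

Lemma H_sum (I : Type) (s : seq I) (Q : pred I) (F : I -> T -> R) :
  (forall i, Q i -> H (F i)) -> H (fun x => \sum_(i <- s | Q i) F i x).
Proof.
move=> h; elim: s => [|a s ih].
  rewrite (_ : (fun x => _) = fun=> 0); first exact: H_zero.
  by apply/funext => x; rewrite big_nil.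
have [Qa|Qa] := boolP (Q a).
  rewrite (_ : (fun x => _) = fun x => F a x + \sum_(i <- s | Q i) F i x).
    by apply: H_add => //; exact: h.
  by apply/funext => x; rewrite big_cons Qa.
rewrite (_ : (fun x => _) = fun x => \sum_(i <- s | Q i) F i x)//.
by apply/funext => x; rewrite big_cons (negbTE Qa).
Qed.

Lemma H_complete (u : nat -> T -> R) : (forall n, H (u n)) ->
  (forall e : R, 0 < e -> exists N, forall m n, (N <= m)%N -> (N <= n)%N ->
     dist2 (u m) (u n) <= e) ->
  exists f, H f /\ (fun n => dist2 (u n) f) @ \oo --> 0.
Proof.
move=> Hu cu; have Lu n : L2 (u n) := H_L2 (Hu n).
have [f [Lf hf]] := riesz_fischer Lu cu.
have cf : (fun n => dist2 (u n) f) @ \oo --> 0.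
  apply/cvgrPdist_le => e e0; have [N hN] := hf e e0.
  exists N => // n /= Nn; rewrite sub0r normrN ger0_norm ?dot_ge0//; exact: hN.
exists f; split => //.
case: HH => _ _ _ hc _; apply: (hc u) => //; first exact: L2_measurable Lf.
have -> : (fun n => L2dist2 P (u n) f) = (fun n => (dist2 (u n) f)%:E).
  by apply/funext => n; rewrite L2dist2E.
by apply/cvg_EFin => //; near=> n.
Unshelve. all: by end_near. Qed.

Lemma H_sqr_L2 xi : H xi -> L2 (fun x => xi x ^+ 2).
Proof. by move=> /H_mgf/mgf_L4. Qed.

Lemma H_mul_L2 xi eta : H xi -> H eta -> L2 (fun x => xi x * eta x).
Proof.
move=> Hx He.
rewrite (_ : (fun x => _) = (fun x => 4^-1 * (xi x + eta x) ^+ 2 + (- 4^-1) * (xi x - eta x) ^+ 2)).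
  by apply: L2_lin; apply: H_sqr_L2; [exact: H_add|exact: H_sub].
by apply/funext => x; field.
Qed.

Lemma dot_sqrE xi eta : dot (fun x => xi x ^+ 2) (fun x => eta x ^+ 2) =
  dot (fun x => xi x * eta x) (fun x => xi x * eta x).
Proof. by apply: eq_Rintegral => x _; ring. Qed.

(** Isserlis' formula from the kurtosis alone: [xi + eta] and [xi - eta] are again Gaussian, and
    their fourth powers add up to [2 xi^4 + 12 xi^2 eta^2 + 2 eta^4]. *)
Lemma gauss_sqr_dot xi eta : H xi -> H eta ->
  dot (fun x => xi x ^+ 2) (fun x => eta x ^+ 2) =
  dot xi xi * dot eta eta + dot xi eta ^+ 2 *+ 2.
Proof.
move=> Hx He.
have Lx := H_L2 Hx; have Le := H_L2 He.
have K z : H z -> dot (fun x => z x ^+ 2) (fun x => z x ^+ 2) = 3 * dot z z ^+ 2.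
  by move=> Hz; rewrite (mgf_kurtosis (H_mgf Hz)).
have Hp := H_add Hx He; have Hm := H_sub Hx He.
have Lxe := H_mul_L2 Hx He; have Lx2 := H_sqr_L2 Hx; have Le2 := H_sqr_L2 He.
have Lp2 := H_sqr_L2 Hp; have Lm2 := H_sqr_L2 Hm.
have Lp := H_L2 Hp; have Lm := H_L2 Hm.
have Kp := K _ Hp; have Km := K _ Hm.
have Kx := K _ Hx; have Ke := K _ He.
have dp := dotD_sqr Lx Le.
have dm := dotB_sqr Lx Le.
rewrite dp in Kp; rewrite dm in Km.
have S : dot (fun x => (xi x + eta x) ^+ 2) (fun x => (xi x + eta x) ^+ 2) +
  dot (fun x => (xi x - eta x) ^+ 2) (fun x => (xi x - eta x) ^+ 2) =
  2 * dot (fun x => xi x ^+ 2) (fun x => xi x ^+ 2) +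
  12 * dot (fun x => xi x ^+ 2) (fun x => eta x ^+ 2) +
  2 * dot (fun x => eta x ^+ 2) (fun x => eta x ^+ 2).
  rewrite /L2dot -RintD; try exact: L2M.
  rewrite -!RintZ; try exact: L2M.
  rewrite -!RintD; try (by apply: IntZ; exact: L2M); last first.
    by apply: IntD; apply: IntZ; exact: L2M.
  by apply: eq_Rintegral => x _; ring.
rewrite Kp Km Kx Ke in S; lra.
Qed.

Lemma gauss_sqr_dot_mul z xi eta : H z -> H xi -> H eta ->
  dot (fun x => z x ^+ 2) (fun x => xi x * eta x) =
  dot z z * dot xi eta + (dot z xi * dot z eta) *+ 2.
Proof.
move=> Hz Hx He.
have Lz := H_L2 Hz; have Lx := H_L2 Hx; have Le := H_L2 He.
have Hp := H_add Hx He; have Hm := H_sub Hx He.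
have Lz2 := H_sqr_L2 Hz; have Lp2 := H_sqr_L2 Hp; have Lm2 := H_sqr_L2 Hm.
have Lp := H_L2 Hp; have Lm := H_L2 Hm.
have Kp := gauss_sqr_dot Hz Hp; have Km := gauss_sqr_dot Hz Hm.
have dp := dotD_sqr Lx Le.
have dm := dotB_sqr Lx Le.
rewrite dp dotDr// in Kp; rewrite dm dotBr// in Km.
have -> : (fun x => xi x * eta x) =
    (fun x => 4^-1 * (xi x + eta x) ^+ 2 + (- 4^-1) * (xi x - eta x) ^+ 2).
  by apply/funext => x; field.
by rewrite dot_linr// Kp Km; field.
Qed.

(** The 3 is [1 + 2]: the doubled term of [gauss_sqr_dot] is bounded by Cauchy-Schwarz. *)
Lemma H_mul_norm_le xi eta : H xi -> H eta ->
  dot (fun x => xi x * eta x) (fun x => xi x * eta x) <= 3 * (dot xi xi * dot eta eta).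
Proof.
move=> Hx He; rewrite -dot_sqrE gauss_sqr_dot//.
have := cauchy_schwarz (H_L2 Hx) (H_L2 He); lra.
Qed.

(** The Wick square [:z^2:]. By polarisation these span the second chaos, so the approximating sums
    need no mixed products. *)
Definition wick_square (z : T -> R) : T -> R := fun x => z x ^+ 2 - dot z z.

Lemma wick_sqr_L2 z : H z -> L2 (wick_square z).
Proof. by move=> Hz; apply: L2B; [exact: H_sqr_L2|exact: L2_cst]. Qed.

(** On products, [:z^2:] acts as twice the rank-one form of [z]; this makes the operator of a finite
    chaos sum explicit. *)
Lemma wick_sqr_dot_mul z xi eta : H z -> H xi -> H eta ->
  dot (wick_square z) (fun x => xi x * eta x) = (dot z xi * dot z eta) *+ 2.
Proof.
move=> Hz Hx He; have Lxe := H_mul_L2 Hx He.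
rewrite /wick_square dotBl//; [|exact: H_sqr_L2|exact: L2_cst].
rewrite gauss_sqr_dot_mul//.
have -> : dot (fun=> dot z z) (fun x => xi x * eta x) = dot z z * dot xi eta.
  by rewrite /L2dot RintZ//; apply: L2M; exact: H_L2.
ring.
Qed.

Lemma wick_sqr_mean z : H z -> \int[P]_x wick_square z x = 0.
Proof.
move=> Hz; rewrite /wick_square RintegralB//; last exact: Int_cst.
  rewrite Rint_cst /L2dot; apply/eqP; rewrite subr_eq0; apply/eqP.
  by apply: eq_Rintegral => x _; rewrite expr2.
exact: L2_sqr (H_L2 Hz).
Qed.

Lemma wick_sqr_dot y z : H y -> H z -> dot (wick_square y) (wick_square z) = dot y z ^+ 2 *+ 2.
Proof.
move=> Hy Hz; have Ly := wick_sqr_L2 Hy.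
rewrite {2}/wick_square dotBr//; [|exact: H_sqr_L2|exact: L2_cst].
have -> : (fun x => z x ^+ 2) = (fun x => z x * z x) by apply/funext => x; rewrite expr2.
rewrite wick_sqr_dot_mul//.
have -> : dot (wick_square y) (fun=> dot z z) = dot z z * \int[P]_x wick_square y x.
  rewrite -RintZ; last exact: L2_Int.
  by apply: eq_Rintegral => x _; rewrite mulrC.
by rewrite wick_sqr_mean// mulr0 subr0 expr2.
Qed.

End gaussian_hilbert.

(** * The bounded symmetric form attached to Y *)

Section quadratic_form.
Context {d : measure_display} {T : measurableType d} {R : realType}
  (P : probability T R) (H : set (T -> R)) (Y : T -> R).
Hypothesis HH : gaussian_hilbert_space P H.
Hypothesis Ych : wick_chaos2 P H Y.
Hypothesis Ymean : \int[P]_x Y x = 0.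
Local Notation dot := (L2dot P).
Local Notation L2 := (L2 P).
Local Notation dist2 f g := (dot (fun x => f x - g x) (fun x => f x - g x)).
Local Notation wick_sqr := (wick_square P).

Lemma wick_polarization xi eta x : H xi -> H eta ->
  wick P xi eta x = 4^-1 * wick_sqr (fun w => xi w + eta w) x +
                    (- 4^-1) * wick_sqr (fun w => xi w - eta w) x.
Proof.
move=> Hx He; rewrite /wick /wick_square.
have Lx := H_L2 HH Hx; have Le := H_L2 HH He.
rewrite EFin_expectation; last exact: L2M.
by rewrite dotD_sqr// dotB_sqr//= -/(dot xi eta); field.
Qed.

Lemma chaos_approx (eps : R) : 0 < eps ->
  exists n (c : nat -> R) (z : nat -> T -> R), (forall i, H (z i)) /\
    (L2dist2 P Y (fun w => (\sum_(i < n) c i * wick_sqr (z i) w)%R) < eps%:E)%E.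
Proof.
move=> eps0; case: Ych => mY /(_ eps eps0)[n [c [xs [ys [hxy hlt]]]]].
(* The first [n] entries carry the sums and the next [n] the differences, with coefficients [c / 4]
   and [- c / 4] from polarisation; the value 0 beyond keeps every [z i] in [H]. *)
pose z i := if (i < n)%N then (fun w => xs i w + ys i w)
  else if (i < n + n)%N then (fun w => xs (i - n)%N w - ys (i - n)%N w) else fun=> 0.
pose c' i := if (i < n)%N then c i / 4 else - (c (i - n)%N / 4).
exists (n + n)%N, c', z; split.
  move=> i; rewrite /z; case: ltnP => [ni|ni].
    by have [Hx He] := hxy i ni; exact: (H_add HH).
  case: ltnP => [ni2|_]; last exact: H_zero HH.
  have ni' : (i - n < n)%N by rewrite ltn_subLR.
  by have [Hx He] := hxy _ ni'; exact: (H_sub HH).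
move: hlt; congr (L2dist2 P Y _ < _)%E; apply/funext => w.
rewrite big_split_ord/= -big_split/=; apply: eq_bigr => i _.
have [Hx He] := hxy i (ltn_ord i).
rewrite wick_polarization// /c' /z /= ltn_ord ltnNge leq_addr/= ltn_add2l ltn_ord addKn.
ring.
Qed.

Lemma sum_wick_sqr_L2 n (c : nat -> R) (z : nat -> T -> R) : (forall i, H (z i)) ->
  L2 (fun w => \sum_(i < n) c i * wick_sqr (z i) w).
Proof. by move=> Hz; apply: L2_sum => i _; apply: L2Z; exact: wick_sqr_L2 (Hz i). Qed.

Lemma chaos_L2 : L2 Y.
Proof.
have [n [c [z [Hz h]]]] := chaos_approx ltr01.
have LS := sum_wick_sqr_L2 n c Hz.
set S := (fun w => _) in LS h.
have mY : measurable_fun setT Y by case: Ych.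
have LYS : L2 (fun x => Y x - S x).
  have m : measurable_fun setT (fun x => Y x - S x).
    by apply: measurable_funB => //; exact: L2_measurable LS.
  split => //; apply: ge0_Int; first exact: measurable_funX.
    by move=> x; exact: sqr_ge0.
  by move: h; rewrite /L2dist2 unlock => /lt_trans; apply; rewrite ltry.
by have := L2D LYS LS; under eq_fun do rewrite subrK.
Qed.

Lemma chaos_approx_seq : exists Z : nat -> T -> R, forall k,
  (exists n (c : nat -> R) (z : nat -> T -> R), (forall i, H (z i)) /\
     Z k = fun w => \sum_(i < n) c i * wick_sqr (z i) w) /\
  dist2 Y (Z k) <= k.+1%:R^-1.
Proof.
have /choice[Z hZ] : forall k : nat, exists Z, (exists n (c : nat -> R) (z : nat -> T -> R), (forall i, H (z i)) /\
     Z = fun w => \sum_(i < n) c i * wick_sqr (z i) w) /\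
  dist2 Y Z <= k.+1%:R^-1.
  move=> k; have k0 : 0 < k.+1%:R^-1 :> R by rewrite invr_gt0.
  have [n [c [z [Hz h]]]] := chaos_approx k0.
  exists (fun w => \sum_(i < n) c i * wick_sqr (z i) w); split; first by exists n, c, z.
  by move: h; rewrite L2dist2E ?lte_fin; [exact: ltW|exact: chaos_L2|exact: sum_wick_sqr_L2].
by exists Z.
Qed.

(** Real-valued twin of [Bform], with [xi * eta] grouped so that the rules for [dot] apply; [BformE]
    links the two on [H]. *)
Definition quad_form (xi eta : T -> R) : R := 2^-1 * dot Y (fun x => xi x * eta x).

Lemma BformE xi eta : H xi -> H eta -> Bform P Y xi eta = (quad_form xi eta)%:E.
Proof.
move=> Hx He; rewrite /Bform /quad_form.
rewrite EFin_expectation; last first.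
  apply: (Int_ext _ (L2M chaos_L2 (H_mul_L2 HH Hx He))) => x; by rewrite mulrA.
by rewrite -EFinM; congr (_ * _)%:E; apply: eq_Rintegral => x _; rewrite mulrA.
Qed.

Lemma BqC xi eta : quad_form xi eta = quad_form eta xi.
Proof. by congr (_ * dot _ _); apply/funext => x; rewrite mulrC. Qed.

Lemma Bq_linl (a b : R) xi eta zeta : H xi -> H eta -> H zeta ->
  quad_form (fun x => a * xi x + b * eta x) zeta = a * quad_form xi zeta + b * quad_form eta zeta.
Proof.
move=> Hx He Hz; rewrite /quad_form.
have -> : (fun x => (a * xi x + b * eta x) * zeta x) =
   (fun x => a * (xi x * zeta x) + b * (eta x * zeta x)) by apply/funext => x; ring.
have L1 := H_mul_L2 HH Hx Hz; have L2' := H_mul_L2 HH He Hz; have LY := chaos_L2.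
by rewrite (dot_linr _ _ L1 L2' LY); ring.
Qed.

Lemma Bq_linr (a b : R) xi eta zeta : H xi -> H eta -> H zeta ->
  quad_form zeta (fun x => a * xi x + b * eta x) = a * quad_form zeta xi + b * quad_form zeta eta.
Proof. by move=> *; rewrite BqC Bq_linl// (BqC xi) (BqC eta). Qed.

Lemma BqZl (a : R) xi zeta : H xi -> H zeta ->
  quad_form (fun x => a * xi x) zeta = a * quad_form xi zeta.
Proof.
move=> Hx Hz; have := Bq_linl a 0 Hx Hx Hz.
by under eq_fun do rewrite mul0r addr0; rewrite mul0r addr0.
Qed.

Lemma Bq_wick_sqr xi : H xi -> dot Y (wick_sqr xi) = quad_form xi xi *+ 2.
Proof.
move=> Hx; have LY := chaos_L2.
rewrite /wick_square (dotBr (H_sqr_L2 HH Hx) (L2_cst P _) LY).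
have -> : dot Y (fun=> dot xi xi) = dot xi xi * \int[P]_x Y x.
  rewrite -RintZ; last exact: L2_Int.
  by apply: eq_Rintegral => x _; rewrite mulrC.
rewrite Ymean mulr0 subr0 /quad_form.
have -> : (fun x => xi x ^+ 2) = (fun x => xi x * xi x) by apply/funext => x; rewrite expr2.
by field.
Qed.

(** Cauchy-Schwarz and [H_mul_norm_le] give the constant [3/4], rounded up to 1. *)
Lemma Bq_bound xi eta : H xi -> H eta ->
  quad_form xi eta ^+ 2 <= dot Y Y * (dot xi xi * dot eta eta).
Proof.
move=> Hx He; have LY := chaos_L2; have Lxe := H_mul_L2 HH Hx He.
have h1 := cauchy_schwarz LY Lxe; have h2 := H_mul_norm_le HH Hx He.
have Y0 := dot_ge0 P Y.
have xe0 : 0 <= dot xi xi * dot eta eta by rewrite mulr_ge0 ?dot_ge0.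
rewrite /quad_form exprMn.
apply: (@le_trans _ _ (2^-1 ^+ 2 * (dot Y Y * (3 * (dot xi xi * dot eta eta))))).
  rewrite ler_wpM2l ?sqr_ge0//; apply: le_trans h1 _.
  by rewrite ler_wpM2l.
have -> : 2^-1 ^+ 2 = 4^-1 :> R by field.
have : 0 <= dot Y Y * (dot xi xi * dot eta eta) by rewrite mulr_ge0.
lra.
Qed.

Lemma Bq_cvgl (u : nat -> T -> R) f g : (forall n, H (u n)) -> H f -> H g ->
  (fun n => dist2 (u n) f) @ \oo --> 0 ->
  (fun n => quad_form (u n) g) @ \oo --> quad_form f g.
Proof.
move=> Hu Hf Hg cu; apply/cvgrPdist_le => e e0.
have G0 : 0 < dot Y Y * dot g g + 1 by rewrite ltr_wpDl// mulr_ge0 ?dot_ge0.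
have ep : 0 < e ^+ 2 / (dot Y Y * dot g g + 1) by rewrite divr_gt0// exprn_gt0.
move/cvgrPdist_le : cu => /(_ _ ep); apply: filterS => n.
rewrite sub0r normrN ger0_norm ?dot_ge0// => h.
have -> : quad_form f g - quad_form (u n) g = - quad_form (fun x => u n x - f x) g.
  have := Bq_linl 1 (-1) (Hu n) Hf Hg.
  by under eq_fun do rewrite mul1r mulN1r; move=> ->; ring.
rewrite normrN -(@ler_pXn2r _ 2)// ?nnegrE ?(ltW e0)//.
rewrite real_normK ?num_real//.
apply: le_trans (Bq_bound (H_sub HH (Hu n) Hf) Hg) _.
apply: (@le_trans _ _ (dist2 (u n) f * (dot Y Y * dot g g + 1))).
  by rewrite mulrCA ler_wpM2l ?dot_ge0// lerDl.
by rewrite -ler_pdivlMr.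
Qed.

(* For a finite combination [Z = sum c_i :z_i^2:] the operator is explicit,
   [xi |-> sum c_i <z_i, xi> z_i]; the general case is a limit of these. *)
Lemma Bq_riesz xi : H xi -> exists zeta, H zeta /\ forall eta, H eta -> dot zeta eta = quad_form xi eta.
Proof.
move=> Hx; have LY := chaos_L2; have Lx := H_L2 HH Hx.
have [Z hZ] := chaos_approx_seq.
have LZ k : L2 (Z k).
  by have [[n [c [z [Hz ->]]]] _] := hZ k; exact: sum_wick_sqr_L2.
have /choice[zt hzt] : forall k, exists zeta, H zeta /\
    forall eta, H eta -> dot zeta eta = 2^-1 * dot (Z k) (fun x => xi x * eta x).
  move=> k; have [[n [c [z [Hz ->]]]] _] := hZ k.
  exists (fun w => \sum_(i < n) (c i * dot (z i) xi) * z i w); split.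
    by apply: (H_sum HH) => i _; exact: (H_scale HH).
  move=> eta He; have Le := H_L2 HH He; have Lxe := H_mul_L2 HH Hx He.
  rewrite [LHS]dot_suml//; last by move=> i _; apply: L2Z; exact: (H_L2 HH (Hz i)).
  rewrite dot_suml//; last by move=> i _; apply: L2Z; exact: (wick_sqr_L2 HH (Hz i)).
  rewrite mulr_sumr; apply: eq_bigr => i _.
  rewrite (dotZl _ (wick_sqr_L2 HH (Hz i)) Lxe) (dotZl _ (H_L2 HH (Hz i)) Le).
  by rewrite (wick_sqr_dot_mul HH (Hz i) Hx He); field.
have Hzt k : H (zt k) by have [] := hzt k.
have dzt k eta : H eta -> dot (zt k) eta = 2^-1 * dot (Z k) (fun x => xi x * eta x).
  by have [_] := hzt k; exact.
(* Testing the difference [del] against itself gives [D = q / 2] with [q^2 <= 3 <xi, xi> ZZ D];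
   dividing by [D] controls the representing vectors by the approximants of [Y]. *)
have cauchy m n : dist2 (zt m) (zt n) <= dot xi xi * dist2 (Z m) (Z n).
  have Hd := H_sub HH (Hzt m) (Hzt n); have Ld := H_L2 HH Hd.
  have Lxd := H_mul_L2 HH Hx Hd.
  set del := (fun x => zt m x - zt n x) in Hd Ld Lxd *.
  have e1 : dot del del = 2^-1 * dot (fun x => Z m x - Z n x) (fun x => xi x * del x).
    rewrite {1}/del (dotBl (H_L2 HH (Hzt m)) (H_L2 HH (Hzt n)) Ld).
    by rewrite !dzt// dotBl//; ring.
  have LZZ := L2B (LZ m) (LZ n).
  have h1 := cauchy_schwarz LZZ Lxd; have h2 := H_mul_norm_le HH Hx Hd.
  have D0 := dot_ge0 P del; have X0 := dot_ge0 P xi.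
  have ZZ0 := dot_ge0 P (fun x => Z m x - Z n x).
  set D := dot del del in e1 h2 D0 *; set ZZ := dist2 (Z m) (Z n) in h1 ZZ0 *.
  set q := dot _ (fun x => xi x * del x) in e1 h1.
  have h3 : q ^+ 2 <= ZZ * (3 * (dot xi xi * D)).
    by apply: le_trans h1 _; rewrite ler_wpM2l.
  have h4 : D * D <= dot xi xi * ZZ * D.
    have -> : D * D = 4^-1 * q ^+ 2 by rewrite e1; field.
    have : 0 <= ZZ * (dot xi xi * D) by rewrite !mulr_ge0.
    lra.
  have [->|D0'] := eqVneq D 0; first by rewrite mulr_ge0.
  by rewrite ler_pM2r// lt_neqAle eq_sym D0' in h4.
have [zeta [Hzeta cz]] : exists f, H f /\ (fun n => dist2 (zt n) f) @ \oo --> 0.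
  apply: (H_complete HH Hzt) => e e0.
  have X1 : 0 < dot xi xi + 1 by rewrite ltr_wpDl// dot_ge0.
  (* Makes [1 / (k + 1)] at most [e / (4 (<xi, xi> + 1))] for [k >= N]; the 4 absorbs the two terms
     of [L2_triangle2] and its factor 2. *)
  pose N := Num.truncn (4 * (dot xi xi + 1) / e).
  exists N => m n Nm Nn; apply: le_trans (cauchy m n) _.
  have bnd k : (N <= k)%N -> dist2 Y (Z k) <= e / (4 * (dot xi xi + 1)).
    move=> Nk; have [_ h] := hZ k; apply: le_trans h _.
    rewrite -[leRHS]invrK lef_pV2 ?posrE ?ltr0n ?invr_gt0 ?divr_gt0 ?mulr_gt0//.
    rewrite invf_div (le_trans (ltW (truncnS_gt _)))// ler_nat ltnS//.
  have h := L2_triangle2 (LZ m) (LZ n) LY.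
  have h1 := bnd _ Nm; have h2 := bnd _ Nn.
  have X0 := dot_ge0 P xi.
  apply: (@le_trans _ _ ((dot xi xi + 1) * dist2 (Z m) (Z n))).
    by rewrite ler_wpM2r ?dot_ge0// lerDl.
  have h3 : dist2 (Z m) (Z n) <= e / (dot xi xi + 1).
    apply: le_trans h _; rewrite (dist2C _ (Z m) Y).
    have -> : e / (dot xi xi + 1) = (e / (4 * (dot xi xi + 1)) + e / (4 * (dot xi xi + 1))) *+ 2.
      by field; rewrite gt_eqF.
    by rewrite lerMn2r/= lerD.
  by rewrite mulrC -ler_pdivlMr.
exists zeta; split => // eta He.
have Le := H_L2 HH He; have Lxe := H_mul_L2 HH Hx He.
have c1 := dot_cvgl (fun n => H_L2 HH (Hzt n)) (H_L2 HH Hzeta) Le cz.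
apply: (@cvg_unique _ (@Rhausdorff R) _ _ _ _ c1).
have cZ : (fun n => dist2 (Z n) Y) @ \oo --> 0.
  apply: (@squeeze_cvgr _ _ _ _ (fun=> 0) (fun n => n.+1%:R^-1)).
  - by apply: nearW => n; rewrite dot_ge0/= dist2C; have [] := hZ n.
  - exact: cvg_cst.
  - exact: cvg_harmonic.
have c2 := dot_cvgl LZ LY Lxe cZ.
have : (fun n => 2^-1 * dot (Z n) (fun x => xi x * eta x)) @ \oo --> quad_form xi eta.
  by apply: cvgM => //; exact: cvg_cst.
by apply: cvg_trans; apply: near_eq_cvg; apply: nearW => n; rewrite dzt.
Qed.

End quadratic_form.

(** * Eigenvectors *)

Section log_convex.
Context {R : realType} (m : nat -> R) (K : R).
Hypothesis m_gt0 : forall k, 0 < m k.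
Hypothesis m_convex : forall k, m k.+1 ^+ 2 <= m k * m k.+2.
Hypothesis m_bound : forall k, m k.*2.+1 <= K * m k.*2.

Let r k := m k.+1 / m k.

Lemma log_convex_ratio_homo : {homo r : i j / (i <= j)%N >-> i <= j}.
Proof.
apply/nondecreasing_seqP => k; rewrite /r ler_pdivrMr// mulrAC ler_pdivlMr//.
by rewrite -expr2 mulrC.
Qed.

(** The ratios increase, so bounding them at even indices bounds them all. Their limit [rho]
    dominates each ratio, which is why [m k / rho ^+ k] decreases. *)
Lemma log_convex_limit_ratio : exists rho : R, [/\ 0 < rho,
  forall k, m k.+1 / rho ^+ k.+1 <= m k / rho ^+ k &
  (fun k => r k / rho) @ \oo --> (1 : R)].
Proof.
have rK k : r k <= K.
  apply: le_trans (log_convex_ratio_homo (_ : (k <= k.*2)%N)) _.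
    by rewrite -addnn leq_addr.
  by rewrite /r ler_pdivrMr.
have rc : cvgn r.
  by apply: nondecreasing_is_cvgn; [exact: log_convex_ratio_homo|exists K => _ [k _ <-]].
have r_gt0 k : 0 < r k by rewrite divr_gt0.
have r_le k : r k <= limn r by apply: nondecreasing_cvgn_le => //; exact: log_convex_ratio_homo.
have rho0 : 0 < limn r by apply: lt_le_trans (r_le 0%N).
exists (limn r); split => //.
- move=> k; rewrite exprS invfM mulrA ler_wpM2r//.
    by rewrite invr_ge0 exprn_ge0// ltW.
  by rewrite ler_pdivrMr// -ler_pdivrMl// mulrC; exact: r_le.
- rewrite -[X in _ --> X](@divff _ (limn r)) ?gt_eqF//.
  by apply: cvgM => //; exact: cvg_cst.
Qed.

End log_convex.

Section almost_orthogonal.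
Context {R : realType} (mu : nat -> R).
Hypothesis mu_gt0 : forall k, 0 < mu k.
Hypothesis mu_cvg0 : mu @ \oo --> 0.
Hypothesis mu_ratio : (fun k => mu k.+1 / mu k) @ \oo --> (1 : R).
Hypothesis mu_cs : forall i j, mu (i + j)%N ^+ 2 <= mu i.*2 * mu j.*2.

(** Since [mu] tends to 0, some [k0] makes [4 mu (2n + 2 k0)] at most [del mu (2n)]. With [k0]
    fixed, ratios tending to 1 give [mu (n + k) <= 2 mu (n + k0 + k)] for large [k], and [mu_cs]
    bounds the square of [mu (n + k0 + k)] by [mu (2n + 2 k0) mu (2k)]. *)
Lemma almost_orthogonal_tail n (del : R) : 0 < del ->
  exists M, forall k, (M <= k)%N -> mu (n + k)%N ^+ 2 <= del * (mu n.*2 * mu k.*2).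
Proof.
move=> del0.
have p0 : 0 < del * mu n.*2 / 4 by rewrite divr_gt0// mulr_gt0.
have [k0 hk0] : exists k0, 4 * mu (n + k0).*2 <= del * mu n.*2.
  move/cvgrPdist_le : mu_cvg0 => /(_ _ p0)[N _ hN]; exists N.
  have := hN (n + N).*2; rewrite /= sub0r normrN gtr0_norm// => h.
  rewrite mulrC -ler_pdivlMr//; apply: h.
  by rewrite -addnn (leq_trans (leq_addl n N))// leq_addr.
have c1 j : (fun k => mu (k + j)%N / mu k) @ \oo --> (1 : R).
  elim: j => [|j IH].
    apply: (@cvg_trans _ ((fun=> 1 : R) @ \oo)); last exact: cvg_cst.
    by apply: near_eq_cvg; apply: nearW => k; rewrite addn0 divff// gt_eqF.
  have h : (fun k => mu (k + j).+1 / mu (k + j)%N) @ \oo --> (1 : R).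
    by have := mu_ratio; rewrite -(@cvg_shiftn j).
  have : (fun k => mu (k + j).+1 / mu (k + j)%N * (mu (k + j)%N / mu k)) @ \oo --> (1 * 1 : R).
    exact: cvgM.
  rewrite mulr1; apply: cvg_trans; apply: near_eq_cvg; apply: nearW => k.
  by rewrite addnS mulrA divfK// gt_eqF.
have [M hM] : exists M, forall k, (M <= k)%N -> mu k <= 2 * mu (k + k0)%N.
  have /cvgrPdist_le/(_ (2^-1)) := c1 k0.
  rewrite invr_gt0 ltr0n => /(_ isT)[M _ hM]; exists M => k Mk.
  have := hM k Mk; rewrite /= ler_distlC => /andP[h _].
  have : 2^-1 <= mu (k + k0)%N / mu k by lra.
  by rewrite ler_pdivlMr// mulrC ler_pdivrMr// mulrC.
exists M => k Mk.
have h1 : mu (n + k)%N <= 2 * mu (n + k0 + k)%N.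
  by rewrite addnAC; apply: hM; rewrite (leq_trans Mk)// leq_addl.
have h2 := mu_cs (n + k0) k.
have h3 : mu (n + k)%N ^+ 2 <= 4 * mu (n + k0 + k)%N ^+ 2.
  have -> : 4 * mu (n + k0 + k)%N ^+ 2 = (2 * mu (n + k0 + k)%N) ^+ 2 by ring.
  by rewrite ler_pXn2r// nnegrE ?mulr_ge0// ltW.
apply: (le_trans h3); apply: (@le_trans _ _ (4 * (mu (n + k0).*2 * mu k.*2))).
  by rewrite ler_pM2l.
by rewrite !mulrA ler_wpM2r// ltW.
Qed.

(** Greedy choice: the next index is taken past the thresholds of all earlier ones. *)
Lemma almost_orthogonal_family (del : R) k : 0 < del ->
  exists f : nat -> nat, forall i j, (i < k)%N -> (j < k)%N -> i != j ->
    mu (f i + f j)%N ^+ 2 <= del * (mu (f i).*2 * mu (f j).*2).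
Proof.
move=> del0.
have /choice[M hM] : forall n, exists M, forall k, (M <= k)%N ->
    mu (n + k)%N ^+ 2 <= del * (mu n.*2 * mu k.*2).
  by move=> n; exact: almost_orthogonal_tail.
elim: k => [|k [f IH]]; first by exists id.
pose m := (\max_(i < k) M (f i))%N.
have Mm i : (i < k)%N -> (M (f i) <= m)%N.
  by move=> ik; exact: (@leq_bigmax _ (fun i : 'I_k => M (f i)) (Ordinal ik)).
exists (fun i => if (i < k)%N then f i else m) => i j.
rewrite !ltnS; rewrite leq_eqVlt => /predU1P[->|ik]; rewrite leq_eqVlt => /predU1P[->|jk].
- by rewrite eqxx.
- move=> _; rewrite ltnn jk addnC [in leRHS](mulrC (mu m.*2)).
  by apply: hM; exact: Mm.
- by move=> _; rewrite ltnn ik; apply: hM; exact: Mm.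
- by move=> ij; rewrite ik jk; exact: IH.
Qed.

End almost_orthogonal.

(** * Bessel inequality and power iteration *)

Section power_iteration.
Context {d : measure_display} {T : measurableType d} {R : realType}
  (P : probability T R) (H : set (T -> R)) (Y : T -> R).
Hypothesis HH : gaussian_hilbert_space P H.
Hypothesis Ych : wick_chaos2 P H Y.
Hypothesis Ymean : \int[P]_x Y x = 0.
Local Notation dot := (L2dot P).
Local Notation L2 := (L2 P).
Local Notation dist2 f g := (dot (fun x => f x - g x) (fun x => f x - g x)).
Local Notation wick_sqr := (wick_square P).
Local Notation Bq := (quad_form P Y).

(** Pair [Y] with the sum [S] of the Wick squares of the [e i]: the product is at least [2 k bet],
    while [|S|^2 = 2 sum <e_i, e_j>^2 <= 4 k], because the tolerance [1/k] keeps the off-diagonal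
    part below the diagonal one. Cauchy-Schwarz concludes. *)
Lemma bessel_almost_orthogonal k (e : nat -> T -> R) (bet : R) :
  0 <= bet ->
  (forall i, (i < k)%N -> H (e i)) ->
  (forall i, (i < k)%N -> dot (e i) (e i) = 1) ->
  (forall i j, (i < k)%N -> (j < k)%N -> i != j -> dot (e i) (e j) ^+ 2 <= k%:R^-1) ->
  (forall i, (i < k)%N -> bet <= Bq (e i) (e i)) ->
  k%:R * bet ^+ 2 <= dot Y Y.
Proof.
move=> bet0 He e1 eo eB; have LY := chaos_L2 HH Ych.
have [->|k0] := posnP k; first by rewrite mul0r dot_ge0.
have kp : 0 < k%:R :> R by rewrite ltr0n.
pose S x := \sum_(i < k) wick_sqr (e i) x.
have Lw i : (i < k)%N -> L2 (wick_sqr (e i)).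
  by move=> ik; exact: (wick_sqr_L2 HH (He i ik)).
have LS : L2 S by apply: L2_sum => i _; exact: Lw.
have YS : k%:R * bet *+ 2 <= dot Y S.
  rewrite /S dot_sumr//; last by move=> i _; exact: Lw.
  rewrite (eq_bigr (fun i : 'I_k => Bq (e i) (e i) *+ 2)); last first.
    by move=> i _; rewrite (Bq_wick_sqr HH Ych Ymean (He i (ltn_ord i))).
  have -> : k%:R * bet *+ 2 = \sum_(i < k) bet *+ 2.
    by rewrite sumr_const card_ord -mulrnAr mulr_natl.
  by apply: ler_sum => i _; rewrite lerMn2r/= eB.
have SS : dot S S <= 4 * k%:R.
  rewrite {1}/S dot_suml//; last by move=> i _; exact: Lw.
  apply: (@le_trans _ _ (\sum_(i < k) 4)); last first.
    by rewrite sumr_const card_ord mulr_natr.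
  apply: ler_sum => i _; rewrite /S dot_sumr//; [|by move=> j _; exact: Lw|exact: Lw].
  rewrite (bigD1 i)//= (wick_sqr_dot HH (He i (ltn_ord i)) (He i (ltn_ord i))).
  rewrite e1// expr1n.
  apply: (@le_trans _ _ (1 *+ 2 + \sum_(j < k | j != i) (k%:R^-1 *+ 2))).
    rewrite lerD2l; apply: ler_sum => j ji.
    rewrite (wick_sqr_dot HH (He i (ltn_ord i)) (He j (ltn_ord j))).
    by rewrite lerMn2r/= eo// eq_sym.
  apply: (@le_trans _ _ (1 *+ 2 + \sum_(j < k) (k%:R^-1 *+ 2))).
    rewrite lerD2l [leRHS](bigD1 i)//= lerDr mulrn_wge0// invr_ge0 ltW//.
  rewrite sumr_const card_ord -mulrnA mulnC mulrnA -[k%:R^-1 *+ k]mulr_natr mulVf ?gt_eqF//.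
  lra.
have := cauchy_schwarz LY LS => cs.
have h1 : (k%:R * bet *+ 2) ^+ 2 <= dot Y S ^+ 2.
  rewrite ler_pXn2r// nnegrE; first by rewrite mulrn_wge0// mulr_ge0// ltW.
  by apply: le_trans YS; rewrite mulrn_wge0// mulr_ge0// ltW.
have h2 : dot Y Y * dot S S <= dot Y Y * (4 * k%:R) by rewrite ler_wpM2l ?dot_ge0.
have h3 : (k%:R * bet *+ 2) ^+ 2 <= dot Y Y * (4 * k%:R) by apply: le_trans h1 _; exact: le_trans cs h2.
have -> : k%:R * bet ^+ 2 = (k%:R * bet *+ 2) ^+ 2 / (4 * k%:R).
  by field; rewrite gt_eqF.
by rewrite ler_pdivrMr// mulr_gt0.
Qed.

Hypothesis Bpos : forall xi, H xi -> 0 <= Bq xi xi.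

Lemma Bq_cauchy_schwarz f g : H f -> H g -> Bq f g ^+ 2 <= Bq f f * Bq g g.
Proof.
move=> Hf Hg; apply: psd_quadratic_discr => t.
have := Bpos (H_lin HH 1 t Hf Hg).
have Hfg := H_lin HH 1 t Hf Hg.
rewrite (Bq_linl HH Ych _ _ Hf Hg Hfg) !(Bq_linr HH Ych)//.
rewrite (BqC P Y g f).
by congr (0 <= _); ring.
Qed.

(** The weak form avoids naming the operator. The zero function qualifies, so non-triviality is a
    separate condition on [dot v v]. *)
Definition eigenvector (v : T -> R) (mu : R) :=
  H v /\ forall eta, H eta -> Bq v eta = mu * dot v eta.

(* With a_n = A^n xi0, the numbers m_k = <a_k, a_0> are log-convex, so m_(k+1) / m_k
   increases to some rho; the a_n / rho^n then form a Cauchy sequence. *)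
Lemma power_iteration (xi0 : T -> R) : H xi0 -> 0 < Bq xi0 xi0 ->
  exists (rho : R) v, [/\ 0 < rho, eigenvector v rho, 0 < dot v v &
    forall eta mu, eigenvector eta mu -> dot xi0 eta = 0 -> dot v eta = 0].
Proof.
move=> H0 B0; have LY := chaos_L2 HH Ych.
(* [A] is the operator of the form, given by [Bq_riesz] on [H] and arbitrary outside. *)
have /choice[A hA] : forall xi, exists zeta, H xi -> H zeta /\
    forall eta, H eta -> dot zeta eta = Bq xi eta.
  move=> xi; have [Hx|nHx] := pselect (H xi); last by exists xi.
  by have [zeta hz] := Bq_riesz HH Ych Hx; exists zeta.
pose a n := iter n A xi0.
have Ha n : H (a n) by elim: n => // n IH; have [] := hA _ IH.
have La n := H_L2 HH (Ha n).
have aS n eta : H eta -> dot (a n.+1) eta = Bq (a n) eta.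
  by move=> He; have [_] := hA _ (Ha n); exact.
pose m k := dot (a k) (a 0%N).
have am i j : dot (a i) (a j) = m (i + j)%N.
  elim: j i => [|j IH] i; first by rewrite addn0.
  by rewrite addnS -addSn -IH dotC aS// BqC -aS.
have Bm i j : Bq (a i) (a j) = m (i + j).+1 by rewrite -aS// am.
have m1 : 0 < m 1%N by rewrite -(Bm 0%N 0%N).
have m_ge0 k : 0 <= m k.*2 by rewrite -addnn -am dot_ge0.
(* For odd [k] this is Cauchy-Schwarz for the form, for even [k] Cauchy-Schwarz for [dot]. *)
have m_convex k : m k.+1 ^+ 2 <= m k * m k.+2.
  have [ko|ke] := boolP (odd k).
    have -> : k = (k./2 + k./2).+1 by rewrite -{1}(odd_double_half k) ko add1n addnn.
    have := Bq_cauchy_schwarz (Ha k./2) (Ha k./2.+1).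
    by rewrite !Bm !addnS !addSn.
  have -> : k = (k./2 + k./2)%N by rewrite -{1}(odd_double_half k) (negbTE ke) addnn.
  have := cauchy_schwarz (La k./2) (La k./2.+1).
  by rewrite !am !addnS !addSn.
have m0 : 0 < m 0%N.
  rewrite lt_neqAle (m_ge0 0%N) andbT eq_sym; apply/eqP => m00.
  by have := m_convex 0%N; rewrite m00 mul0r leNgt exprn_gt0.
have m_gt0 k : 0 < m k.
  suff : 0 < m k /\ 0 < m k.+1 by case.
  elim: k => // k [mk mk1]; split => //.
  rewrite -(@pmulr_rgt0 _ (m k))//; apply: lt_le_trans (m_convex k).
  by rewrite exprn_gt0.
have m_bound k : m k.*2.+1 <= Num.sqrt (dot Y Y) * m k.*2.
  rewrite -addnn -Bm -am -(@ler_pXn2r _ 2)// ?nnegrE ?Bpos//; last first.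
    by rewrite mulr_ge0 ?sqrtr_ge0 ?dot_ge0.
  by rewrite [leRHS]exprMn sqr_sqrtr ?dot_ge0// [X in _ * X]expr2 (Bq_bound HH Ych).
have [rho [rho0 mu_dec mu_rat]] := log_convex_limit_ratio m_gt0 m_convex m_bound.
have r_homo := log_convex_ratio_homo m_gt0 m_convex.
pose mu k := m k / rho ^+ k.
have rhoN k : rho ^+ k != 0 by rewrite gt_eqF// exprn_gt0.
have mu_gt0 k : 0 < mu k by rewrite divr_gt0// exprn_gt0.
have mu_homo : {homo mu : i j / (i <= j)%N >-> j <= i}.
  by apply/nonincreasing_seqP => k; exact: mu_dec.
have mu_cvg : cvgn mu.
  by apply: nonincreasing_is_cvgn => //; exists 0 => _ [k _ <-]; exact: ltW.
pose L := limn mu.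
have L0 : 0 <= L by apply: limr_ge => //; apply: nearW => k; exact: ltW.
pose u n x := (rho ^+ n)^-1 * a n x.
have Hu n : H (u n) by exact: (H_scale HH).
have Lu n := H_L2 HH (Hu n).
have um i j : dot (u i) (u j) = mu (i + j)%N.
  rewrite /u dotZl//; last exact: Lu.
  by rewrite dotZr// am /mu exprD; field; rewrite !rhoN.
have Bu n eta : H eta -> Bq (u n) eta = rho * dot (u n.+1) eta.
  move=> He; rewrite /u (BqZl HH Ych)// dotZl//; last exact: (H_L2 HH).
  by rewrite aS// exprS; field; rewrite rhoN gt_eqF.
(* As [dot (u i) (u j)] depends on [i + j] only, the squared distance is
   [mu (2i) - 2 mu (i + j) + mu (2j)], which is small because [mu] converges. *)
have [v [Hv cv]] : exists f, H f /\ (fun n => dist2 (u n) f) @ \oo --> 0.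
  apply: (H_complete HH Hu) => e e0.
  have e4 : 0 < e / 4 by rewrite divr_gt0.
  move/cvgrPdist_le : (mu_cvg) => /(_ _ e4)[N _ hN]; exists N => i j Ni Nj.
  rewrite dotB_sqr// !um.
  have h k : (N <= k)%N -> `|L - mu k| <= e / 4 by move=> Nk; exact: hN.
  have := h (i + i)%N (leq_trans Ni (leq_addr _ _)).
  have := h (i + j)%N (leq_trans Ni (leq_addr _ _)).
  have := h (j + j)%N (leq_trans Nj (leq_addr _ _)).
  rewrite !ler_distlC => /andP[_ h1] /andP[h2 _] /andP[_ h3]; lra.
have Lv := H_L2 HH Hv.
have vu k : dot v (u k) = L.
  have := dot_cvgl Lu Lv (Lu k) cv => c.
  apply: (@cvg_unique _ (@Rhausdorff R) _ _ _ _ c).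
  have := mu_cvg; rewrite -(@cvg_shiftn k).
  by apply: cvg_trans; apply: near_eq_cvg; apply: nearW => n; rewrite um.
have vv : dot v v = L.
  have := dot_cvgl Lu Lv Lv cv => c.
  apply: (@cvg_unique _ (@Rhausdorff R) _ _ _ _ c).
  apply: (@cvg_trans _ ((fun=> L) @ \oo)); last exact: cvg_cst.
  by apply: near_eq_cvg; apply: nearW => n; rewrite dotC vu.
exists rho, v; split => //.
- split => // eta He; have Le := H_L2 HH He.
  have c1 := Bq_cvgl HH Ych Hu Hv He cv.
  apply: (@cvg_unique _ (@Rhausdorff R) _ _ _ _ c1).
  have c2 := dot_cvgl Lu Lv Le cv.
  rewrite -cvg_shiftS in c2.
  have : (fun n => rho * dot (u n.+1) eta) @ \oo --> rho * dot v eta.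
    by apply: cvgM => //; exact: cvg_cst.
  by apply: cvg_trans; apply: near_eq_cvg; apply: nearW => n; rewrite Bu.
(* If [L = 0], then [mu] tends to 0 with ratios tending to 1, and [almost_orthogonal_family] yields
   [k] normalised iterates with form at least [bet], the first and smallest ratio. The choice of
   [k > |Y|^2 / bet^2] contradicts the Bessel bound. *)
- rewrite vv lt_neqAle L0 andbT eq_sym; apply/eqP => L00.
  pose bet := m 1%N / m 0%N.
  have bet0 : 0 < bet by rewrite divr_gt0.
  pose k := (Num.truncn (dot Y Y / bet ^+ 2)).+1.
  have k0 : 0 < k%:R^-1 :> R by rewrite invr_gt0.
  have mu0 : mu @ \oo --> 0 by rewrite -L00; exact: mu_cvg.
  have mur : (fun k => mu k.+1 / mu k) @ \oo --> (1 : R).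
    move: mu_rat; apply: cvg_trans; apply: near_eq_cvg; apply: nearW => i.
    by rewrite /mu exprS; field; rewrite rhoN !gt_eqF.
  have mucs i j : mu (i + j)%N ^+ 2 <= mu i.*2 * mu j.*2.
    by rewrite -!addnn -!um; exact: cauchy_schwarz.
  have [f hf] := almost_orthogonal_family mu_gt0 mu0 mur mucs k k0.
  pose e i x := (Num.sqrt (mu (f i).*2))^-1 * u (f i) x.
  have s0 i : Num.sqrt (mu (f i).*2) != 0 by rewrite gt_eqF// sqrtr_gt0.
  have s2 i : Num.sqrt (mu (f i).*2) ^+ 2 = mu (f i).*2 by rewrite sqr_sqrtr// ltW.
  have He i : H (e i) by exact: (H_scale HH).
  have ee i j : dot (e i) (e j) = mu (f i + f j)%N / (Num.sqrt (mu (f i).*2) * Num.sqrt (mu (f j).*2)).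
    rewrite /e dotZl//; last exact: (H_L2 HH (He j)).
    by rewrite dotZr// um; field; rewrite !s0.
  have := @bessel_almost_orthogonal k e bet (ltW bet0).
  have h1 i : (i < k)%N -> H (e i) by [].
  have h2 i : (i < k)%N -> dot (e i) (e i) = 1.
    by move=> _; rewrite ee addnn -expr2 s2 divff// gt_eqF.
  have h3 i j : (i < k)%N -> (j < k)%N -> i != j -> dot (e i) (e j) ^+ 2 <= k%:R^-1.
    move=> ik jk ij; rewrite ee expr_div_n [X in _ / X]exprMn !s2.
    rewrite (ler_pdivrMr _ _ (mulr_gt0 (mu_gt0 (f i).*2) (mu_gt0 (f j).*2))).
    exact: hf.
  have h4 i : (i < k)%N -> bet <= Bq (e i) (e i).
    move=> _.
    have -> : Bq (e i) (e i) = (mu (f i).*2)^-1 * (rho * mu (f i).*2.+1).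
      rewrite (BqZl HH Ych _ (Hu (f i)) (He i)) BqC (BqZl HH Ych _ (Hu (f i)) (Hu (f i))).
      by rewrite Bu// um mulrA -invfM -expr2 s2 addSn addnn.
    apply: le_trans (r_homo 0%N (f i).*2 _) _ => //.
    rewrite le_eqVlt; apply/orP; left; apply/eqP.
    by rewrite /mu exprS; field; rewrite rhoN !gt_eqF.
  move=> /(_ h1 h2 h3 h4); rewrite leNgt => /negP; apply.
  by rewrite -ltr_pdivrMr ?exprn_gt0// truncnS_gt.
(* Orthogonality to an eigenvector passes from [a n] to [a n.+1] by symmetry of the form, and then
   to the limit. *)
- move=> eta nu [He Ee] x0; have Le := H_L2 HH He.
  have ae n : dot (a n) eta = 0.
    elim: n => // n IH; rewrite aS// BqC Ee// dotC IH mulr0 //.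
  have c := dot_cvgl Lu Lv Le cv.
  apply: (@cvg_unique _ (@Rhausdorff R) _ _ _ _ c).
  apply: (@cvg_trans _ ((fun=> 0 : R) @ \oo)); last exact: cvg_cst.
  by apply: near_eq_cvg; apply: nearW => n; rewrite /u dotZl// ae mulr0.
Qed.

End power_iteration.

(** * Eigenbasis and expansion of Y *)

Section spectral.
Context {d : measure_display} {T : measurableType d} {R : realType}
  (P : probability T R) (H : set (T -> R)) (Y : T -> R).
Hypothesis HH : gaussian_hilbert_space P H.
Hypothesis Ych : wick_chaos2 P H Y.
Hypothesis Ymean : \int[P]_x Y x = 0.
Local Notation dot := (L2dot P).
Local Notation L2 := (L2 P).
Local Notation dist2 f g := (dot (fun x => f x - g x) (fun x => f x - g x)).
Local Notation wick_sqr := (wick_square P).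
Local Notation Bq := (quad_form P Y).
Local Notation eigenvector := (eigenvector P H Y).
Hypothesis Bpos : forall xi, H xi -> 0 <= Bq xi xi.
Variables (N : option nat) (lam : nat -> R).
Hypothesis lam_enum : enumerates_nonzero_eigenvalues P H Y N lam.
Local Notation I := (index_set N).

Let LY : L2 Y := chaos_L2 HH Ych.

Lemma eigenspaceP mu xi : Defs.eigenspace P H Y mu xi <-> eigenvector xi mu.
Proof.
have E x y : H x -> H y -> 'E_P[fun w => (x w * y w)%R]%E = (dot x y)%:E.
  by move=> Hx Hy; rewrite EFin_expectation//; apply: L2M; exact: (H_L2 HH).
split=> -[Hx h]; split=> // eta He.
  by have := h eta He; rewrite (BformE HH Ych Hx He) E// -EFinM => -[].
by rewrite (BformE HH Ych Hx He) E// -EFinM h.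
Qed.

Lemma orthonormalP mu m : has_orthonormal P (Defs.eigenspace P H Y mu) m <->
  exists f : nat -> T -> R, (forall i, (i < m)%N -> eigenvector (f i) mu) /\
    forall i k, (i < m)%N -> (k < m)%N -> dot (f i) (f k) = (i == k)%:R.
Proof.
have E x y : H x -> H y -> 'E_P[fun w => (x w * y w)%R]%E = (dot x y)%:E.
  by move=> Hx Hy; rewrite EFin_expectation//; apply: L2M; exact: (H_L2 HH).
split=> -[f [fe fo]]; exists f.
  have fe' i : (i < m)%N -> eigenvector (f i) mu by move=> im; apply/eigenspaceP; exact: fe.
  split => // i k im km; have := fo i k im km.
  by rewrite E; [move=> -[]|have [] := fe' i im|have [] := fe' k km].
split=> [i im|i k im km]; first by apply/eigenspaceP; exact: fe.
by rewrite E ?fo//; [have [] := fe i im|have [] := fe k km].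
Qed.

Lemma eigenvalue_gt0 mu v : mu != 0 -> eigenvector v mu -> dot v v = 1 -> 0 < mu.
Proof.
move=> mu0 [Hv Ev] v1; rewrite lt_neqAle eq_sym mu0/=.
by have := Bpos Hv; rewrite Ev// v1 mulr1.
Qed.

Lemma lam_gt0 j : I j -> 0 < lam j.
Proof.
move=> Ij; case: lam_enum => lam0 enum.
have /orthonormalP[f [fe fo]] : has_orthonormal P (Defs.eigenspace P H Y (lam j)) 1.
  apply/(enum _ (lam0 _ Ij)); exists [:: j]; split => // i.
  by rewrite inE => /eqP ->.
by apply: (@eigenvalue_gt0 _ (f 0%N) (lam0 _ Ij) (fe 0%N erefl)); rewrite fo.
Qed.

(** Orthonormal eigenvectors for [mu] satisfy the Bessel bound with [bet = mu], so there are at most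
    [|Y|^2 / mu^2] of them. *)
Lemma multiplicity_max mu : mu != 0 -> exists m,
  has_orthonormal P (Defs.eigenspace P H Y mu) m /\
  forall m', has_orthonormal P (Defs.eigenspace P H Y mu) m' -> (m' <= m)%N.
Proof.
move=> mu0; pose Q m := `[< has_orthonormal P (Defs.eigenspace P H Y mu) m >].
have ex : exists m, Q m by exists 0%N; apply/asboolP; exists (fun=> fun=> 0); split.
have bnd m : Q m -> (m <= Num.truncn (dot Y Y / mu ^+ 2))%N.
  move=> /asboolP/orthonormalP[f [fe fo]].
  have [->//|m0] := posnP m.
  have mup : 0 < mu.
    by apply: (@eigenvalue_gt0 _ (f 0%N) mu0 (fe 0%N m0)); rewrite fo.
  have := @bessel_almost_orthogonal _ _ _ P H Y HH Ych Ymean m f mu (ltW mup).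
  have h1 i : (i < m)%N -> H (f i) by move=> im; have [] := fe i im.
  have h2 i : (i < m)%N -> dot (f i) (f i) = 1 by move=> im; rewrite fo// eqxx.
  have h3 i j : (i < m)%N -> (j < m)%N -> i != j -> dot (f i) (f j) ^+ 2 <= m%:R^-1.
    by move=> im jm ij; rewrite fo// (negbTE ij) expr0n/= invr_ge0.
  have h4 i : (i < m)%N -> mu <= Bq (f i) (f i).
    by move=> im; have [Hf Ef] := fe i im; rewrite Ef// h2// mulr1.
  move=> /(_ h1 h2 h3 h4) h.
  by rewrite truncn_ge_nat ?divr_ge0 ?dot_ge0 ?sqr_ge0// ler_pdivlMr// exprn_gt0.
case: (ex_maxnP ex bnd) => m /asboolP Qm max; exists m; split => // m' Qm'.
by apply: max; exact/asboolP.
Qed.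

(** Distributes the basis of each eigenspace: the index [j] receives basis vector number [rk j] of
    its own eigenvalue, so repeated eigenvalues get different vectors. *)
Let rk j := count (fun i => I i && (lam i == lam j)) (iota 0 j).

(** The enumeration only counts dimensions, so eigenvectors have to be chosen: a maximal orthonormal
    family per eigenvalue, distributed by [rk]. The last clause is completeness: a further
    eigenvector orthogonal to all [e j] would give an orthonormal family larger than the maximal
    one. *)
Lemma eigenbasis : exists e : nat -> T -> R,
  [/\ forall j, I j -> eigenvector (e j) (lam j),
      forall i j, I i -> I j -> dot (e i) (e j) = (i == j)%:R &
      forall v rho, 0 < rho -> eigenvector v rho ->
        (forall j, I j -> dot v (e j) = 0) -> dot v v = 0].
Proof.
case: lam_enum => lam0 enum.
have /choice[F hF] : forall mu, exists mf : nat * (nat -> T -> R), mu != 0 ->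
  [/\ (forall i, (i < mf.1)%N -> eigenvector (mf.2 i) mu),
      (forall i k, (i < mf.1)%N -> (k < mf.1)%N -> dot (mf.2 i) (mf.2 k) = (i == k)%:R) &
      (forall m', has_orthonormal P (Defs.eigenspace P H Y mu) m' -> (m' <= mf.1)%N)].
  move=> mu; have [->|mu0] := eqVneq mu 0; first by exists (0%N, fun=> fun=> 0).
  have [m [/orthonormalP[f [fe fo]] max]] := multiplicity_max mu0.
  by exists (m, f).
pose M mu := (F mu).1; pose f mu := (F mu).2.
have fe mu i : mu != 0 -> (i < M mu)%N -> eigenvector (f mu i) mu.
  by move=> /hF[h _ _]; exact: h.
have fo mu i k : mu != 0 -> (i < M mu)%N -> (k < M mu)%N -> dot (f mu i) (f mu k) = (i == k)%:R.
  by move=> /hF[_ h _]; exact: h.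
have fmax mu m' : mu != 0 -> has_orthonormal P (Defs.eigenspace P H Y mu) m' -> (m' <= M mu)%N.
  by move=> /hF[_ _ h]; exact: h.
(* The index [j] and the [rk j] earlier ones with the same eigenvalue are [rk j + 1] occurrences, so
   the eigenspace has at least that dimension. *)
have rkM j : I j -> (rk j < M (lam j))%N.
  move=> Ij; apply: fmax; first exact: lam0.
  apply/(enum _ (lam0 _ Ij)).
  exists (seq.filter (fun i => I i && (lam i == lam j)) (iota 0 j.+1)); split.
  - by rewrite filter_uniq// iota_uniq.
  - by rewrite size_filter -addn1 iotaD count_cat/= ?add0n Ij eqxx/= ?addn0 addn1.
  - by move=> i; rewrite mem_filter => /andP[/andP[Ii /eqP]].
have rk_lt i j : I i -> (i < j)%N -> lam i = lam j -> (rk i < rk j)%N.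
  move=> Ii ij lij; rewrite /rk lij.
  have -> : iota 0 j = iota 0 i ++ i :: iota i.+1 (j - i.+1).
    by rewrite -[in LHS](subnKC ij) addSnnS iotaD.
  by rewrite count_cat/= Ii lij eqxx/= addnA addn1 ltnS leq_addr.
pose e j := f (lam j) (rk j).
have ee j : I j -> eigenvector (e j) (lam j).
  by move=> Ij; apply: fe; [exact: lam0|exact: rkM].
have eo i j : I i -> I j -> dot (e i) (e j) = (i == j)%:R.
  move=> Ii Ij; have [lij|lij] := eqVneq (lam i) (lam j); last first.
    have [Hi Ei] := ee i Ii; have [Hj Ej] := ee j Ij.
    have -> : (i == j) = false by apply/eqP => ij; rewrite ij eqxx in lij.
    have h : (lam i - lam j) * dot (e i) (e j) = 0.
      by rewrite mulrBl -Ei// BqC Ej// (dotC _ (e j)) subrr.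
    by move/eqP: h; rewrite mulf_eq0 subr_eq0 (negbTE lij)/= => /eqP.
  rewrite /e lij fo//; last 3 first.
  - exact: lam0.
  - by rewrite -lij; exact: rkM.
  - exact: rkM.
  congr (nat_of_bool _)%:R; have [->|ij] := eqVneq i j; first by rewrite eqxx.
  apply/negbTE; rewrite neq_ltn; move: ij; rewrite neq_ltn => /orP[ij|ij].
    by rewrite rk_lt.
  by rewrite (rk_lt j i)// orbT.
exists e; split => // v rho rho0 [Hv Ev] ve.
apply/eqP; apply: contraT => vv0.
have vv : 0 < dot v v by rewrite lt_neqAle eq_sym vv0 dot_ge0.
have rhoN : rho != 0 by rewrite gt_eqF.
have [m [hm max]] := multiplicity_max rhoN.
have [s [su ss sI]] := (enum _ rhoN m).2 hm.
pose c := (Num.sqrt (dot v v))^-1.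
have c2 : c ^+ 2 * dot v v = 1.
  by rewrite /c exprVn sqr_sqrtr ?dot_ge0// mulVf.
(* The [m] listed eigenvectors for [rho], followed by the normalised [v] in position [m]. *)
pose g i := if (i < m)%N then e (nth 0%N s i) else (fun x => c * v x).
have gI i : (i < m)%N -> I (nth 0%N s i) /\ lam (nth 0%N s i) = rho.
  by move=> im; apply: sI; rewrite mem_nth// ss.
have Lv := H_L2 HH Hv.
have Le j : I j -> L2 (e j) by move=> /ee[/(H_L2 HH)].
suff : (m.+1 <= m)%N by rewrite ltnn.
apply: max; apply/orthonormalP; exists g; split.
  move=> i; rewrite ltnS leq_eqVlt /g => /predU1P[->|im].
    rewrite ltnn; split; first exact: (H_scale HH).
    move=> eta He; rewrite (BqZl HH Ych _ Hv He) Ev// dotZl//; last exact: (H_L2 HH).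
    ring.
  by rewrite im; have [Ii <-] := gI i im; exact: ee.
move=> i k; rewrite !ltnS leq_eqVlt /g => /predU1P[->|im]; rewrite leq_eqVlt => /predU1P[->|km].
- by rewrite ltnn eqxx dotZl ?dotZr//; [rewrite mulrA -expr2 c2|exact: L2Z].
- have [Ik _] := gI k km.
  by rewrite ltnn km (gtn_eqF km) dotZl// ?ve ?mulr0//; exact: Le.
- have [Ii _] := gI i im.
  by rewrite ltnn im (ltn_eqF im) dotC dotZl// ?ve ?mulr0//; exact: Le.
- have [Ii _] := gI i im; have [Ik _] := gI k km.
  by rewrite im km eo// nth_uniq// ss.
Qed.

Section expansion.
Variable e : nat -> T -> R.
Hypothesis ee : forall j, I j -> eigenvector (e j) (lam j).
Hypothesis eo : forall i j, I i -> I j -> dot (e i) (e j) = (i == j)%:R.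
Hypothesis ecomplete : forall v rho, 0 < rho -> eigenvector v rho ->
  (forall j, I j -> dot v (e j) = 0) -> dot v v = 0.

Let He j : I j -> H (e j). Proof. by move=> /ee[]. Qed.
Let Le j : I j -> L2 (e j). Proof. by move=> /He; exact: (H_L2 HH). Qed.

(** If [Bq xi xi] were positive, power iteration from [xi] would produce a non-zero eigenvector
    still orthogonal to all [e j], against completeness. Cauchy-Schwarz for the form then extends
    [Bq xi xi = 0] to every [eta]. *)
Lemma Bq_orthogonal0 xi eta : H xi -> (forall j, I j -> dot xi (e j) = 0) -> H eta ->
  Bq xi eta = 0.
Proof.
move=> Hx xe Hn.
have B0 : Bq xi xi = 0.
  apply/eqP; apply: contraT => B0.
  have Bp : 0 < Bq xi xi by rewrite lt_neqAle eq_sym B0 Bpos.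
  have [rho [v [rho0 Ev vv ve]]] := power_iteration HH Ych Ymean Bpos Hx Bp.
  suff vv0 : dot v v = 0 by rewrite vv0 ltxx in vv.
  apply: (ecomplete rho0 Ev) => j Ij; exact: (ve _ _ (ee Ij) (xe j Ij)).
have := Bq_cauchy_schwarz HH Ych Bpos Hx Hn; rewrite B0 mul0r => h.
by apply/eqP; rewrite -sqrf_eq0 eq_le h sqr_ge0.
Qed.

Let pr n (xi : T -> R) x := \sum_(j < n | I j) dot xi (e j) * e j x.
Let res n (xi : T -> R) x := xi x - pr n xi x.

Let H_pr n xi : H xi -> H (pr n xi).
Proof. by move=> Hx; apply: (H_sum HH) => j Ij; apply: (H_scale HH); exact: He. Qed.

Let H_res n xi : H xi -> H (res n xi).
Proof. by move=> Hx; apply: (H_sub HH) => //; exact: H_pr. Qed.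

Let dot_pr n xi eta : H xi -> H eta ->
  dot (pr n xi) eta = \sum_(j < n | I j) dot xi (e j) * dot (e j) eta.
Proof.
move=> Hx Hn; have Ln := H_L2 HH Hn.
rewrite /pr dot_suml//; last by move=> j Ij; apply: L2Z; exact: Le.
by apply: eq_bigr => j Ij; rewrite dotZl//; exact: Le.
Qed.

Let dot_e_sum n k (a : nat -> R) : I k ->
  \sum_(j < n | I j) a j * dot (e j) (e k) = if (k < n)%N then a k else 0.
Proof.
move=> Ik; case: ltnP => [kn|nk].
  rewrite (bigD1 (Ordinal kn))//= eo// eqxx mulr1 big1 ?addr0// => j /andP[Ij jk].
  by rewrite eo// (_ : (j == k :> nat) = false) ?mulr0//; apply/negbTE.
rewrite big1// => j Ij; rewrite eo// (_ : (j == k :> nat) = false) ?mulr0//.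
by rewrite ltn_eqF// (leq_trans (ltn_ord j)).
Qed.

Let dot_res_e n xi k : H xi -> I k -> (k < n)%N -> dot (res n xi) (e k) = 0.
Proof.
move=> Hx Ik kn; rewrite /res dotBl; [|exact: (H_L2 HH)|exact: (H_L2 HH (H_pr n Hx))|exact: Le].
by rewrite dot_pr//; [rewrite (dot_e_sum n (fun j => dot xi (e j)))// kn subrr|exact: He].
Qed.

Let b xi n := \sum_(j < n | I j) dot xi (e j) ^+ 2.

Let dot_res n m xi : H xi -> (m <= n)%N -> dot (res n xi) (res m xi) = dot xi xi - b xi n.
Proof.
move=> Hx mn; have Lx := H_L2 HH Hx; have Lr := H_L2 HH (H_res n Hx).
have -> : dot (res n xi) (res m xi) = dot (res n xi) xi - dot (res n xi) (pr m xi).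
  by rewrite {2}/res dotBr//; exact: (H_L2 HH (H_pr m Hx)).
have -> : dot (res n xi) (pr m xi) = 0.
  rewrite dotC dot_pr//; last exact: H_res.
  rewrite big1// => j Ij; rewrite (dotC _ (e j)) dot_res_e ?mulr0//.
  by rewrite (leq_trans (ltn_ord j)).
rewrite subr0 /res dotBl//; last exact: (H_L2 HH (H_pr n Hx)).
by rewrite dot_pr//; congr (_ - _); apply: eq_bigr => j Ij; rewrite (dotC _ (e j)) expr2.
Qed.

Let b_cvg xi : H xi -> cvgn (b xi).
Proof.
move=> Hx; apply: nondecreasing_is_cvgn.
  apply/nondecreasing_seqP => n; rewrite /b [leRHS]big_mkcond big_ord_recr/= -big_mkcond/=.
  by rewrite lerDl; case: ifP => // _; exact: sqr_ge0.
exists (dot xi xi) => _ [n _ <-].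
by rewrite -subr_ge0 -(@dot_res n n)// dot_ge0.
Qed.

Let res_cvg xi : H xi -> exists f, H f /\ (fun n => dist2 (res n xi) f) @ \oo --> 0.
Proof.
move=> Hx; apply: (H_complete HH (fun n => H_res n Hx)) => eps eps0.
have e4 : 0 < eps / 2 by rewrite divr_gt0.
move/cvgrPdist_le : (b_cvg Hx) => /(_ _ e4)[K _ hK]; exists K.
have key m n : (K <= m)%N -> (m <= n)%N -> dist2 (res m xi) (res n xi) <= eps.
  move=> Km mn; have Kn := leq_trans Km mn.
  rewrite dotB_sqr; try exact: (H_L2 HH (H_res _ Hx)).
  rewrite (dotC _ (res m xi) (res n xi)) !dot_res//.
  have := hK m Km; have := hK n Kn; rewrite /= !ler_distlC => /andP[_ h1] /andP[h2 _].
  lra.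
move=> m n Km Kn; have [mn|/ltnW nm] := leqP m n; first exact: key.
by rewrite dist2C; exact: key.
Qed.

(** The residuals converge by Bessel's inequality. Their limit may be non-zero, but it is orthogonal
    to every [e j], so the form vanishes on it. *)
Lemma Bq_res_cvg0 xi eta : H xi -> H eta -> (fun n => Bq (res n xi) eta) @ \oo --> 0.
Proof.
move=> Hx Hn; have [f [Hf cf]] := res_cvg Hx.
have <- : Bq f eta = 0.
  apply: Bq_orthogonal0 => // j Ij.
  have c := dot_cvgl (fun n => H_L2 HH (H_res n Hx)) (H_L2 HH Hf) (Le Ij) cf.
  apply: (@cvg_unique _ (@Rhausdorff R) _ _ _ _ c).
  apply: (@cvg_trans _ ((fun=> 0 : R) @ \oo)); last exact: cvg_cst.
  apply: near_eq_cvg; exists j.+1 => // n /= jn.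
  by rewrite dot_res_e.
exact: (Bq_cvgl HH Ych (fun n => H_res n Hx) Hf Hn cf).
Qed.

Let S n x := \sum_(j < n | I j) lam j * wick_sqr (e j) x.
Let Lw j : I j -> L2 (wick_sqr (e j)). Proof. by move=> /He/(wick_sqr_L2 HH). Qed.
Let LS n : L2 (S n).
Proof. by apply: L2_sum => j Ij; apply: L2Z; exact: Lw. Qed.
Let D n x := Y x - S n x.
Let LD n : L2 (D n). Proof. by apply: L2B. Qed.

(** The remainder [D n] represents twice the form with its eigendirections of index below [n]
    removed. *)
Let dot_D_mul n xi eta : H xi -> H eta ->
  dot (D n) (fun x => xi x * eta x) = Bq (res n xi) eta *+ 2.
Proof.
move=> Hx Hn; have Lxn := H_mul_L2 HH Hx Hn.
rewrite /D dotBl// /S dot_suml//; last by move=> j Ij; apply: L2Z; exact: Lw.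
have -> : Bq (res n xi) eta = Bq xi eta - \sum_(j < n | I j) lam j * (dot xi (e j) * dot (e j) eta).
  have := Bq_linl HH Ych 1 (-1) Hx (H_pr n Hx) Hn.
  have -> : (fun x => 1 * xi x + -1 * pr n xi x) = res n xi.
    by apply/funext => x; rewrite /res mul1r mulN1r.
  move=> ->; rewrite mul1r mulN1r; congr (_ - _).
  rewrite /quad_form /pr.
  have -> : (fun x => (\sum_(j < n | I j) dot xi (e j) * e j x) * eta x) =
     (fun x => \sum_(j < n | I j) dot xi (e j) * (e j x * eta x)).
    by apply/funext => x; rewrite big_distrl/=; apply: eq_bigr => j _; rewrite mulrA.
  have Len j : I j -> L2 (fun x => e j x * eta x) by move=> Ij; exact: (H_mul_L2 HH (He Ij) Hn).
  rewrite dot_sumr//; last by move=> j Ij; apply: L2Z; exact: Len.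
  rewrite mulr_sumr; apply: eq_bigr => j Ij; rewrite dotZr//; last exact: Len.
  have [_ Ej] := ee Ij; have := Ej eta Hn; rewrite /quad_form => h.
  by rewrite mulrCA h; ring.
rewrite mulrnBl /quad_form -mulrnAl -[_ *+ 2]mulr_natr mulVf// mul1r; congr (_ - _).
rewrite -sumrMnl; apply: eq_bigr => j Ij.
rewrite dotZl//; last exact: Lw.
by rewrite (wick_sqr_dot_mul HH (He Ij) Hx Hn) (dotC _ (e j) xi); ring.
Qed.

Let D_mean n : \int[P]_x D n x = 0.
Proof.
rewrite /D RintegralB//; [|exact: L2_Int|exact: L2_Int (LS n)].
rewrite Ymean sub0r /S Rint_sum; last by move=> j Ij; apply: IntZ; exact: L2_Int (Lw Ij).
rewrite big1 ?oppr0// => j Ij.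
by rewrite RintZ; [rewrite (wick_sqr_mean HH (He Ij)) mulr0|exact: L2_Int (Lw Ij)].
Qed.

Let dot_D_wick n z : H z -> dot (D n) (wick_sqr z) = Bq (res n z) z *+ 2.
Proof.
move=> Hz; rewrite -dot_D_mul// /wick_square dotBr//; [|exact: (H_sqr_L2 HH)|exact: L2_cst].
have -> : dot (D n) (fun=> dot z z) = dot z z * \int[P]_x D n x.
  rewrite -RintZ; last exact: L2_Int.
  by apply: eq_Rintegral => x _; rewrite mulrC.
by rewrite D_mean mulr0 subr0.
Qed.

Let dot_D_S n : dot (D n) (S n) = 0.
Proof.
rewrite {1}/S dot_sumr//; last by move=> j Ij; apply: L2Z; exact: Lw.
rewrite big1// => j Ij; rewrite dotZr//; last exact: Lw.
rewrite dot_D_wick; last exact: He.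
have [Hj Ej] := ee Ij; rewrite BqC Ej; last exact: H_res.
by rewrite dotC dot_res_e ?mulr0 ?mul0rn ?mulr0.
Qed.

Let dot_DD n : dot (D n) (D n) = dot (D n) Y.
Proof. by rewrite {2}/D dotBr// dot_D_S subr0. Qed.

(** Weak convergence becomes strong because [D n] is orthogonal to [S n], so [|D n|^2 = <D n, Y>].
    Replacing [Y] by a finite sum [Z k] of Wick squares costs a uniformly small error, as
    [|D n| <= |Y|], and each square is handled by [Bq_res_cvg0]. *)
Lemma chaos_expansion : (fun n => dist2 Y (S n)) @ \oo --> 0.
Proof.
apply/cvgrPdist_le => eps eps0.
have Y0 := dot_ge0 P Y.
have D_le n : dot (D n) (D n) <= dot Y Y.
  have := cauchy_schwarz (LD n) LY; rewrite -dot_DD expr2 => h.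
  have [->//|D0] := eqVneq (dot (D n) (D n)) 0.
  by rewrite ler_pM2l// lt_neqAle eq_sym D0 dot_ge0 in h.
have [Z hZ] := chaos_approx_seq HH Ych.
(* Chosen so that [|Y|^2 / (k + 1) <= (eps / 2)^2], which bounds [<D n, Y - Z k>^2]. *)
pose k := Num.truncn (4 * dot Y Y ^+ 1 / eps ^+ 2).
have [[n0 [c [z [Hz Zk]]]] dZ] := hZ k.
have LZ : L2 (Z k) by rewrite Zk; exact: (sum_wick_sqr_L2 HH).
have LYZ := L2B LY LZ.
have small n : `|dot (D n) (fun x => Y x - Z k x)| <= eps / 2.
  rewrite -(@ler_pXn2r _ 2)// ?nnegrE ?divr_ge0 ?(ltW eps0)//.
  rewrite real_normK ?num_real//; apply: le_trans (cauchy_schwarz (LD n) LYZ) _.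
  apply: (@le_trans _ _ (dot Y Y * k.+1%:R^-1)); first by rewrite ler_pM ?dot_ge0.
  rewrite ler_pdivrMr ?ltr0n//.
  have h : 4 * dot Y Y ^+ 1 / eps ^+ 2 <= k.+1%:R by rewrite ltW// truncnS_gt.
  rewrite ler_pdivrMr ?exprn_gt0// in h.
  have -> : (eps / 2) ^+ 2 * k.+1%:R = (k.+1%:R * eps ^+ 2) / 4 by field.
  by rewrite ler_pdivlMr// mulrC -[dot Y Y]expr1.
have cZ : (fun n => dot (D n) (Z k)) @ \oo --> 0.
  have -> : (fun n => dot (D n) (Z k)) =
      (fun n => \sum_(i < n0) c i * (Bq (res n (z i)) (z i) *+ 2)).
    apply/funext => n; rewrite Zk dot_sumr//; last first.
      by move=> i _; apply: L2Z; exact: (wick_sqr_L2 HH (Hz i)).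
    apply: eq_bigr => i _; rewrite dotZr//; last exact: (wick_sqr_L2 HH (Hz i)).
    by rewrite dot_D_wick.
  elim: n0 {Zk} => [|q IH].
    apply: (@cvg_trans _ ((fun=> 0 : R) @ \oo)); last exact: cvg_cst.
    by apply: near_eq_cvg; apply: nearW => n; rewrite big_ord0.
  have cq : (fun n => Bq (res n (z q)) (z q)) @ \oo --> 0 by exact: Bq_res_cvg0.
  have : (fun n => \sum_(i < q) c i * (Bq (res n (z i)) (z i) *+ 2) +
      c q * (Bq (res n (z q)) (z q) + Bq (res n (z q)) (z q))) @ \oo -->
      0 + c q * (0 + 0).
    by apply: cvgD => //; apply: cvgM; [exact: cvg_cst|exact: cvgD].
  rewrite addr0 mulr0 addr0; apply: cvg_trans; apply: near_eq_cvg; apply: nearW => n.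
  by rewrite big_ord_recr/= mulr2n.
have e2 : 0 < eps / 2 by rewrite divr_gt0.
move/cvgrPdist_le : cZ => /(_ _ e2); apply: filterS => n; rewrite !sub0r !normrN => h.
rewrite -/(D n) dot_DD.
have -> : dot (D n) Y = dot (D n) (fun x => Y x - Z k x) + dot (D n) (Z k).
  by rewrite dotBr// subrK.
apply: le_trans (ler_normD _ _) _.
have := small n; lra.
Qed.

End expansion.

End spectral.

(** * Exponentials of sums of squares *)

Section fubini_bounded.
Context {R : realType} {d1 d2 : measure_display} {T1 : measurableType d1}
  {T2 : measurableType d2} (P1 : probability T1 R) (P2 : probability T2 R).

Lemma Rint_Fubini (f : T1 -> T2 -> R) (M : R) :
  measurable_fun setT (fun z : T1 * T2 => f z.1 z.2) ->
  (forall x y, `|f x y| <= M) ->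
  \int[P1]_x \int[P2]_y f x y = \int[P2]_y \int[P1]_x f x y.
Proof.
move=> mf fM.
pose F (z : T1 * T2) := (f z.1 z.2)%:E.
have mF : measurable_fun setT F by exact/measurable_EFinP.
have m1 x : measurable_fun setT (f x).
  exact: (measurableT_comp mf (measurable_pair1 x)).
have m2 y : measurable_fun setT (f ^~ y).
  exact: (measurableT_comp mf (measurable_pair2 y)).
have i1 x : P2.-integrable setT (EFin \o f x) by exact: Int_bounded.
have i2 y : P1.-integrable setT (EFin \o f ^~ y) by exact: (@Int_bounded _ _ _ _ _ M).
have iF : (P1 \x P2)%E.-integrable setT F.
  apply: (iffRL (integrable12ltyP P1 P2 mF)).
  apply: (@le_lt_trans _ _ (\int[P1]_x M%:E)%E); last first.
    by rewrite -(EFin_Rint (Int_cst P1 M)) Rint_cst ltry.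
  apply: ge0_le_integral => //.
  - by move=> x _; apply: integral_ge0.
  - apply: (measurable_fun_fubini_tonelli_F (m2 := P2) (abse \o F)).
      exact: measurableT_comp.
    by move=> z; exact: abse_ge0.
  - move=> x _; apply: (@le_trans _ _ (\int[P2]_y M%:E)%E); last first.
      by rewrite -(EFin_Rint (Int_cst P2 M)) Rint_cst.
    apply: ge0_le_integral => //.
    + by apply: measurableT_comp => //; apply/measurable_EFinP; exact: m1.
    + by move=> y _; rewrite /F/= lee_fin.
have := Fubini iF; rewrite /F /= /Rintegral => h.
have E1 : (\int[P1]_x \int[P2]_y (f x y)%:E = \int[P1]_x (fine (\int[P2]_y (f x y)%:E))%:E)%E.
  by apply: eq_integral => x _; rewrite fineK//; exact: (integrable_fin_num measurableT (i1 x)).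
have E2 : (\int[P2]_y \int[P1]_x (f x y)%:E = \int[P2]_y (fine (\int[P1]_x (f x y)%:E))%:E)%E.
  by apply: eq_integral => y _; rewrite fineK//; exact: (integrable_fin_num measurableT (i2 y)).
by rewrite -E1 -E2 h.
Qed.

End fubini_bounded.

Section std_normal.
Context {R : realType}.
Local Notation gam := (@normal_prob R 0 1).

Lemma std_normal_mgf (c : R) : gauss_mgf gam (fun g => c * g) (c ^+ 2).
Proof.
split; [exact: measurable_funM|exact: sqr_ge0|move=> a].
under eq_integral do rewrite mulrA.
by rewrite normal_mgf ?oner_neq0// expr1n mulr1 exprMn.
Qed.

Lemma std_normal_cos (b y : R) : 0 <= b ->
  \int[gam]_g cos (Num.sqrt b * g * y) = expR (- (b * y ^+ 2 / 2)).
Proof.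
move=> b0; have := mgf_cos (std_normal_mgf (Num.sqrt b * y)).
rewrite exprMn sqr_sqrtr// => <-; apply: eq_Rintegral => g _; congr cos; ring.
Qed.

Lemma std_normal_expR (b y : R) : 0 <= b ->
  (\int[gam]_g (expR (Num.sqrt b * g * y))%:E = (expR (b * y ^+ 2 / 2))%:E)%E.
Proof.
move=> b0; have [_ _ /(_ 1)] := std_normal_mgf (Num.sqrt b * y).
rewrite expr1n mul1r exprMn sqr_sqrtr// => <-; apply: eq_integral => g _.
by congr (expR _)%:E; ring.
Qed.

Lemma std_normal_Rint_sqr (b : R) : -1 < b ->
  \int[gam]_g expR (- (b * g ^+ 2 / 2)) = (1 + b) `^ (- 2^-1).
Proof. by move=> b1; rewrite /Rintegral normal_sqr_mgf. Qed.

End std_normal.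

(** * Gaussian integrals with several squares *)

Section gaussian_squares.
Context {d : measure_display} {T : measurableType d} {R : realType}
  (P : probability T R) (H : set (T -> R)).
Hypothesis HH : gaussian_hilbert_space P H.
Local Notation dot := (L2dot P).
Local Notation gam := (@normal_prob R 0 1).
Variables (I : pred nat) (e : nat -> T -> R).
Hypothesis He : forall j, I j -> H (e j).
Hypothesis eo : forall i j, I i -> I j -> dot (e i) (e j) = (i == j)%:R.

Let mH xi : H xi -> measurable_fun setT xi.
Proof. by move=> /(H_L2 HH)/L2_measurable. Qed.

(** The new argument must stay in [H] and orthogonal to the remaining [e j] for the induction
    hypothesis to apply; as [e n] and [eta] are orthogonal, the variances add. *)
Let combine_orth n (c : R) eta : I n -> H eta ->
  (forall j, (j < n.+1)%N -> I j -> dot (e j) eta = 0) ->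
  forall a : R, H (fun x => c * e n x + a * eta x) /\
  (forall j, (j < n)%N -> I j -> dot (e j) (fun x => c * e n x + a * eta x) = 0) /\
  dot (fun x => c * e n x + a * eta x) (fun x => c * e n x + a * eta x) =
    c ^+ 2 + a ^+ 2 * dot eta eta.
Proof.
move=> In Heta orth a; have Hn := He In.
have Hl := H_lin HH c a Hn Heta.
have Ln := H_L2 HH Hn; have Leta := H_L2 HH Heta; have Ll := H_L2 HH Hl.
split => //; split.
  move=> j jn Ij; rewrite dot_linr//; last exact: (H_L2 HH (He Ij)).
  by rewrite eo// (ltn_eqF jn) mulr0 orth ?mulr0 ?addr0// ltnS ltnW.
rewrite dot_linl// !dot_linr// eo// eqxx (dotC _ eta (e n)) orth//=.
ring.
Qed.

Let measurable_expR_sqr (n : nat) (b : nat -> R) :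
  measurable_fun setT (fun x => \prod_(j < n | I j) expR (b j * e j x ^+ 2 / 2)).
Proof.
rewrite (_ : (fun x => _) = fun x => \prod_(j < n) if I j then expR (b j * e j x ^+ 2 / 2) else 1).
  apply: measurable_prod => j _; case: (boolP (I j)) => // Ij.
  apply: measurableT_comp => //; apply: measurable_funM => //.
  by apply: measurable_funM => //; apply: measurable_funX; apply: mH; exact: He.
by apply/funext => x; rewrite big_mkcond.
Qed.

(* Induction on n: averaging cos (sqrt (b n) g (e n) + eta) over a standard normal g
   produces the factor exp (- b n (e n)^2 / 2). *)
Lemma gauss_sqr_cos n (b : nat -> R) eta : (forall j, 0 <= b j) -> H eta ->
  (forall j, (j < n)%N -> I j -> dot (e j) eta = 0) ->
  \int[P]_x ((\prod_(j < n | I j) expR (- b j * e j x ^+ 2 / 2)) * cos (eta x)) =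
  (\prod_(j < n | I j) (1 + b j) `^ (- 2^-1)) * expR (- (dot eta eta / 2)).
Proof.
move=> b0; elim: n eta => [|n IH] eta Heta orth.
  rewrite big_ord0 mul1r -(mgf_cos (H_mgf HH Heta)).
  by apply: eq_Rintegral => x _; rewrite big_ord0 mul1r.
pose W n x := \prod_(j < n | I j) expR (- b j * e j x ^+ 2 / 2).
have WS x : W n.+1 x = W n x * (if I n then expR (- b n * e n x ^+ 2 / 2) else 1).
  by rewrite /W !(big_mkcond (fun j : 'I__ => I j)) big_ord_recr.
have wS : \prod_(j < n.+1 | I j) (1 + b j) `^ (- 2^-1) =
    (\prod_(j < n | I j) (1 + b j) `^ (- 2^-1)) * (if I n then (1 + b n) `^ (- 2^-1) else 1).
  by rewrite !(big_mkcond (fun j : 'I__ => I j)) big_ord_recr.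
rewrite wS; set w := \prod_(j < n | I j) _.
transitivity (\int[P]_x (W n.+1 x * cos (eta x))); first by [].
have [In|In] := boolP (I n); last first.
  rewrite mulr1 -IH//; last by move=> j jn; apply: orth; rewrite ltnW.
  by apply: eq_Rintegral => x _; rewrite WS (negbTE In) mulr1.
have mW : measurable_fun setT (W n) by exact: (measurable_expR_sqr n (fun j => - b j)).
have men := mH (He In); have meta := mH Heta.
have W01 x : 0 <= W n x <= 1.
  apply/andP; split; first by apply: prodr_ge0 => j _; exact: expR_ge0.
  apply: prodr_ile1 => j _; rewrite expR_ge0/= -[leRHS]expR0 ler_expR.
  by rewrite mulrAC mulr_le0_ge0 ?sqr_ge0// mulNr oppr_le0 divr_ge0.
(* Product-to-sum formula: for fixed [g], both cosines have an element of [H] as argument, so the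
   induction hypothesis applies to each. *)
pose f x g := W n x * (2^-1 * (cos (Num.sqrt (b n) * g * e n x + eta x) +
                               cos (Num.sqrt (b n) * g * e n x - eta x))).
have fE x g : f x g = W n x * cos (eta x) * cos (Num.sqrt (b n) * g * e n x).
  rewrite /f cosD cosB; by set A := Num.sqrt _ * _ * _; field.
have step1 : \int[P]_x (W n.+1 x * cos (eta x)) = \int[P]_x \int[gam]_g f x g.
  apply: eq_Rintegral => x _; rewrite WS In.
  transitivity (\int[gam]_g (W n x * cos (eta x) * cos (Num.sqrt (b n) * g * e n x))).
    rewrite RintZ ?std_normal_cos//; first by rewrite !mulNr; ring.
    apply: (@Int_bounded _ _ _ _ _ 1); last by move=> g; rewrite ler_norml cos_geN1 cos_le1.
    apply: measurableT_comp; first exact: (continuous_measurable_fun (@continuous_cos R)).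
    by apply: measurable_funM => //; exact: measurable_funM.
  by apply: eq_Rintegral => g _; rewrite fE.
rewrite step1 (@Rint_Fubini _ _ _ _ _ P gam f 1); last 2 first.
- have mcos : measurable_fun setT (@cos R) by exact: (continuous_measurable_fun (@continuous_cos R)).
  have m1 (h : T -> R) : measurable_fun setT h -> measurable_fun setT (fun z : T * measurableTypeR R => h z.1).
    by move=> mh; exact: (measurableT_comp mh).
  have m2 : measurable_fun setT (fun z : T * measurableTypeR R => Num.sqrt (b n) * z.2 * e n z.1).
    apply: measurable_funM; last exact: m1.
    by apply: measurable_funM.
  apply: measurable_funM; first exact: m1.
  apply: measurable_funM => //; apply: measurable_funD.
    by apply: (measurableT_comp mcos); apply: measurable_funD => //; exact: m1.
  by apply: (measurableT_comp mcos); apply: measurable_funB => //; exact: m1.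
- move=> x g; rewrite fE; have /andP[W0 W1] := W01 x.
  have c1 (t : R) : `|cos t| <= 1 by rewrite ler_norml cos_geN1 cos_le1.
  rewrite !normrM (ger0_norm W0) mulr_ile1 ?mulr_ge0//.
  by rewrite mulr_ile1.
transitivity (\int[gam]_g (w * expR (- (dot eta eta / 2)) * expR (- (b n * g ^+ 2 / 2)))); last first.
  rewrite RintZ; first by rewrite std_normal_Rint_sqr; [ring|have := b0 n; lra].
  apply: (@Int_bounded _ _ _ _ _ 1).
    apply: measurableT_comp => //; apply: measurableT_comp => //; apply: measurable_funM => //.
    by apply: measurable_funM => //; exact: measurable_funX.
  move=> g; rewrite ger0_norm ?expR_ge0// -[leRHS]expR0 ler_expR oppr_le0.
  by rewrite divr_ge0// mulr_ge0// sqr_ge0.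
apply: eq_Rintegral => g _; rewrite /f.
set c := Num.sqrt (b n) * g.
have c2 : c ^+ 2 = b n * g ^+ 2 by rewrite /c exprMn sqr_sqrtr.
have [Hp [op dp]] := combine_orth c In Heta orth 1.
have [Hm [om dm]] := combine_orth c In Heta orth (-1).
have iW xi : H xi -> P.-integrable setT (EFin \o (fun x => W n x * cos (xi x))).
  move=> Hxi; apply: (@Int_bounded _ _ _ _ _ 1).
    apply: measurable_funM => //; apply: measurableT_comp; last exact: mH.
    exact: (continuous_measurable_fun (@continuous_cos R)).
  move=> x; have /andP[W0 W1] := W01 x.
  by rewrite normrM (ger0_norm W0) mulr_ile1// ler_norml cos_geN1 cos_le1.
have e1 : (fun x => c * e n x + 1 * eta x) = (fun x => c * e n x + eta x).
  by apply/funext => x; rewrite mul1r.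
have e2 : (fun x => c * e n x + -1 * eta x) = (fun x => c * e n x - eta x).
  by apply/funext => x; rewrite mulN1r.
rewrite e1 in Hp op dp; rewrite e2 in Hm om dm.
have IHp := IH _ Hp op; have IHm := IH _ Hm om.
rewrite dp in IHp; rewrite dm in IHm.
transitivity (2^-1 * (\int[P]_x (W n x * cos (c * e n x + eta x)) +
                      \int[P]_x (W n x * cos (c * e n x - eta x)))).
  rewrite -RintD; [|exact: iW Hp|exact: iW Hm].
  rewrite -RintZ; last by apply: IntD; [exact: iW Hp|exact: iW Hm].
  by apply: eq_Rintegral => x _; ring.
rewrite IHp IHm c2 -/w sqrrN expr1n mul1r.
have -> : - ((b n * g ^+ 2 + dot eta eta) / 2) = - (dot eta eta / 2) - b n * g ^+ 2 / 2.
  by field.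
by rewrite expRD; field.
Qed.

(** Same induction as for cosines, with the single argument [sqrt (b n) g e_n + eta]. The integrands
    are unbounded but nonnegative, so Tonelli replaces bounded Fubini, and [b j < 1] keeps the
    average over [g] finite. *)
Lemma gauss_sqr_expR n (b : nat -> R) eta : (forall j, 0 <= b j < 1) -> H eta ->
  (forall j, (j < n)%N -> I j -> dot (e j) eta = 0) ->
  (\int[P]_x ((\prod_(j < n | I j) expR (b j * e j x ^+ 2 / 2)) * expR (eta x))%:E =
  ((\prod_(j < n | I j) (1 - b j) `^ (- 2^-1)) * expR (dot eta eta / 2))%:E)%E.
Proof.
move=> b01; elim: n eta => [|n IH] eta Heta orth.
  have [_ _ /(_ 1)] := H_mgf HH Heta.
  rewrite big_ord0 mul1r expr1n mul1r => <-.
  by apply: eq_integral => x _; rewrite big_ord0 !mul1r.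
pose W n x := \prod_(j < n | I j) expR (b j * e j x ^+ 2 / 2).
have WS x : W n.+1 x = W n x * (if I n then expR (b n * e n x ^+ 2 / 2) else 1).
  by rewrite /W !(big_mkcond (fun j : 'I__ => I j)) big_ord_recr.
have wS : \prod_(j < n.+1 | I j) (1 - b j) `^ (- 2^-1) =
    (\prod_(j < n | I j) (1 - b j) `^ (- 2^-1)) * (if I n then (1 - b n) `^ (- 2^-1) else 1).
  by rewrite !(big_mkcond (fun j : 'I__ => I j)) big_ord_recr.
rewrite wS; set w := \prod_(j < n | I j) _.
transitivity (\int[P]_x (W n.+1 x * expR (eta x))%:E)%E; first by [].
have [In|In] := boolP (I n); last first.
  rewrite mulr1 -IH//; last by move=> j jn; apply: orth; rewrite ltnW.
  by apply: eq_integral => x _; rewrite WS (negbTE In) mulr1.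
have mW : measurable_fun setT (W n) by exact: measurable_expR_sqr.
have men := mH (He In); have meta := mH Heta.
have W0 x : 0 <= W n x by apply: prodr_ge0 => j _; exact: expR_ge0.
have w0 : 0 <= w by apply: prodr_ge0 => j _; exact: powR_ge0.
have /andP[bn0 bn1] := b01 n.
pose f (z : T * measurableTypeR R) : \bar R :=
  (W n z.1 * expR (Num.sqrt (b n) * z.2 * e n z.1 + eta z.1))%:E.
have mf : measurable_fun setT f.
  have m1 (h : T -> R) : measurable_fun setT h -> measurable_fun setT (fun z : T * measurableTypeR R => h z.1).
    by move=> mh; exact: (measurableT_comp mh).
  apply/measurable_EFinP; apply: measurable_funM; first exact: m1.
  apply: measurableT_comp => //; apply: measurable_funD; last exact: m1.
  apply: measurable_funM; last exact: m1.
  by apply: measurable_funM.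
have f0 z : (0 <= f z)%E by rewrite lee_fin mulr_ge0// expR_ge0.
have := @fubini_tonelli _ _ _ _ _ P gam f mf f0.
have -> : (\int[P]_x \int[gam]_y f (x, y) = \int[P]_x (W n.+1 x * expR (eta x))%:E)%E.
  apply: eq_integral => x _; rewrite WS In /f/=.
  transitivity (\int[gam]_g ((W n x * expR (eta x))%:E * (expR (Num.sqrt (b n) * g * e n x))%:E))%E.
    by apply: eq_integral => g _; rewrite -EFinM expRD; congr EFin; ring.
  rewrite ge0_integralZl//; first last.
  - by rewrite lee_fin mulr_ge0// expR_ge0.
  - apply/measurable_EFinP; apply: measurableT_comp => //.
    by apply: measurable_funM => //; exact: measurable_funM.
  rewrite std_normal_expR// -EFinM; congr EFin; ring.
move=> ->.
transitivity (\int[gam]_g ((w * expR (dot eta eta / 2))%:E * (expR (- (- b n * g ^+ 2 / 2)))%:E))%E; last first.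
  rewrite ge0_integralZl//; first last.
  - by rewrite lee_fin mulr_ge0// expR_ge0.
  - apply/measurable_EFinP; apply: measurableT_comp => //; apply: measurableT_comp => //.
    apply: measurable_funM => //.
    by apply: measurable_funM => //; exact: measurable_funX.
  rewrite normal_sqr_mgf; last by lra.
  by rewrite -EFinM; congr EFin; ring.
apply: eq_integral => g _; rewrite /f/=.
set c := Num.sqrt (b n) * g.
have c2 : c ^+ 2 = b n * g ^+ 2 by rewrite /c exprMn sqr_sqrtr.
have [Hp [op dp]] := combine_orth c In Heta orth 1.
have IHp := IH _ Hp op; rewrite dp c2 expr1n mul1r in IHp.
rewrite -EFinM (_ : w * _ * _ = w * expR ((b n * g ^+ 2 + dot eta eta) / 2)).
  by rewrite -IHp; apply: eq_integral => x _; rewrite mul1r.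
have -> : (b n * g ^+ 2 + dot eta eta) / 2 = dot eta eta / 2 + - (- b n * g ^+ 2 / 2).
  by field.
by rewrite expRD mulrA.
Qed.

End gaussian_squares.

(** * The series and its sum *)

Section nonneg_series.
Context {d : measure_display} {T : measurableType d} {R : realType}
  (P : probability T R).
Local Notation Int f := (P.-integrable [set: T] (EFin \o f)).
Variables (p : nat -> T -> R) (la : nat -> R) (c : R).
Hypothesis p_ge0 : forall j x, 0 <= p j x.
Hypothesis p_Int : forall j, Int (p j).
Hypothesis p_mean : forall j, \int[P]_x p j x = la j.
Hypothesis la_bound : forall n, \sum_(j < n) la j <= c.
Let T_ n x := \sum_(j < n) p j x.
Let Z : T -> R := fun x => limn (T_ ^~ x).
(** Extended-real version of [Z], where monotone limits always exist. Where the partial sums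
    diverge, [limn] in the reals and [fine] of [+oo] both default to 0, so [Z] is [fine] of [Zb]
    everywhere. *)
Let Zb : T -> \bar R := fun x => limn (fun n => (T_ n x)%:E).

Lemma ndecr_partial_sums (a : nat -> R) : (forall j, 0 <= a j) ->
  {homo (fun n => \sum_(j < n) a j) : m n / (m <= n)%N >-> m <= n}.
Proof.
move=> a0 m n mn; rewrite -!(big_mkord predT) [leRHS](@big_cat_nat _ _ _ m)//= lerDl.
by rewrite big_seq_cond sumr_ge0.
Qed.

Let la_ge0 j : 0 <= la j.
Proof. by rewrite -p_mean /Rintegral fine_ge0// integral_ge0// => x _; rewrite lee_fin. Qed.

Let mT n : measurable_fun setT (T_ n).
Proof. by apply: Int_measurable; apply: Int_sum. Qed.

Let Tnd x : {homo T_ ^~ x : m n / (m <= n)%N >-> m <= n}.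
Proof. exact: (@ndecr_partial_sums (p ^~ x)). Qed.

Let Tnd' x : {homo (fun n => (T_ n x)%:E) : m n / (m <= n)%N >-> (m <= n)%E}.
Proof. by move=> m n /(Tnd x); rewrite lee_fin. Qed.

Let cvgZb x : (fun n => (T_ n x)%:E) @ \oo --> Zb x.
Proof. exact: ereal_nondecreasing_is_cvgn. Qed.

Let mZb : measurable_fun setT Zb.
Proof.
apply: (@emeasurable_fun_cvg _ _ _ _ (fun n => EFin \o T_ n)) => //.
  by move=> n; exact/measurable_EFinP.
by move=> x _; exact: cvgZb.
Qed.

Let Zb_ge0 x : (0 <= Zb x)%E.
Proof.
apply: lime_ge; first exact: (cvgZb (x := x)).
by apply: nearW => n; rewrite lee_fin; apply: sumr_ge0.
Qed.

Let Zb_cvg x r : Zb x = r%:E -> T_ ^~ x @ \oo --> r.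
Proof. by move=> h; have := cvgZb (x := x); rewrite h => /fine_cvg. Qed.

Let Z_Zb x : Z x = fine (Zb x).
Proof.
case E : (Zb x) => [r| |] /=.
- by apply: cvg_lim => //; exact: Zb_cvg.
- rewrite /Z dvgP// => cT; have : (fun n => (T_ n x)%:E) @ \oo --> (Z x)%:E.
    by apply: cvg_EFin => //; near=> n.
  by move/cvg_lim => /(_ (@ereal_hausdorff R)); rewrite -/(Zb x) E.
- by have := Zb_ge0 x; rewrite E.
Unshelve. all: by end_near. Qed.

Lemma nonneg_series_measurable : measurable_fun setT Z.
Proof.
rewrite (_ : Z = fine \o Zb); last by apply/funext => x; rewrite Z_Zb.
by apply: measurableT_comp => //; exact: fine_measurable.
Qed.

Lemma nonneg_series_ge0 x : 0 <= Z x.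
Proof. by rewrite Z_Zb fine_ge0. Qed.

Let int_T n : (\int[P]_x (T_ n x)%:E)%E = (\sum_(j < n) la j)%:E.
Proof.
rewrite -EFin_Rint; last exact: Int_sum.
by rewrite Rint_sum//; congr EFin; apply: eq_bigr.
Qed.

Lemma cvg_nonneg_mean : cvgn (fun n => \sum_(j < n) la j).
Proof.
apply: nondecreasing_is_cvgn; first exact: ndecr_partial_sums.
by exists c => _ [n _ <-].
Qed.

Let int_Zb : (\int[P]_x Zb x)%E = (limn (fun n => \sum_(j < n) la j))%:E.
Proof.
rewrite (@monotone_convergence _ _ _ P _ measurableT (fun n => EFin \o T_ n)).
- apply: cvg_lim => //.
  rewrite (_ : (fun n => _) = (fun n => (\sum_(j < n) la j)%:E)); last first.
    by apply/funext => n; rewrite int_T.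
  by apply: cvg_EFin; [near=> n|exact: cvg_nonneg_mean].
- by move=> n; exact/measurable_EFinP.
- by move=> n x _; rewrite lee_fin; apply: sumr_ge0.
- by move=> x _; exact: Tnd'.
Unshelve. all: by end_near. Qed.

Let Zb_fin : {ae P, forall x, Zb x = (Z x)%:E}.
Proof.
have : P.-integrable setT Zb.
  apply/integrableP; split => //.
  by under eq_integral do rewrite gee0_abs//; rewrite int_Zb ltry.
move=> /(integrable_ae measurableT); apply: filterS => x /(_ Logic.I) h.
by rewrite Z_Zb fineK.
Qed.

Lemma nonneg_series_ae_cvg : {ae P, forall x, T_ ^~ x @ \oo --> Z x}.
Proof. by apply: filterS Zb_fin => x; exact: Zb_cvg. Qed.

Let int_Z : (\int[P]_x (Z x)%:E)%E = (limn (fun n => \sum_(j < n) la j))%:E.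
Proof.
rewrite -int_Zb; apply: ge0_ae_eq_integral => //.
- by apply/measurable_EFinP; exact: nonneg_series_measurable.
- by move=> x _; rewrite lee_fin nonneg_series_ge0.
- by apply: filterS Zb_fin => x ->.
Qed.

Lemma nonneg_series_Int : Int Z.
Proof.
apply: ge0_Int; [exact: nonneg_series_measurable|exact: nonneg_series_ge0|].
by rewrite int_Z ltry.
Qed.

Lemma nonneg_series_mean : \int[P]_x Z x = limn (fun n => \sum_(j < n) la j).
Proof.
by rewrite /Rintegral int_Z.
Qed.

Lemma nonneg_series_laplace (s : R) : 0 <= s ->
  (fun n => \int[P]_x expR (- (s * T_ n x))) @ \oo --> \int[P]_x expR (- (s * Z x)).
Proof.
move=> s0; suff [] : Int (fun x => expR (- (s * Z x))) /\
  (fun n => \int[P]_x expR (- (s * T_ n x))) @ \oo --> \int[P]_x expR (- (s * Z x)) by [].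
apply: (@Rint_dominated_cvg _ _ _ _ _ _ (cst 1)).
- move=> n; apply: measurableT_comp => //; apply: measurableT_comp => //.
  exact: measurable_funM.
- apply: measurableT_comp => //; apply: measurableT_comp => //.
  by apply: measurable_funM => //; exact: nonneg_series_measurable.
- apply: filterS nonneg_series_ae_cvg => x cx.
  by apply: (cvg_comp _ expR); [apply: cvgN; apply: cvgMr; exact: cx|exact: continuous_expR].
- exact: Int_cst.
- apply: aeW => x n; rewrite ger0_norm ?expR_ge0// -[leRHS]expR0 ler_expR oppr_le0.
  by rewrite mulr_ge0// sumr_ge0.
Qed.

Lemma nonneg_series_mgf (t : R) : 0 <= t ->
  (fun n => \int[P]_x (expR (t * T_ n x))%:E)%E @ \oo --> (\int[P]_x (expR (t * Z x))%:E)%E.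
Proof.
move=> t0.
have mE (f : T -> R) : measurable_fun setT f -> measurable_fun setT (fun x => (expR (t * f x))%:E).
  by move=> mf; apply/measurable_EFinP; apply: measurableT_comp => //; exact: measurable_funM.
have nd x : {homo (fun n => (expR (t * T_ n x))%:E) : m n / (m <= n)%N >-> (m <= n)%E}.
  by move=> m n /(Tnd x) h; rewrite lee_fin ler_expR ler_wpM2l.
have -> : (\int[P]_x (expR (t * Z x))%:E = \int[P]_x limn (fun n => (expR (t * T_ n x))%:E))%E.
  apply: ge0_ae_eq_integral => //.
  - by apply: mE; exact: nonneg_series_measurable.
  - apply: (@emeasurable_fun_cvg _ _ _ _ (fun n x => (expR (t * T_ n x))%:E)).
      by move=> n; exact: mE.
    by move=> x _; exact: ereal_nondecreasing_is_cvgn.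
  - move=> x _; apply: lime_ge; first exact: ereal_nondecreasing_is_cvgn.
    by apply: nearW => n; rewrite lee_fin expR_ge0.
  - apply: filterS nonneg_series_ae_cvg => x cx _; apply/esym; apply: cvg_lim => //.
    apply: cvg_EFin; first by near=> n.
    by apply: (cvg_comp _ expR); [apply: cvgMr; exact: cx|exact: continuous_expR].
apply: (@cvg_monotone_convergence _ _ _ P setT measurableT (fun n x => (expR (t * T_ n x))%:E)).
- by move=> n; exact: mE.
- by move=> n x _; rewrite lee_fin expR_ge0.
- by move=> x _; exact: nd.
Unshelve. all: by end_near. Qed.

End nonneg_series.

Section powR_bounds.
Context {R : realType}.
Implicit Types a b y : R.

Lemma powR_half_gt0 a : 0 < a -> 0 < a `^ (- 2^-1).
Proof. by move=> a0; rewrite powR_gt0. Qed.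

Lemma powR_half_le a b : 0 < a -> a <= b -> b `^ (- 2^-1) <= a `^ (- 2^-1).
Proof.
move=> a0 ab; have b0 := lt_le_trans a0 ab.
rewrite !powRN lef_pV2 ?posrE ?powR_gt0//.
by apply: ge0_ler_powR => //; rewrite nnegrE ltW.
Qed.

Lemma powR_half_ge_expR y : 0 <= y -> expR (- y) <= (1 + 2 * y) `^ (- 2^-1).
Proof.
move=> y0; have -> : - y = (2 * y) * - 2^-1 by field.
rewrite expRM; apply: powR_half_le; first by lra.
exact: expR_ge1Dx.
Qed.

(** Compare [exp (- y) (1 + y) <= 1] with [(1 - y + y^2) (1 + y) = 1 + y^3]. *)
Lemma expRN_le_quadratic y : 0 <= y -> expR (- y) <= 1 - y + y ^+ 2.
Proof.
move=> y0; have h := expR_ge1Dx y; have p := expR_gt0 (- y).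
have : expR (- y) * (1 + y) <= 1.
  by rewrite -[leRHS](expRxMexpNx_1 (- y)) opprK ler_wpM2l ?expR_ge0.
nra.
Qed.

End powR_bounds.

Section ae_integrals.
Context {d : measure_display} {T : measurableType d} {R : realType}
  (P : probability T R).
Implicit Types f g : T -> R.

Lemma Rint_ae_eq f g : measurable_fun setT f -> measurable_fun setT g ->
  {ae P, forall x, f x = g x} -> \int[P]_x f x = \int[P]_x g x.
Proof.
move=> mf mg fg; congr fine; apply: ae_eq_integral => //; try exact/measurable_EFinP.
by apply: filterS fg => x ->.
Qed.

Lemma Rint_ae_ge0 f : measurable_fun setT f -> {ae P, forall x, 0 <= f x} ->
  0 <= \int[P]_x f x.
Proof.
move=> mf f0; rewrite (@Rint_ae_eq f (fun x => `|f x|))//.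
- by rewrite fine_ge0// integral_ge0// => x _; rewrite lee_fin.
- exact: measurableT_comp.
- by apply: filterS f0 => x h; rewrite ger0_norm.
Qed.

Lemma Rint_abs_ae0 f : P.-integrable setT (EFin \o f) ->
  \int[P]_x `|f x| = 0 -> {ae P, forall x, f x = 0}.
Proof.
move=> fi f0; have ni : P.-integrable setT (EFin \o (fun x => `|f x|)).
  exact: integrable_abse fi.
have : (\int[P]_x `|(f x)%:E| = 0)%E.
  by rewrite -[RHS]/(0%:E) -f0 EFin_Rint.
move/(ae_eq_integral_abs _ measurableT).
have mf : measurable_fun setT (fun x => (f x)%:E) by exact/measurable_EFinP/Int_measurable/fi.
by move=> /(_ mf); apply: filterS => x /(_ Logic.I)/= [].
Qed.

End ae_integrals.

(** * The mean of X and the sum of the eigenvalues *)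

Section mean_of_positive_chaos.
Context {d : measure_display} {T : measurableType d} {R : realType}
  (P : probability T R).
Local Notation Int f := (P.-integrable [set: T] (EFin \o f)).
Variables (p : nat -> T -> R) (la : nat -> R) (X : T -> R).
Hypothesis p_ge0 : forall j x, 0 <= p j x.
Hypothesis p_L2 : forall j, L2 P (p j).
Hypothesis p_mean : forall j, \int[P]_x p j x = la j.
Hypothesis p_laplace : forall n (b : nat -> R), (forall j, 0 <= b j) ->
  \int[P]_x expR (- \sum_(j < n) b j * p j x) =
  \prod_(j < n) (1 + 2 * (b j * la j)) `^ (- 2^-1).
Hypothesis X_L2 : L2 P X.
Hypothesis X_ge0 : {ae P, forall x, 0 <= X x}.
Let T_ n x := \sum_(j < n) p j x.
Let Lam n := \sum_(j < n) la j.
Let c := \int[P]_x X x.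
Let S n x := T_ n x - Lam n.
Hypothesis X_expansion : (fun n => L2dot P (fun x => S n x - (X x - c))
  (fun x => S n x - (X x - c))) @ \oo --> 0.

Let p_Int j : Int (p j). Proof. exact: L2_Int. Qed.

Let la_ge0 j : 0 <= la j.
Proof. by rewrite -p_mean /Rintegral fine_ge0// integral_ge0// => x _; rewrite lee_fin. Qed.

Let T_L2 n : L2 P (T_ n). Proof. by apply: L2_sum => j _. Qed.

Let S_L2 n : L2 P (S n). Proof. by apply: L2B => //; exact: L2_cst. Qed.

Let T_ge0 n x : 0 <= T_ n x. Proof. exact: sumr_ge0. Qed.

Let laplace_factor_gt0 (s : R) j : 0 <= s -> 0 < 1 + 2 * (s * la j).
Proof. by move=> s0; rewrite ltr_wpDr// mulr_ge0// mulr_ge0. Qed.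

Let A n (s : R) := \int[P]_x expR (- (s * T_ n x)).

Let AE n (s : R) : 0 <= s -> A n s = \prod_(j < n) (1 + 2 * (s * la j)) `^ (- 2^-1).
Proof.
move=> s0; rewrite -(@p_laplace n (fun=> s))//.
by apply: eq_Rintegral => x _; rewrite /T_ mulr_sumr.
Qed.

Let A_gt0 n (s : R) : 0 <= s -> 0 < A n s.
Proof.
by move=> s0; rewrite AE//; apply: prodr_gt0 => j _; apply/powR_half_gt0/laplace_factor_gt0.
Qed.

Let m_exp n (s : R) : measurable_fun setT (fun x => expR (- (s * T_ n x))).
Proof.
apply: measurableT_comp => //; apply: measurableT_comp => //.
by apply: measurable_funM => //; exact: L2_measurable.
Qed.

Let exp01 n (s : R) x : 0 <= s -> 0 <= expR (- (s * T_ n x)) <= 1.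
Proof.
move=> s0; rewrite expR_ge0/= -[leRHS]expR0 ler_expR oppr_le0.
by rewrite mulr_ge0.
Qed.

Let exp_L2 n (s : R) : 0 <= s -> L2 P (fun x => expR (- (s * T_ n x))).
Proof.
move=> s0; apply: (@L2_bounded _ _ _ _ _ 1) => // x.
by have /andP[h0 h1] := exp01 n x s0; rewrite ger0_norm.
Qed.

(** Each factor changes by at most sqrt 2, since [(1 + 2 s la) / 2 <= 1 + s la]; the loss [2^(n/2)]
    does not depend on [s]. *)
Let A_half n (s : R) : 0 <= s -> A n (s / 2) <= (2^-1 `^ (- 2^-1)) ^+ n * A n s.
Proof.
move=> s0; rewrite !AE ?divr_ge0// -[X in _ ^+ X]card_ord -prodr_const -big_split/=.
apply: ler_prod => j _; rewrite powR_ge0/= -powRM ?invr_ge0//; last first.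
  exact/ltW/laplace_factor_gt0.
have h := laplace_factor_gt0 j s0.
by apply: powR_half_le; [rewrite mulr_gt0|lra].
Qed.

(** Uses [y <= exp y] at [y = s T_n / 2]. With [A_half], the mean of [T_n] under the weight
    [exp (- s T_n)] is O(1/s) for fixed [n]. *)
Let int_Texp n (s : R) : 0 < s ->
  \int[P]_x (T_ n x * expR (- (s * T_ n x))) <= 2 / s * (2^-1 `^ (- 2^-1)) ^+ n * A n s.
Proof.
move=> s0; have s2 : 0 <= s / 2 by rewrite divr_ge0// ltW.
apply: (@le_trans _ _ (\int[P]_x (2 / s * expR (- (s / 2 * T_ n x))))).
  apply: Rint_le.
  - by apply: L2M => //; exact/exp_L2/ltW.
  - by apply: IntZ; apply: L2_Int; exact: exp_L2.
  - move=> x; set t := T_ n x.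
    have -> : - (s * t) = - (s / 2 * t) + - (s / 2 * t) by field.
    rewrite expRD mulrA ler_wpM2r ?expR_ge0//.
    have h : s / 2 * t <= expR (s / 2 * t) by apply: le_trans (expR_ge1Dx _); lra.
    rewrite expRN ler_pdivrMr ?expR_gt0// -ler_pdivrMl ?divr_gt0//.
    by rewrite invf_div.
rewrite RintZ; last by apply: L2_Int; exact: exp_L2.
rewrite -mulrA ler_wpM2l ?divr_ge0 ?(ltW s0)//.
exact/A_half/ltW.
Qed.

(* The conditional mean of T_m - T_n given T_n is Lam_m - Lam_n; the inequality is
   the derivative at u = 0 of E exp (- s T_n - u (T_m - T_n)). *)
Let int_Dexp n m (s : R) : (n <= m)%N -> 0 <= s ->
  \int[P]_x ((T_ m x - T_ n x) * expR (- (s * T_ n x))) <= (Lam m - Lam n) * A n s.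
Proof.
move=> nm s0; pose D x := T_ m x - T_ n x; pose phi x := expR (- (s * T_ n x)).
have DE x : D x = \sum_(n <= j < m) p j x.
  rewrite /D /T_ -!(big_mkord xpredT (fun j => p j x)) (@big_cat_nat _ _ _ n 0 m)//=.
  by rewrite addrAC subrr add0r.
have LE : Lam m - Lam n = \sum_(n <= j < m) la j.
  rewrite /Lam -!(big_mkord xpredT la) (@big_cat_nat _ _ _ n 0 m)//=.
  by rewrite addrAC subrr add0r.
have LD : L2 P D by exact: L2B.
have D0 x : 0 <= D x by rewrite DE big_seq_cond sumr_ge0.
have phi01 x := exp01 n x s0.
have L0 : 0 <= Lam m - Lam n by rewrite LE big_seq_cond sumr_ge0.
(* A finite difference with quadratic error [u * L2dot P D D] stands in for the derivative; [u] is
   made small at the end. *)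
have key (u : R) : 0 < u -> \int[P]_x (D x * phi x) <=
    (Lam m - Lam n) * A n s + u * L2dot P D D.
  move=> u0; have u0' := ltW u0.
  (* Weight [s] on the first [n] squares and [u] on the next ones; this is why [p_laplace] is stated
     with a separate weight per index. *)
  pose b j := if (j < n)%N then s else u.
  have b0 j : 0 <= b j by rewrite /b; case: ifP.
  have bE x : \sum_(j < m) b j * p j x = s * T_ n x + u * D x.
    rewrite DE /T_ -(big_mkord xpredT (fun j => b j * p j x)).
    rewrite -(big_mkord xpredT (fun j => p j x)) (@big_cat_nat _ _ _ n 0 m)//= !mulr_sumr.
    congr (_ + _); apply: eq_big_nat => j /andP[j1 j2].
      by rewrite /b j2.
    by rewrite /b ltnNge j1.
  have IE : \int[P]_x (phi x * expR (- (u * D x))) =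
      A n s * \prod_(n <= j < m) (1 + 2 * (u * la j)) `^ (- 2^-1).
    transitivity (\int[P]_x expR (- \sum_(j < m) b j * p j x)).
      by apply: eq_Rintegral => x _; rewrite bE opprD expRD.
    rewrite p_laplace// AE// -(big_mkord xpredT (fun j => (1 + 2 * (b j * la j)) `^ (- 2^-1))).
    rewrite -(big_mkord xpredT (fun j => (1 + 2 * (s * la j)) `^ (- 2^-1))).
    rewrite (@big_cat_nat _ _ _ n 0 m)//=.
    congr (_ * _); apply: eq_big_nat => j /andP[j1 j2].
      by rewrite /b j2.
    by rewrite /b ltnNge j1.
  have pexp : 1 - u * (Lam m - Lam n) <= \prod_(n <= j < m) (1 + 2 * (u * la j)) `^ (- 2^-1).
    apply: (@le_trans _ _ (expR (- (u * (Lam m - Lam n))))).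
      exact: expR_ge1Dx.
    rewrite LE mulr_sumr -sumrN expR_sum.
    apply: ler_prod => j _; rewrite expR_ge0/=; apply: powR_half_ge_expR.
    exact: mulr_ge0.
  have Lphi : L2 P phi by exact: exp_L2.
  have iphi : Int phi by exact: L2_Int.
  have iD : Int (fun x => D x * phi x) by exact: L2M.
  have iD2 : Int (fun x => D x * D x) by exact: L2M.
  have mD := L2_measurable LD; have mphi := L2_measurable Lphi.
  have iE : Int (fun x => phi x * expR (- (u * D x))).
    apply: (@Int_bounded _ _ _ _ _ 1).
      apply: measurable_funM => //; apply: measurableT_comp => //.
      by apply: measurableT_comp => //; exact: measurable_funM.
    move=> x; have /andP[h0 h1] := phi01 x.
    rewrite ger0_norm ?mulr_ge0 ?expR_ge0// mulr_ile1 ?expR_ge0//.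
    by rewrite -[leRHS]expR0 ler_expR oppr_le0 mulr_ge0.
  have : u * \int[P]_x (D x * phi x) <=
      A n s - \int[P]_x (phi x * expR (- (u * D x))) + u ^+ 2 * L2dot P D D.
    rewrite -mulN1r /A /L2dot -!RintZ// -!RintD//; first last.
    - exact: IntZ.
    - exact: IntZ.
    - by apply: IntD => //; exact: IntZ.
    apply: Rint_le.
    - exact: IntZ.
    - by apply: IntD; [apply: IntD => //; exact: IntZ|exact: IntZ].
    - move=> x; have /andP[h0 h1] := phi01 x; rewrite -/(phi x).
      have q := expRN_le_quadratic (mulr_ge0 u0' (D0 x)).
      have := ler_wpM2l (h0 : 0 <= phi x) q; have := mulr_ge0 (sqr_ge0 u) (sqr_ge0 (D x)).
      rewrite exprMn; set K := u ^+ 2 * D x ^+ 2 => k0 hq.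
      have : phi x * K <= K by rewrite ler_piMl.
      have e1 : u ^+ 2 * (D x * D x) = K by rewrite /K; ring.
      lra.
  have A0 := ltW (A_gt0 n s0); have := ler_wpM2l A0 pexp; rewrite -IE.
  move=> h1 h2; rewrite -(ler_pM2l u0); apply: le_trans h2 _.
  nra.
apply/ler_addgt0Pr => eps e0.
have k0 : 0 < L2dot P D D + 1 by rewrite ltr_wpDl// dot_ge0.
apply: le_trans (key (eps / (L2dot P D D + 1)) (divr_gt0 e0 k0)) _.
rewrite lerD2l mulrAC ler_pdivrMr// ler_wpM2l ?(ltW e0)//.
by rewrite lerDl.
Qed.

(** Two bounds for the mean of [(X - c) exp (- s T_n)]: at least [- c A n s] because [X >= 0], and
    at most [(O(1/s) - Lam n) A n s] through the expansion. Divide by [A n s > 0] and let [s]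
    grow. *)
Lemma chaos_mean_bound n : Lam n <= c.
Proof.
have key (s : R) : 0 < s -> Lam n - c <= 2 / s * (2^-1 `^ (- 2^-1)) ^+ n.
  move=> s0; have s0' := ltW s0; set K := (_ `^ _) ^+ n.
  pose phi x := expR (- (s * T_ n x)).
  have Lphi : L2 P phi by exact: exp_L2.
  have LX : L2 P (fun x => X x - c) by apply: L2B => //; exact: L2_cst.
  have cv : (fun m => L2dot P (S m) phi) @ \oo --> L2dot P (fun x => X x - c) phi.
    by apply: dot_cvgl.
  (* [X - c] is only the limit of [S m]; the growing mean [Lam m] subtracted in [S m] is offset by
     the contribution of [T_m - T_n], leaving [- Lam n]. *)
  have ub : L2dot P (fun x => X x - c) phi <= (2 / s * K - Lam n) * A n s.
    rewrite -(cvg_lim _ cv)//; apply: limr_le; first by apply/cvg_ex; eexists; exact: cv.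
    near=> m; have nm : (n <= m)%N by near: m; exact: nbhs_infty_ge.
    have -> : L2dot P (S m) phi = \int[P]_x (T_ n x * phi x) +
        \int[P]_x ((T_ m x - T_ n x) * phi x) + (- Lam m) * A n s.
      rewrite /A -RintZ; last exact: L2_Int.
      rewrite -!RintD; first last.
      - by apply: L2M => //; exact: L2B.
      - exact: L2M.
      - by apply: IntZ; exact: L2_Int.
      - by apply: IntD; apply: L2M => //; exact: L2B.
      by apply: eq_Rintegral => x _; rewrite /S /phi; ring.
    have := int_Texp n s0; have := int_Dexp nm s0'; rewrite -/K -/phi.
    lra.
  have lb : - c * A n s <= L2dot P (fun x => X x - c) phi.
    have -> : L2dot P (fun x => X x - c) phi = \int[P]_x (X x * phi x) + - c * A n s.
      rewrite /A -RintZ; last exact: L2_Int.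
      rewrite -RintD; last 2 first.
      - exact: L2M.
      - by apply: IntZ; exact: L2_Int.
      by apply: eq_Rintegral => x _; rewrite /phi; ring.
    rewrite lerDr; apply: Rint_ae_ge0.
      by apply: measurable_funM; [exact: (L2_measurable X_L2)|exact: (L2_measurable Lphi)].
    by apply: filterS X_ge0 => x h; rewrite mulr_ge0// expR_ge0.
  have A0 := A_gt0 n s0'.
  have := le_trans lb ub; rewrite ler_pM2r//; lra.
apply/ler_addgt0Pr => eps e0.
set K := (2^-1 `^ (- 2^-1)) ^+ n in key.
have K0 : 0 < K by rewrite exprn_gt0// powR_half_gt0.
have := key (2 * K / eps) (divr_gt0 (mulr_gt0 (ltr0Sn R 1) K0) e0).
have -> : 2 / (2 * K / eps) * K = eps by field; rewrite !gt_eqF.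
by rewrite lerBlDl.
Unshelve. all: by end_near. Qed.

Let Z x := limn (T_ ^~ x).
Let L := limn Lam.

(** [S n] tends to [X - c] in L^2 and [T_n] to [Z] in L^1, so [X - Z] is the constant limit of
    [c - Lam n]. *)
Let X_shift : {ae P, forall x, X x = Z x + (c - L)}.
Proof.
have iZ : Int Z by exact: (nonneg_series_Int p_ge0 p_Int p_mean chaos_mean_bound).
have cL : Lam @ \oo --> L := cvg_nonneg_mean p_ge0 p_mean chaos_mean_bound.
have EZ : \int[P]_x Z x = L := nonneg_series_mean p_ge0 p_Int p_mean chaos_mean_bound.
have aeZ := nonneg_series_ae_cvg p_ge0 p_Int p_mean chaos_mean_bound.
have iX : Int X by exact: L2_Int.
pose f x := X x + (-1) * Z x + (L - c).
have fi : Int f.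
  by apply: IntD; [apply: IntD => //; exact: IntZ|exact: Int_cst].
suff f0 : \int[P]_x `|f x| = 0.
  have := Rint_abs_ae0 fi f0; apply: filterS => x; rewrite /f; lra.
apply/eqP; rewrite eq_le; apply/andP; split; last first.
  by rewrite fine_ge0// integral_ge0// => x _; rewrite lee_fin.
have nf : Int (fun x => `|f x|) by exact: integrable_abse fi.
pose g n x := S n x - (X x - c).
have Lg n : L2 P (g n) by apply: L2B => //; apply: L2B => //; exact: L2_cst.
have ig n : Int (fun x => `|g n x|) by exact: integrable_abse (L2_Int (Lg n)).
have T_Z n : {ae P, forall x, T_ n x <= Z x}.
  apply: filterS aeZ => x cx.
  apply: (@nondecreasing_cvgn_le _ (T_ ^~ x)); last by apply/cvg_ex; exists (Z x).
  exact: (@ndecr_partial_sums _ (p ^~ x)).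
have intZT n : \int[P]_x `|Z x + (-1) * T_ n x| = L - Lam n.
  have iT : Int (T_ n) by exact: L2_Int.
  have i1 : Int (fun x => Z x + -1 * T_ n x) by apply: IntD => //; exact: IntZ.
  transitivity (\int[P]_x (Z x + (-1) * T_ n x)).
    apply: Rint_ae_eq.
    - by apply: measurableT_comp => //; exact: Int_measurable i1.
    - exact: Int_measurable i1.
    - by apply: filterS (T_Z n) => x h; rewrite mulN1r ger0_norm ?subr_ge0.
  rewrite RintD//; last exact: IntZ.
  rewrite RintZ// EZ /T_ Rint_sum//.
  rewrite (eq_bigr (fun j : 'I_n => la j)) ?mulN1r//.
(* The inequality [|g| <= e + g^2 / e] passes from the L^2 to the L^1 norm without square roots. *)
have bound n (e : R) : 0 < e ->
    \int[P]_x `|f x| <= e + e^-1 * L2dot P (g n) (g n) + (L - Lam n) + `|L - Lam n|.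
  move=> e0.
  have iT : Int (fun x => `|Z x + (-1) * T_ n x|).
    apply: (@integrable_abse _ _ _ P setT (EFin \o (fun x => Z x + -1 * T_ n x))).
    by apply: IntD => //; apply: IntZ; exact: L2_Int.
  have i2 : Int (fun x => e + e^-1 * (g n x * g n x)).
    by apply: IntD; [exact: Int_cst|apply: IntZ; exact: L2M].
  have -> : e + e^-1 * L2dot P (g n) (g n) + (L - Lam n) + `|L - Lam n| =
     \int[P]_x (e + e^-1 * (g n x * g n x) + `|Z x + (-1) * T_ n x| + `|L - Lam n|).
    rewrite RintD; [|exact: IntD|exact: Int_cst].
    rewrite RintD// RintD; [|exact: Int_cst|by apply: IntZ; exact: L2M].
    by rewrite RintZ ?intZT ?Rint_cst//; exact: L2M.
  apply: Rint_le => //.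
    by apply: IntD; [exact: IntD|exact: Int_cst].
  move=> x.
  have -> : f x = - g n x - (Z x + -1 * T_ n x) + (L - Lam n).
    by rewrite /f /g /S; ring.
  apply: le_trans (ler_normD _ _) _; rewrite lerD2r.
  apply: le_trans (ler_normB _ _) _; rewrite lerD2r normrN.
  have e1 : 0 < e^-1 by rewrite invr_gt0.
  have e2 : e * e^-1 = 1 by rewrite divff// gt_eqF.
  have := mulr_ge0 (ltW e1) (sqr_ge0 (`|g n x| - e)).
  have := mulr_ge0 (ltW e0) (normr_ge0 (g n x)); have := normr_ge0 (g n x).
  rewrite -expr2 -(real_normK (num_real (g n x))).
  set a := `|g n x|; set b := e^-1 => h1 h2.
  have -> : b * (a - e) ^+ 2 = b * a ^+ 2 - 2 * (e * b) * a + (e * b) * e by ring.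
  rewrite e2; lra.
apply/ler_addgt0Pr => e e0; rewrite add0r.
pose u n := e + e^-1 * L2dot P (g n) (g n) + (L - Lam n) + `|L - Lam n|.
have cu : u @ \oo --> e.
  have cLL : (fun n => L - Lam n) @ \oo --> (0 : R).
    by rewrite -(subrr L); apply: cvgB => //; exact: cvg_cst.
  have : u @ \oo --> e + e^-1 * 0 + 0 + `|0 : R|.
    apply: cvgD; last exact: cvg_norm.
    apply: cvgD => //; apply: cvgD; first exact: cvg_cst.
    by apply: cvgMr; exact: X_expansion.
  by rewrite mulr0 normr0 !addr0.
rewrite -(cvg_lim _ cu)//; apply: limr_ge; first by apply/cvg_ex; exists e.
by apply: nearW => n; exact: bound.
Qed.

Hypothesis X_small : forall eps : R, 0 < eps -> (0 < P [set w | (X w < eps)%R])%E.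

Lemma chaos_mean : Lam @ \oo --> c.
Proof.
have cL : Lam @ \oo --> L := cvg_nonneg_mean p_ge0 p_mean chaos_mean_bound.
suff -> : c = L by [].
apply/eqP; rewrite eq_le; apply/andP; split; last first.
  apply: limr_le; first exact: cL.
  by apply: nearW => n; exact: chaos_mean_bound.
rewrite leNgt; apply/negP => Lc.
have := X_small (eps := c - L); rewrite subr_gt0 => /(_ Lc).
suff -> : P [set w | X w < c - L] = 0%E by rewrite ltxx.
apply/negligibleP.
  rewrite (_ : [set w | _] = [set: T] `&` X @^-1` `]-oo, (c - L)[%classic).
    by apply: (L2_measurable X_L2).
  by rewrite setTI; apply/seteqP; split => w /=; rewrite in_itv.
apply: negligibleS X_shift => x /= h e.
have := nonneg_series_ge0 p_ge0 x; rewrite -/(Z x).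
move: h; rewrite e; lra.
Qed.

Lemma chaos_ae_series : {ae P, forall x, X x = Z x}.
Proof.
have Lc : L = c by apply: cvg_lim => //; exact: chaos_mean.
by apply: filterS X_shift => x ->; rewrite Lc subrr addr0.
Qed.

End mean_of_positive_chaos.

(** * Moment generating function of the series *)

Section series_mgf.
Context {d : measure_display} {T : measurableType d} {R : realType}
  (P : probability T R).
Local Notation Int f := (P.-integrable [set: T] (EFin \o f)).
Variables (p : nat -> T -> R) (la : nat -> R) (X : T -> R) (c : R).
Hypothesis p_ge0 : forall j x, 0 <= p j x.
Hypothesis p_Int : forall j, Int (p j).
Hypothesis p_mean : forall j, \int[P]_x p j x = la j.
Hypothesis la_bound : forall n, \sum_(j < n) la j <= c.
Hypothesis mX : measurable_fun setT X.
Hypothesis X_series : {ae P, forall x, X x = limn (fun n => \sum_(j < n) p j x)}.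
Let T_ n x := \sum_(j < n) p j x.
Let Z : T -> R := fun x => limn (T_ ^~ x).

Let la_ge0 j : 0 <= la j.
Proof. by rewrite -p_mean /Rintegral fine_ge0// integral_ge0// => x _; rewrite lee_fin. Qed.

Let mZ : measurable_fun setT Z.
Proof. by apply: nonneg_series_measurable. Qed.

Let m_expR (f : T -> R) (t : R) : measurable_fun setT f ->
  measurable_fun setT (fun x => expR (t * f x)).
Proof. by move=> mf; apply: measurableT_comp => //; exact: measurable_funM. Qed.

Let expR_X (t : R) : (\int[P]_x (expR (t * X x))%:E = \int[P]_x (expR (t * Z x))%:E)%E.
Proof.
apply: ae_eq_integral => //; try by apply/measurable_EFinP; exact: m_expR.
by apply: filterS X_series => x ->.
Qed.

Lemma series_mgf_le0 (t : R) : t <= 0 ->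
  (forall n, \int[P]_x expR (t * T_ n x) =
     \prod_(j < n) (1 - 2 * (t * la j)) `^ (- 2^-1)) ->
  exists L : R,
    (fun n => \prod_(j < n) (1 - 2 * (t * la j)) `^ (- 2^-1)) @ \oo --> L /\
    (\int[P]_x (expR (t * X x))%:E = L%:E)%E.
Proof.
move=> t0 hT; exists (\int[P]_x expR (t * Z x)); split.
  have s0 : 0 <= - t by rewrite oppr_ge0.
  have := nonneg_series_laplace p_ge0 p_Int p_mean la_bound s0.
  have -> : \int[P]_x expR (t * Z x) = \int[P]_x expR (- (- t * Z x)).
    by apply: eq_Rintegral => x _; rewrite mulNr opprK.
  apply: cvg_trans; apply: near_eq_cvg; apply: nearW => n.
  by rewrite -hT; apply: eq_Rintegral => x _; rewrite mulNr opprK.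
rewrite expR_X EFin_Rint//; apply: (@Int_bounded _ _ _ _ _ 1); first exact: m_expR.
move=> x; rewrite ger0_norm ?expR_ge0// -[leRHS]expR0 ler_expR mulr_le0_ge0//.
exact: nonneg_series_ge0.
Qed.

(** [th] keeps all [y = 2 t la_j] away from 1, so [(1 - y)^(-1/2) <= 1 / (1 - y) <= 1 + y / (1 - th)
    <= exp (y / (1 - th))], and the products stay below [exp (2 t c / (1 - th))]. This makes the
    limit given by monotone convergence finite. *)
Lemma series_mgf_ge0 (t th : R) : 0 <= t -> th < 1 ->
  (forall j, 2 * (t * la j) <= th) ->
  (forall n, \int[P]_x (expR (t * T_ n x))%:E =
     (\prod_(j < n) (1 - 2 * (t * la j)) `^ (- 2^-1))%:E)%E ->
  exists L : R,
    (fun n => \prod_(j < n) (1 - 2 * (t * la j)) `^ (- 2^-1)) @ \oo --> L /\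
    (\int[P]_x (expR (t * X x))%:E = L%:E)%E.
Proof.
move=> t0 th1 tth hT; pose Q n := \prod_(j < n) (1 - 2 * (t * la j)) `^ (- 2^-1).
have th0 : 0 < 1 - th by rewrite subr_gt0.
have Qle n : Q n <= expR (2 * t * c / (1 - th)).
  apply: (@le_trans _ _ (expR (\sum_(j < n) 2 * (t * la j) / (1 - th)))); last first.
    rewrite ler_expR -mulr_suml ler_pM2r ?invr_gt0// -!mulr_sumr -mulrA.
    by rewrite ler_wpM2l// ler_wpM2l.
  rewrite expR_sum; apply: ler_prod => j _; rewrite powR_ge0/=.
  set y := 2 * (t * la j); have y0 : 0 <= y by rewrite mulr_ge0// mulr_ge0.
  have y1 : y <= th := tth j.
  have yp : 0 < 1 - y by lra.
  apply: (@le_trans _ _ ((1 - y)^-1)).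
    rewrite powRN lef_pV2 ?posrE ?powR_gt0//.
    rewrite -[leLHS]powRr1 ?(ltW yp)//; apply: ger_powR; [lra|].
    by rewrite invf_le1// ler1n.
  apply: le_trans (expR_ge1Dx _).
  rewrite -[(1 - y)^-1]mul1r ler_pdivrMr//.
  have : y / (1 - th) * (1 - y) >= y.
    by rewrite mulrAC ler_pdivlMr// ler_wpM2l//; lra.
  set w := y / _; lra.
have cQ : (fun n => (Q n)%:E) @ \oo --> (\int[P]_x (expR (t * X x))%:E)%E.
  rewrite expR_X; have := nonneg_series_mgf p_ge0 p_Int p_mean la_bound t0.
  by apply: cvg_trans; apply: near_eq_cvg; apply: nearW => n; rewrite -hT.
have fin : (\int[P]_x (expR (t * X x))%:E)%E \is a fin_num.
  rewrite ge0_fin_numE; last by apply: integral_ge0 => x _; rewrite lee_fin expR_ge0.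
  apply: (@le_lt_trans _ _ (expR (2 * t * c / (1 - th)))%:E); last by rewrite ltry.
  rewrite -(cvg_lim _ cQ)//; apply: lime_le; first by apply/cvg_ex; eexists; exact: cQ.
  by apply: nearW => n; rewrite lee_fin.
exists (fine (\int[P]_x (expR (t * X x))%:E)); rewrite fineK//; split => //.
by move: cQ; rewrite -(fineK fin) => /fine_cvg.
Qed.

End series_mgf.

Section masked.
Context {R : realType}.
Variables (I : pred nat) (lam : nat -> R).

(** Lets finite and infinite [N] share series over all of nat: a zero coefficient adds nothing to a
    sum and the factor 1 to a product. *)
Definition masked (j : nat) : R := if I j then lam j else 0.

Lemma masked_sum (w : nat -> R) n :
  \sum_(j < n | I j) lam j * w j = \sum_(j < n) masked j * w j.
Proof.
by rewrite big_mkcond; apply: eq_bigr => j _; rewrite /masked; case: ifP => //; rewrite mul0r.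
Qed.

Lemma masked_mean n : \sum_(j < n | I j) lam j = \sum_(j < n) masked j.
Proof. by rewrite big_mkcond. Qed.

Lemma masked_prod (f : R -> R) n : f 0 = 1 ->
  \prod_(j < n | I j) f (lam j) = \prod_(j < n) f (masked j).
Proof. by move=> f0; rewrite big_mkcond; apply: eq_bigr => j _; rewrite /masked; case: ifP. Qed.

End masked.

Section iid_squares.
Context {d : measure_display} {T : measurableType d} {R : realType}
  (P : probability T R) (xi : nat -> T -> R).
Hypothesis iid : iid_std_normal P xi.
Local Notation Int f := (P.-integrable [set: T] (EFin \o f)).

Let mxi j : measurable_fun setT (xi j). Proof. by case: iid. Qed.

Lemma iid_mgf j : gauss_mgf P (xi j) 1.
Proof.
case: iid => _ law _; split => // a.
have ma : measurable_fun setT (fun y : R => (expR (a * y))%:E).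
  by apply/measurable_EFinP/measurableT_comp => //; exact: measurable_funM.
rewrite (ge0_integral_normal_law (mxi j) (law j) ma)//.
by rewrite normal_mgf ?oner_neq0// expr1n.
Qed.

Lemma iid_sqr_Int (a : R) j : Int (fun x => a * xi j x ^+ 2).
Proof. by apply: IntZ; apply: L2_sqr; exact: mgf_L2 (iid_mgf j). Qed.

Lemma iid_sqr_mean (a : R) j : \int[P]_x (a * xi j x ^+ 2) = a.
Proof.
rewrite RintZ; last by apply: L2_sqr; exact: mgf_L2 (iid_mgf j).
by rewrite (_ : \int[P]_x _ = 1) ?mulr1// -(mgf_var (iid_mgf j)).
Qed.

(** The closed form is that of [orthonormal_sqr_laplace] with constant [b]; this agreement
    identifies the law of [X]. *)
Lemma iid_sqr_laplace (la : nat -> R) (s : R) n : 0 <= s -> (forall j, 0 <= la j) ->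
  \int[P]_x expR (- (s * \sum_(j < n) la j * xi j x ^+ 2)) =
  \prod_(j < n) (1 + 2 * (s * la j)) `^ (- 2^-1).
Proof.
move=> s0 la0; pose h j (y : R) := expR (- (2 * (s * la j) * y ^+ 2 / 2)).
have mh j : measurable_fun setT (h j).
  apply: measurableT_comp => //; apply: measurableT_comp => //; apply: measurable_funM => //.
  by apply: measurable_funM => //; exact: measurable_funX.
have h01 j y : 0 <= h j y <= 1.
  rewrite expR_ge0/= -[leRHS]expR0 ler_expR oppr_le0.
  by rewrite divr_ge0// mulr_ge0 ?sqr_ge0// mulr_ge0// mulr_ge0.
transitivity (\int[P]_x \prod_(j < n) h j (xi j x)).
  apply: eq_Rintegral => x _; rewrite /h -expR_sum mulr_sumr -sumrN.
  by congr expR; apply: eq_bigr => j _; field.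
rewrite (iid_Rint_prod iid _ mh h01); apply: eq_bigr => j _.
case: iid => _ law _.
rewrite /Rintegral (ge0_integral_normal_law (f := fun y => (h j y)%:E) (mxi j) (law j)).
- by rewrite normal_sqr_mgf//; rewrite (lt_le_trans (ltrN10 R))// mulr_ge0// mulr_ge0.
- exact/measurable_EFinP.
- by move=> y; rewrite lee_fin; case/andP: (h01 j y).
Qed.

End iid_squares.

Section orthonormal_squares.
Context {d : measure_display} {T : measurableType d} {R : realType}
  (P : probability T R) (H : set (T -> R)).
Hypothesis HH : gaussian_hilbert_space P H.
Variables (I : pred nat) (e : nat -> T -> R) (lam : nat -> R).
Hypothesis He : forall j, I j -> H (e j).
Hypothesis eo : forall i j, I i -> I j -> L2dot P (e i) (e j) = (i == j)%:R.
Hypothesis lam0 : forall j, I j -> 0 < lam j.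
Local Notation la := (masked I lam).
Let p j x := la j * e j x ^+ 2.

Let dot00 : L2dot P (fun=> 0) (fun=> 0) = 0.
Proof. by rewrite /L2dot mul0r Rint_cst. Qed.

Lemma masked_ge0 j : 0 <= la j.
Proof. by rewrite /masked; case: ifP => // /lam0/ltW. Qed.

Lemma orthonormal_sqr_L2 j : L2 P (p j).
Proof.
rewrite /p /masked; case: ifP => Ij; first by apply: L2Z; exact: (H_sqr_L2 HH (He Ij)).
by rewrite (_ : (fun x => _) = fun=> 0); [exact: L2_cst|apply/funext => x; rewrite mul0r].
Qed.

Lemma orthonormal_sqr_mean j : \int[P]_x p j x = la j.
Proof.
rewrite /p /masked; case: ifP => Ij.
  rewrite RintZ; last exact: L2_sqr (H_L2 HH (He Ij)).
  by rewrite (_ : \int[P]_x _ = 1) ?mulr1//; have := eo Ij Ij; rewrite eqxx.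
by rewrite -[RHS](Rint_cst P); apply: eq_Rintegral => x _; rewrite mul0r.
Qed.

Lemma orthonormal_sqr_laplace n (b : nat -> R) : (forall j, 0 <= b j) ->
  \int[P]_x expR (- \sum_(j < n) b j * p j x) =
  \prod_(j < n) (1 + 2 * (b j * la j)) `^ (- 2^-1).
Proof.
move=> b0; pose b' j := 2 * (b j * la j).
have b'0 j : 0 <= b' j by rewrite mulr_ge0// mulr_ge0// masked_ge0.
have := gauss_sqr_cos HH He eo b'0 (H_zero HH) (n := n).
rewrite dot00 mul0r oppr0 expR0 mulr1 => h.
transitivity (\prod_(j < n | I j) (1 + b' j) `^ (- 2^-1)).
  rewrite -h; last first.
    by move=> j _ Ij; rewrite -[RHS](Rint_cst P); apply: eq_Rintegral => x _; rewrite mulr0.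
  apply: eq_Rintegral => x _; rewrite cos0 mulr1 -sumrN expR_sum [RHS]big_mkcond.
  apply: eq_bigr => j _; rewrite /b' /p /masked; case: ifP => Ij.
    by congr expR; field.
  by rewrite mul0r mulr0 oppr0 expR0.
rewrite big_mkcond; apply: eq_bigr => j _; rewrite /b' /masked.
by case: (I j) => //; rewrite !mulr0 addr0 powR1.
Qed.

Lemma orthonormal_sqr_mgf n (t : R) : 0 <= t -> (forall j, 2 * (t * la j) < 1) ->
  (\int[P]_x (expR (t * \sum_(j < n) p j x))%:E =
  (\prod_(j < n) (1 - 2 * (t * la j)) `^ (- 2^-1))%:E)%E.
Proof.
move=> t0 t1; pose b j := 2 * (t * la j).
have b01 j : 0 <= b j < 1 by rewrite t1 andbT mulr_ge0// mulr_ge0// masked_ge0.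
have := gauss_sqr_expR HH He eo b01 (H_zero HH) (n := n).
rewrite dot00 mul0r expR0 mulr1 => h.
transitivity (\prod_(j < n | I j) (1 - b j) `^ (- 2^-1))%:E.
  rewrite -h; last first.
    by move=> j _ Ij; rewrite -[RHS](Rint_cst P); apply: eq_Rintegral => x _; rewrite mulr0.
  apply: eq_integral => x _; rewrite mulr1 mulr_sumr expR_sum [in RHS]big_mkcond.
  congr EFin; apply: eq_bigr => j _; rewrite /b /p /masked; case: ifP => Ij.
    by congr expR; field.
  by rewrite mul0r mulr0 expR0.
rewrite big_mkcond; congr EFin; apply: eq_bigr => j _.
by rewrite /b /masked; case: (I j) => //; rewrite !mulr0 subr0 powR1.
Qed.

End orthonormal_squares.

Theorem mainTheorem20 (R : realType) (d : measure_display)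
  (T : measurableType d) (P : probability T R)
  (H : set (T -> R)) (X : T -> R) (N : option nat) (lam : nat -> R) :
  gaussian_hilbert_space P H ->
  measurable_fun setT X ->
  P.-integrable setT (EFin \o X) ->
  (* (i) *)
  wick_chaos2 P H (fun w => X w - fine ('E_P[X])%E) ->
  (* (ii) *)
  {ae P, forall w, 0 <= X w} ->
  (forall eps : R, 0 < eps -> (0 < P [set w | (X w < eps)%R])%E) ->
  (* (iii) *)
  (forall xi, H xi ->
     (0 <= Bform P (fun w => (X w - fine ('E_P[X])%E)%R) xi xi)%E) ->
  enumerates_nonzero_eigenvalues P H (fun w => X w - fine ('E_P[X])%E) N lam ->
  [/\ (forall j, index_set N j -> 0 < lam j),
      (forall (d' : measure_display) (T' : measurableType d')
              (P' : probability T' R) (xi : nat -> T' -> R),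
         iid_std_normal P' xi ->
         {ae P', forall w,
            cvgn (fun n => \sum_(j < n | index_set N j) lam j * xi j w ^+ 2)} /\
         forall A : set R, measurable A ->
           P' [set w | A (limn (fun n =>
                 \sum_(j < n | index_set N j) lam j * xi j w ^+ 2))] =
           P (X @^-1` A)),
      cvgn (fun n => \sum_(j < n | index_set N j) lam j) /\
        ('E_P[X] = (limn (fun n => \sum_(j < n | index_set N j) lam j))%:E)%E &
      forall t : R, 2 * t * sup [set lam j | j in index_set N] < 1 ->
        exists L : R,
          (fun n => \prod_(j < n | index_set N j)
                      (1 - 2 * lam j * t) `^ (- 2^-1)) @ \oo --> L /\
          ('E_P[fun w => expR (t * X w)%R] = L%:E)%E].
Proof.
move=> HH mX iX Ych X0 Xsmall Bpos lam_enum.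
have EX := EFin_expectation iX.
set c := \int[P]_x X x in EX.
rewrite EX /= in Ych Bpos lam_enum.
have LY := chaos_L2 HH Ych.
have LX : L2 P X.
  rewrite (_ : X = fun x => (X x - c) + c); first by apply: L2D => //; exact: L2_cst.
  by apply/funext => x; rewrite subrK.
have Ymean : \int[P]_x (X x - c) = 0.
  rewrite (RintD iX (Int_cst P (- c))) Rint_cst; exact: subrr.
have Bq_ge0 xi : H xi -> 0 <= quad_form P (fun x => X x - c) xi xi.
  by move=> Hx; have := Bpos _ Hx; rewrite (BformE HH Ych)// lee_fin.
have lam0 := lam_gt0 HH Ych Bq_ge0 lam_enum.
have [e [ee eo ec]] := eigenbasis HH Ych Ymean Bq_ge0 lam_enum.
have He j : index_set N j -> H (e j) by move=> /ee[].
have cexp := chaos_expansion HH Ych Ymean Bq_ge0 ee eo ec.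
pose la := masked (index_set N) lam.
have la0 j : 0 <= la j := masked_ge0 lam0 j.
pose p j x := la j * e j x ^+ 2.
have p_ge0 j x : 0 <= p j x by rewrite mulr_ge0// sqr_ge0.
have p_L2 := orthonormal_sqr_L2 HH lam He.
have p_mean := orthonormal_sqr_mean HH lam He eo.
have p_laplace := orthonormal_sqr_laplace HH He eo lam0.
have p_Int j : P.-integrable setT (EFin \o p j) := L2_Int (p_L2 j).
have X_expansion : (fun n => L2dot P
    (fun x => (\sum_(j < n) p j x - \sum_(j < n) la j) - (X x - c))
    (fun x => (\sum_(j < n) p j x - \sum_(j < n) la j) - (X x - c))) @ \oo --> (0 : R).
  move: cexp; apply: cvg_trans; apply: near_eq_cvg; apply: nearW => n.
  rewrite dist2C.
  have SE x : \sum_(j < n | index_set N j) lam j * wick_square P (e j) x =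
      \sum_(j < n) p j x - \sum_(j < n) la j.
    rewrite big_mkcond -sumrB; apply: eq_bigr => j _.
    rewrite /p /la /masked; case: ifP => Ij; last by rewrite mul0r subr0.
    by rewrite /wick_square eo// eqxx mulrBr mulr1.
  by apply: eq_Rintegral => x _; rewrite SE.
have la_bound := chaos_mean_bound p_ge0 p_L2 p_mean p_laplace LX X0 X_expansion.
have cLam := chaos_mean p_ge0 p_L2 p_mean p_laplace LX X0 X_expansion Xsmall.
have X_series := chaos_ae_series p_ge0 p_L2 p_mean p_laplace LX X0 X_expansion Xsmall.
have lapX (s : R) : 0 <= s ->
    (fun n => \prod_(j < n) (1 + 2 * (s * la j)) `^ (- 2^-1)) @ \oo -->
    \int[P]_x expR (- (s * X x)).
  move=> s0; have := nonneg_series_laplace p_ge0 p_Int p_mean la_bound s0.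
  have -> : \int[P]_x expR (- (s * X x)) =
      \int[P]_x expR (- (s * limn (fun n => \sum_(j < n) p j x))).
    have mlim := nonneg_series_measurable p_ge0 p_Int.
    apply: Rint_ae_eq.
    - by do 2 apply: measurableT_comp => //; exact: measurable_funM.
    - by do 2 apply: measurableT_comp => //; exact: measurable_funM.
    - by apply: filterS X_series => x ->.
  apply: cvg_trans; apply: near_eq_cvg; apply: nearW => n.
  rewrite -(p_laplace n (fun=> s))//.
  by apply: eq_Rintegral => x _; rewrite mulr_sumr.
split.
- exact: lam0.
- move=> d' T' P' xi iid.
  pose p' j w := la j * xi j w ^+ 2.
  have p'_ge0 j w : 0 <= p' j w by rewrite mulr_ge0// sqr_ge0.
  have p'_Int j : P'.-integrable setT (EFin \o p' j) := iid_sqr_Int iid (la j) j.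
  have p'_mean j : \int[P']_w p' j w = la j := iid_sqr_mean iid (la j) j.
  have sE w : (fun n => \sum_(j < n | index_set N j) lam j * xi j w ^+ 2) =
      (fun n => \sum_(j < n) p' j w).
    by apply/funext => n; rewrite (masked_sum (index_set N) lam (fun j => xi j w ^+ 2)).
  split.
    apply: filterS (nonneg_series_ae_cvg p'_ge0 p'_Int p'_mean la_bound) => w cw.
    by rewrite sE; apply/cvg_ex; eexists; exact: cw.
  move=> A mA.
  rewrite (_ : [set w | _] = (fun w => limn (fun n => \sum_(j < n) p' j w)) @^-1` A); last first.
    by apply/seteqP; split => w /=; rewrite sE.
  apply: law_of_laplace => //.
  + exact: nonneg_series_measurable.
  + by apply: aeW => w; exact: nonneg_series_ge0.
  + move=> s s0; have h := nonneg_series_laplace p'_ge0 p'_Int p'_mean la_bound s0.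
    apply: (cvg_unique _ h); first exact: norm_hausdorff.
    apply: cvg_trans (lapX s s0); apply: near_eq_cvg; apply: nearW => n.
    by rewrite -(iid_sqr_laplace iid _ s0 la0).
- have sE : (fun n => \sum_(j < n | index_set N j) lam j) = (fun n => \sum_(j < n) la j).
    by apply/funext => n; rewrite masked_mean.
  rewrite sE EX; split; first by apply/cvg_ex; exists c.
  by rewrite (cvg_lim _ cLam).
- move=> t ht.
  have pE : (fun n => \prod_(j < n | index_set N j) (1 - 2 * lam j * t) `^ (- 2^-1)) =
      (fun n => \prod_(j < n) (1 - 2 * (t * la j)) `^ (- 2^-1)).
    apply/funext => n; rewrite (masked_prod _ _ (f := fun l => (1 - 2 * l * t) `^ (- 2^-1))).
      by apply: eq_bigr => j _; congr ((_ - _) `^ _); rewrite -mulrA (mulrC t).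
    by rewrite mulr0 mul0r subr0 powR1.
  have EE : ('E_P[fun w => expR (t * X w)%R] = \int[P]_w (expR (t * X w))%:E)%E.
    by rewrite unlock.
  rewrite pE EE.
  (* For [t <= 0] the exponentials are bounded and the Laplace transform at [- t] applies; for
     [t > 0] the threshold on [t] enters. *)
  have [t0|t0] := leP t 0.
    apply: (series_mgf_le0 p_ge0 p_Int p_mean la_bound mX X_series t0) => n.
    transitivity (\int[P]_x expR (- \sum_(j < n) (- t) * p j x)).
      by apply: eq_Rintegral => x _; rewrite -mulr_sumr mulNr opprK.
    rewrite (p_laplace n (fun=> - t)); last by move=> _; rewrite oppr_ge0.
    by apply: eq_bigr => j _; rewrite mulNr mulrN.
  (* Each eigenvalue is at most [c] because the partial sums are; boundedness is what makes [sup] a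
     genuine upper bound. *)
  have la_sup j : index_set N j -> lam j <= sup [set lam j | j in index_set N].
    move=> Ij; apply: sup_upper_bound; last by exists j.
    split; first by exists (lam j); exists j.
    exists c => _ [i Ii <-]; apply: le_trans (la_bound i.+1).
    rewrite big_ord_recr/= {2}/masked Ii lerDr.
    by apply: sumr_ge0 => k _; exact: la0.
  (* The maximum with 0 covers the masked indices, whose coefficient is 0. *)
  pose th := Num.max 0 (2 * t * sup [set lam j | j in index_set N]).
  have th1 : th < 1 by rewrite gt_max ltr01.
  have la_th j : 2 * (t * la j) <= th.
    rewrite le_max mulrA /la /masked; case: ifP => Ij; last by rewrite mulr0 lexx.
    by rewrite ler_wpM2l ?orbT ?la_sup// mulr_ge0// ltW.
  apply: (series_mgf_ge0 p_ge0 p_Int p_mean la_bound mX X_series (ltW t0) th1 la_th) => n.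
  apply: (orthonormal_sqr_mgf HH He eo lam0 n (ltW t0)) => j.
  exact: le_lt_trans (la_th j) th1.
Qed.
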